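(* Let $V:\mathbb{R}^n\to\mathbb{R}$ be a smooth function which is bounded above, and for $\varepsilon>0$ let $L_\varepsilon(x,v)=\frac12|v|^2-\varepsilon V(x)$ on $T\mathbb{R}^n$, with cost $$c_\varepsilon(x,y)=\inf\int_0^1L_\varepsilon(\gamma(t),\dot\gamma(t))\,dt,$$ the infimum being over all smooth curves $\gamma:[0,1]\to\mathbb{R}^n$ with $\gamma(0)=x$, $\gamma(1)=y$. For each $\varepsilon>0$ let $\mathcal U_\varepsilon$ be an open subset of $T\mathbb{R}^n$ all of whose elements are regular and outside the conjugate locus (for $L_\varepsilon$). Let $\mathcal U$ be a bounded open subset of $T\mathbb{R}^n$ such that, for some constant $C>0$, $$\int_0^1\int_0^\tau\Big\langle u,(1-t)\,\partial_s^2\,\mathrm{Hess}\,V_{x+t(v+sw)}\,u\Big\rangle\Big|_{s=0}\,dt\,d\tau\ \ge\ C \qquad( * )$$ for all $(x,v)\in\mathcal U$ and all unit vectors $u,w\in T_x\mathbb{R}^n$. Then for all small enough $\varepsilon>0$ the cost $c_\varepsilon$ is positively cross-curved on the set $$\mathcal K_\varepsilon=\{(x,\Phi_1^\varepsilon(x,\alpha)):(x,\alpha)\in\mathcal U_\varepsilon\cap\mathcal U\}.$$ If $( * )$ is only assumed to hold for all $(x,v)\in\mathcal U$ and all unit vectors $u,w\in T_x\mathbb{R}^n$ which are orthogonal to each other, then for all small enough $\varepsilon>0$ the cost $c_\varepsilon$ satisfies the strong Ma-Trudinger-Wang condition (A3s) on $\mathcal K_\varepsilon$.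
   Context: Tangent and cotangent spaces of $\mathbb{R}^n$ are identified by the Euclidean inner product; $\mathrm{Hess}\,V_p$ is the Hessian matrix of $V$ at $p$. Let $H_\varepsilon(x,v)=\frac12|v|^2+\varepsilon V(x)$ be the Hamiltonian of $L_\varepsilon$, $e^{t\vec H_\varepsilon}$ its Hamiltonian flow (where defined), $\pi(x,\alpha)=x$, and $\Phi_t^\varepsilon(x,\alpha)=\pi(e^{t\vec H_\varepsilon}(x,\alpha))$. An element $(x,\alpha)$ is regular if $t\in[0,1]\mapsto\Phi_t^\varepsilon(x,\alpha)$ is the unique path attaining the infimum defining $c_\varepsilon$ between its endpoints; it is in the conjugate locus if the map $\Phi_1^\varepsilon(x,\cdot)$ does not have full rank at $\alpha$. On $\mathcal K_\varepsilon$ the cost $c=c_\varepsilon$ is smooth. For $(x,\alpha)\in\mathcal U_\varepsilon\cap\mathcal U$, the $c$-exponential $\exp^c(x,\alpha)$ is the point $y$ with $(x,y)\in\mathcal K_\varepsilon$ and $d_xc(x,y)=-\alpha$. The cross-curvature is $$\mathcal C_x(u,\alpha,\alpha_1)=-\frac32\,\partial_s^2\partial_t^2\,c\big(\gamma(t),\exp^c(x,\alpha+s\alpha_1)\big)\Big|_{t=s=0},\quad (x,\alpha)\in\mathcal U_\varepsilon\cap\mathcal U,\ u\in T_x\mathbb{R}^n,\ \alpha_1\in T_x^*\mathbb{R}^n,$$ where $\gamma$ is any curve with $\gamma(0)=x$, $\dot\gamma(0)=u$. The cost is positively cross-curved on $\mathcal K_\varepsilon$ if $\mathcal C_x(u,\alpha,\alpha_1)\ge0$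 for all such arguments, with equality only if $u=0$ or $\alpha_1=0$. It satisfies the strong MTW condition (A3s) on $\mathcal K_\varepsilon$ if, for all such arguments with $\alpha_1(u)=0$, one has $\mathcal C_x(u,\alpha,\alpha_1)\ge0$, with equality only if $u=0$ or $\alpha_1=0$. *)

(* Defs.v *)
From mathcomp Require Import all_boot all_order all_algebra.
From mathcomp Require Import all_classical all_reals all_analysis.

Set Implicit Arguments.
Unset Strict Implicit.
Unset Printing Implicit Defensive.

Import Order.TTheory GRing.Theory Num.Theory.
Import numFieldNormedType.Exports.

Local Open Scope classical_set_scope.
Local Open Scope ring_scope.

(** The library norm on ['rV[R]_n] is the sup norm.  It is used only through
    the topology and the notion of differentiability, which are those of the
    Euclidean norm [enorm]. *)
Section Euclidean.
Context {R : realType} {n : nat}.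
Implicit Types u v : 'rV[R]_n.

Definition dotv u v : R := \sum_(i < n) u 0 i * v 0 i.

Definition enorm u : R := Num.sqrt (dotv u u).

Definition grad (f : 'rV[R]_n -> R) (x : 'rV[R]_n) : 'rV[R]_n :=
  \row_i 'D_(delta_mx 0 i) f x.

Definition Hess (f : 'rV[R]_n -> R) (x : 'rV[R]_n) : 'M[R]_n :=
  \matrix_(i, j) 'D_(delta_mx 0 i) ('D_(delta_mx 0 j) f) x.

End Euclidean.

Section Smoothness.
Context {R : realType}.

(** [Ck k f] says that [f] is of class C^k; it is meant for a
    finite-dimensional source [E], where C^1 amounts to the continuity of all
    directional derivatives. *)
Fixpoint Ck (k : nat) (E F : normedModType R) (f : E -> F) : Prop :=
  if k is k'.+1 then
    (forall x, differentiable f x) /\ (forall v, Ck k' ('D_v f))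
  else continuous f.

Definition smooth (E F : normedModType R) (f : E -> F) := forall k, Ck k f.

End Smoothness.

Section Flow.
Context {R : realType} {E : normedModType R}.
Variable X : E -> E.

(** [flow_graph t z0 z1]: the integral curve of [X] issued from [z0] exists on
    an open interval containing [0] and [t], and takes the value [z1] at [t]. *)
Definition flow_graph (t : R) (z0 z1 : E) :=
  exists (a b : R) (z : R -> E),
    [/\ a < 0 < b, a < t < b, z 0 = z0, z t = z1 &
        forall r, a < r < b -> is_derive r 1 z (X (z r))].

Definition flow_defined (t : R) (z0 : E) := exists z1, flow_graph t z0 z1.

(** This is [z0] when the flow is not defined at time [t]. *)
Definition flow (t : R) (z0 : E) : E := xget z0 (flow_graph t z0).

End Flow.

Section Mechanics.
Context {R : realType} {n : nat}.
Implicit Types (x y v a : 'rV[R]_n) (g : R -> 'rV[R]_n).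

Definition hamiltonian_field (H : 'rV[R]_n * 'rV[R]_n -> R)
    (z : 'rV[R]_n * 'rV[R]_n) : 'rV[R]_n * 'rV[R]_n :=
  (grad (fun p => H (z.1, p)) z.2, - grad (fun q => H (q, z.2)) z.1).

Variables (V : 'rV[R]_n -> R) (eps : R).

Definition lagrangian (z : 'rV[R]_n * 'rV[R]_n) : R :=
  2^-1 * enorm z.2 ^+ 2 - eps * V z.1.

Definition hamiltonian (z : 'rV[R]_n * 'rV[R]_n) : R :=
  2^-1 * enorm z.2 ^+ 2 + eps * V z.1.

(** A path [0,1] -> R^n is represented by a function on [R] of which only the
    values on [0,1] matter; it is smooth up to the end points when it is there
    the restriction of a smooth function on [R]. *)
Definition smooth_path g :=
  exists2 g0 : R -> 'rV[R]_n, smooth g0 & forall t, 0 <= t <= 1 -> g t = g0 t.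

Definition action g : R :=
  \int[lebesgue_measure]_(t in `[0, 1]) lagrangian (g t, derive1 g t).

Definition admissible x y g := [/\ smooth_path g, g 0 = x & g 1 = y].

Definition cost x y : R := inf [set action g | g in admissible x y].

Definition minimizer x y g := admissible x y g /\ action g = cost x y.

Definition Phi (t : R) x a : 'rV[R]_n :=
  (flow (hamiltonian_field hamiltonian) t (x, a)).1.

Definition regular x a :=
  [/\ flow_defined (hamiltonian_field hamiltonian) 1 (x, a),
      minimizer x (Phi 1 x a) (fun t => Phi t x a) &
      forall g, minimizer x (Phi 1 x a) g ->
        forall t, 0 <= t <= 1 -> g t = Phi t x a].

Definition conjugate_locus x a : Prop := (\rank ('J (Phi 1 x) a) < n)%N.

Definition Kset (D : set ('rV[R]_n * 'rV[R]_n)) : set ('rV[R]_n * 'rV[R]_n) :=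
  [set (z.1, Phi 1 z.1 z.2) | z in D].

End Mechanics.

Section CrossCurvature.
Context {R : realType} {n : nat}.
Implicit Types (x y u a : 'rV[R]_n) (g : R -> 'rV[R]_n).
Variables (c : 'rV[R]_n -> 'rV[R]_n -> R) (K : set ('rV[R]_n * 'rV[R]_n)).

Definition cexp x a : 'rV[R]_n :=
  get [set y | [/\ K (x, y), differentiable (c^~ y) x & grad (c^~ y) x = - a]].

(** The cross-curvature C_x(u, a, a1) computed with a curve [g] such that
    [g 0 = x] and [derive1 g 0 = u]. *)
Definition cross_curvature g x a a1 : R :=
  - (3 / 2) *
    derive1n 2 (fun s : R =>
      derive1n 2 (fun t : R => c (g t) (cexp x (a + s *: a1))) 0) 0.

Variable D : set ('rV[R]_n * 'rV[R]_n).

Definition positively_cross_curved :=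
  forall x a u a1 g, D (x, a) -> smooth g -> g 0 = x -> derive1 g 0 = u ->
    0 <= cross_curvature g x a a1 /\
    (cross_curvature g x a a1 = 0 -> u = 0 \/ a1 = 0).

Definition strong_MTW :=
  forall x a u a1 g, D (x, a) -> smooth g -> g 0 = x -> derive1 g 0 = u ->
    dotv a1 u = 0 ->
    0 <= cross_curvature g x a a1 /\
    (cross_curvature g x a a1 = 0 -> u = 0 \/ a1 = 0).

End CrossCurvature.

Section Condition.
Context {R : realType} {n : nat}.

Definition hess_integral (V : 'rV[R]_n -> R) (x v u w : 'rV[R]_n) : R :=
  \int[lebesgue_measure]_(tau in `[0, 1])
    \int[lebesgue_measure]_(t in `[0, tau])
      dotv u (u *m ((1 - t) *:
        derive1n 2 (fun s : R => Hess V (x + t *: (v + s *: w))) 0)^T).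

End Condition.

(* Main.v *)
(** For small [eps] the motion stays in a fixed ball, where the initial and the
    boundary value problems for [q'' = - eps grad V q] are fixed point equations
    with contraction factor 1/2 for two integral operators; this replaces the
    implicit function theorem and Gronwall's lemma.  Perturbing the minimizer
    issued from [(x, a)] by [(1 - t) w] bounds [c (x + w, y) - c (x, y) + <a, w>]
    from above by [O(|w|^2)]; the elements near [(x, a)] that lead to the same
    [y] are regular too, which gives the opposite bound.  Hence [c (., y)] has
    gradient [- a] at [x], and [exp^c (x, a) = Phi_1 (x, a)].  Differentiating
    [- a] along a curve [g] with [g' 0 = u] brings in the Jacobi field [J] with
    [J 0 = u] and [J 1 = 0] along the trajectory [q] of [(x, a)]:
      [d_t^2 c = |u|^2 - eps <u, int_0^1 int_0^tau Hess V (q t) (J t) dt dtau>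
                 - <a, g'' 0>].
    With [a + s a1] in place of [a], the first and the last term disappear under
    [d_s^2], while [q t = x + t (a + s a1) + O(eps)] and [J t = (1 - t) u + O(eps)]
    together with their first two derivatives in [s].  So the cross-curvature is
    [3/2 eps] times the integral in the hypothesis, up to [O(eps^2)]. *)
Require Import Defs.
From HB Require Import structures.
From mathcomp Require Import all_boot all_order all_algebra.
From mathcomp Require Import all_classical all_reals all_analysis.
From mathcomp Require Import ring lra.

Set Implicit Arguments.
Unset Strict Implicit.
Unset Printing Implicit Defensive.

Import Order.TTheory GRing.Theory Num.Theory.
Import numFieldNormedType.Exports.
Local Open Scope classical_set_scope.
Local Open Scope ring_scope.

(** * Integral operators on [0,1] *)

(** The threshold for [eps] must be fixed before the point, the two vectors and the curve, although
    [u] and [a1] range over unbounded sets. The cross-curvature turns out to be quadratically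
    homogeneous in each of them, so all estimates are made for their Euclidean unit directions, with
    the parameter [s] in [[-1, 1]]. The constants then depend only on [n], on one ball containing
    all the paths, and on bounds for [V] and its derivatives there. As the whole curvature carries a
    factor [eps], it is enough that the rest be within [C / 2] of the integral in the hypothesis.
    Another obstacle is that [flow] and [cexp] are chosen values and [cost] is an infimum. Each is
    pinned down by a uniqueness or minimality statement: integral curves coincide with the fixed
    point of a contraction, the gradient of the cost determines the end point, and regularity gives
    the value of the infimum. Norms are sup norms, which is where the factors [n] in the estimates
    come from. *)

Definition cont01 {R : realType} {T : topologicalType} (f : R -> T) : Prop :=
  {within `[0, 1], continuous f}.

Section Integrals.
Context {R : realType}.
Implicit Types f g : R -> R.
Notation mu := (@lebesgue_measure R).

Definition prim f (t : R) : R := \int[mu]_(r in `[0, t]) f r.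

Lemma cont01_integrable f t : cont01 f -> t <= 1 -> mu.-integrable `[0, t] (EFin \o f).
Proof.
move=> cf t1; apply: continuous_compact_integrable; first exact: segment_compact.
apply: continuous_subspaceW cf => x /=; rewrite !in_itv/= => /andP[-> xt].
exact: le_trans t1.
Qed.

Lemma prim_ext f g t : (forall r, 0 <= r <= t -> f r = g r) -> prim f t = prim g t.
Proof. by move=> fg; apply: eq_Rintegral => r; rewrite inE/= in_itv/= => /fg. Qed.

Lemma primD f g t : cont01 f -> cont01 g -> t <= 1 ->
  prim (fun r => f r + g r) t = prim f t + prim g t.
Proof. by move=> cf cg t1; apply: RintegralD => //; exact: cont01_integrable. Qed.

Lemma primZ a f t : cont01 f -> t <= 1 -> prim (fun r => a * f r) t = a * prim f t.
Proof. by move=> cf t1; apply: RintegralZl => //; exact: cont01_integrable. Qed.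

Lemma prim_le f g t : cont01 f -> cont01 g -> t <= 1 -> (forall r, 0 <= r <= t -> f r <= g r) ->
  prim f t <= prim g t.
Proof.
move=> cf cg t1 fg; apply: le_Rintegral => [//|||x /=]; [exact: cont01_integrable..|].
by rewrite in_itv/=; exact: fg.
Qed.

Lemma cont01_cst (c : R) : cont01 (fun _ : R => c).
Proof. by apply: continuous_subspaceT => x; exact: cvg_cst. Qed.

Lemma prim_cst (c : R) t : 0 <= t -> prim (fun=> c) t = c * t.
Proof.
move=> t0; rewrite /prim Rintegral_cst//= lebesgue_measure_itv/= lte_fin.
by case: ltgtP t0 => // [t_gt0|<-] _; rewrite ?mulr0 ?subr0// oppr0 addr0.
Qed.

Lemma cont01_prim f : cont01 f -> cont01 (prim f).
Proof.
by move=> cf; apply: parameterized_integral_continuous; [exact: ler01|exact: cont01_integrable].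
Qed.

Lemma prim_bound f M t : cont01 f -> 0 <= t <= 1 -> (forall r, 0 <= r <= t -> `|f r| <= M) ->
  `|prim f t| <= M * t.
Proof.
move=> cf /andP[t0 t1] fM; rewrite ler_norml -mulNr -!(prim_cst _ t0).
apply/andP; split; apply: prim_le => //; try exact: cont01_cst.
  by move=> r /fM; rewrite ler_norml => /andP[].
by move=> r /fM; rewrite ler_norml => /andP[].
Qed.

Lemma cont01_D f g : cont01 f -> cont01 g -> cont01 (fun r : R => f r + g r).
Proof. by move=> cf cg x; apply: continuousD; [exact: cf|exact: cg]. Qed.
Lemma cont01_M f g : cont01 f -> cont01 g -> cont01 (fun r : R => f r * g r).
Proof. by move=> cf cg x; apply: continuousM; [exact: cf|exact: cg]. Qed.
Lemma cont01_Z a f : cont01 f -> cont01 (fun r : R => a * f r).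
Proof. by move=> cf; apply: cont01_M => //; exact: cont01_cst. Qed.
Lemma cont01_id : cont01 (fun r : R => r).
Proof. by apply: continuous_subspaceT => x; exact: cvg_id. Qed.
Lemma cont01_sum (I : finType) (F : I -> R -> R) :
  (forall i, cont01 (F i)) -> cont01 (fun r : R => \sum_i F i r).
Proof.
move=> cF; elim: (index_enum I) => [|i l IH].
  by under eq_fun do rewrite big_nil; exact: cont01_cst.
by under eq_fun do rewrite big_cons; exact: cont01_D.
Qed.

Definition prim2 f := prim (prim f).

Lemma prim2_prim f t : prim2 f t = prim (prim f) t.
Proof. by []. Qed.

Lemma prim2E f t :
  prim2 f t = \int[mu]_(tau in `[0, t]) \int[mu]_(r in `[0, tau]) f r.
Proof. by []. Qed.

Lemma cont01_prim2 f : cont01 f -> cont01 (prim2 f).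
Proof. by move=> cf; do 2 apply: cont01_prim. Qed.

Lemma prim2_ext f g t : (forall r, 0 <= r <= t -> f r = g r) -> prim2 f t = prim2 g t.
Proof.
move=> fg; apply: prim_ext => r /andP[r0 rt]; apply: prim_ext => r' /andP[r'0 r't].
by apply: fg; rewrite r'0 (le_trans r't).
Qed.

Lemma prim2D f g t : cont01 f -> cont01 g -> 0 <= t <= 1 ->
  prim2 (fun r => f r + g r) t = prim2 f t + prim2 g t.
Proof.
move=> cf cg /andP[t0 t1]; rewrite /prim2 -primD//; [|exact: cont01_prim..].
by apply: prim_ext => r /andP[r0 rt]; rewrite primD// (le_trans rt).
Qed.

Lemma prim2Z a f t : cont01 f -> 0 <= t <= 1 -> prim2 (fun r => a * f r) t = a * prim2 f t.
Proof.
move=> cf /andP[t0 t1]; rewrite /prim2 -primZ//; [|exact: cont01_prim].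
by apply: prim_ext => r /andP[r0 rt]; rewrite primZ// (le_trans rt).
Qed.

Lemma prim_FTC (f F : R -> R) (T : R) : 0 <= T <= 1 -> cont01 f ->
  (forall r, 0 <= r <= T -> is_derive r 1 F (f r)) -> prim f T = F T - F 0.
Proof.
move=> /andP[T0 T1] cf dF; move: T0; rewrite le_eqVlt => /predU1P[<-|T0].
  by rewrite /prim set_itv1 Rintegral_set1 subrr.
have FC r : 0 <= r <= T -> {for r, continuous F}.
  move=> /dF dFr; apply: differentiable_continuous; apply/derivable1_diffP.
  exact: ex_derive.
rewrite /prim /Rintegral (@continuous_FTC2 R f F 0 T)//.
- apply: continuous_subspaceW cf => x /=; rewrite !in_itv/= => /andP[-> xt].
  exact: le_trans T1.
- split.
  + move=> x; rewrite in_itv/= => /andP[x0 xT]; apply: (@ex_derive _ _ _ _ _ _ _ (dF x _)).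
    by rewrite !ltW.
  + by apply: cvg_at_right_filter; apply: FC; rewrite lexx ltW.
  + by apply: cvg_at_left_filter; apply: FC; rewrite lexx ltW.
- move=> x; rewrite in_itv/= => /andP[x0 xT]; rewrite derive1E.
  by apply: (@derive_val _ _ _ _ _ _ _ (dF x _)); rewrite !ltW.
Qed.

(** The factor [1/2] is that of [t^2 / 2]. It lets [bvp], a difference of two such terms, keep the
    bound [M]. *)
Lemma prim2_bound f M t : 0 <= M -> cont01 f -> 0 <= t <= 1 ->
  (forall r, 0 <= r <= t -> `|f r| <= M) -> `|prim2 f t| <= M / 2.
Proof.
move=> M0 cf t01 fM.
have cid : cont01 (fun r : R => M * r) by apply: cont01_Z; exact: cont01_id.
have [t0 t1] := andP t01.
have h r : 0 <= r <= t -> `|prim f r| <= M * r.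
  move=> /andP[r0 rt]; apply: prim_bound => //; first by rewrite r0 (le_trans rt).
  by move=> r' /andP[r'0 r'r]; apply: fM; rewrite r'0 (le_trans r'r).
have primM : prim (fun r => M * r) t <= M / 2.
  have t0' : cont01 (fun r : R => r) by exact: cont01_id.
  have dF r : 0 <= r <= t -> is_derive r 1 (fun s => M / 2 * s ^+ 2) (M * r).
    move=> _; have h1 : is_derive r 1 (fun s : R => s ^+ 2) (2 * r).
      by apply: is_derive_eq; rewrite /GRing.scale/=; lra.
    by apply: is_derive_eq; rewrite /GRing.scale/=; lra.
  rewrite (prim_FTC t01 cid dF) expr0n/= mulr0 subr0.
  by rewrite ler_piMr ?divr_ge0// expr_le1.
rewrite ler_norml; apply/andP; split.
  rewrite lerNl; apply: le_trans primM.
  rewrite -mulN1r -primZ//; last exact: cont01_prim.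
  apply: prim_le => //; first by apply: cont01_Z; exact: cont01_prim.
  by move=> r /h; rewrite mulN1r ler_norml lerNl => /andP[].
apply: le_trans primM; apply: prim_le => //; first exact: cont01_prim.
by move=> r /h; rewrite ler_norml => /andP[].
Qed.

(** A path is prescribed only on [[0, 1]], so its [derive1] is controlled only in the open interval.
    The end points form a null set. *)
Lemma prim_interior f g : cont01 g -> (forall t, 0 < t < 1 -> f t = g t) ->
  \int[mu]_(t in `[0, 1]) f t = prim g 1.
Proof.
move=> Wg fg; rewrite /prim /Rintegral; congr fine.
have mg : measurable_fun (`]0, 1[ : set (measurableTypeR R)) g.
  have /integrableP[/measurable_realfun.measurable_EFinP mg _] := cont01_integrable Wg (lexx 1).
  by apply: measurable_funS mg => //; exact: subset_itv_oo_cc.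
have mf : measurable_fun (`]0, 1[ : set (measurableTypeR R)) f.
  apply: (eq_measurable_fun g) mg => t; rewrite inE/= in_itv/= => t01.
  by rewrite (fg _ t01).
apply: eq_integral_itv_bounded; [exact: mf|exact: mg|] => t; rewrite in_itv/= => t01.
by rewrite (fg _ t01).
Qed.

End Integrals.
#[global] Opaque prim prim2.

(** Applied to the least upper bound, the improvement reads [sup A <= d + sup A / 2]. The crude
    bound [B] makes this supremum finite and does not enter the result. *)
Lemma contraction_bound {R : realType} (S : Type) (D : set S) (f : S -> R) (d B : R) :
  (forall s, D s -> f s <= B) ->
  (forall M, (forall s, D s -> f s <= M) -> forall s, D s -> f s <= d + M / 2) ->
  forall s, D s -> f s <= 2 * d.
Proof.
move=> fB H s Ds; set A := [set f s | s in D].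
have nA : A !=set0 by exists (f s), s.
have ubA : has_ubound A by exists B => _ [s' Ds' <-]; exact: fB.
have Asup s' : D s' -> f s' <= sup A by move=> Ds'; apply: ub_le_sup => //; exists s'.
have : sup A <= d + sup A / 2 by apply: ge_sup => // _ [s' Ds' <-]; exact: H.
by have := Asup _ Ds; lra.
Qed.

(** * Green operators on vector-valued paths and Picard iteration *)

Section Vector.
Context {R : realType}.

(* The bounds shared by [prim2] and [bvp], which solve [q'' = f] with zero initial
   data and [q'' = - f] with zero boundary data. *)
Record green (T : (R -> R) -> R -> R) : Prop := {
  green_W : forall f : R -> R, cont01 f -> cont01 (T f);
  greenD : forall (f g : R -> R) (t : R), cont01 f -> cont01 g -> 0 <= t <= 1 ->
    T (fun r => f r + g r) t = T f t + T g t;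
  greenZ : forall (a : R) (f : R -> R) (t : R), cont01 f -> 0 <= t <= 1 -> T (fun r => a * f r) t = a * T f t;
  green_bound : forall (f : R -> R) (M t : R), 0 <= M -> cont01 f -> 0 <= t <= 1 ->
    (forall r : R, 0 <= r <= 1 -> `|f r| <= M) -> `|T f t| <= M }.

Definition bvp (f : R -> R) (t : R) : R := t * prim2 f 1 - prim2 f t.

Lemma le01 : 0 <= (1 : R) <= 1. Proof. by rewrite ler01 lexx. Qed.

Lemma green_prim2 : green prim2.
Proof.
split; [exact: cont01_prim2|exact: prim2D|exact: prim2Z|].
move=> f M t M0 cf t01 fM; apply: le_trans (prim2_bound M0 cf t01 _) _.
  by case/andP: t01 => t0 t1 r /andP[r0 rt]; apply: fM; rewrite r0 (le_trans rt).
lra.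
Qed.

Lemma cont01_N (f : R -> R) : cont01 f -> cont01 (fun r : R => - f r).
Proof. by move=> cf x; apply: continuousN; exact: cf. Qed.

Lemma cont01_B (f g : R -> R) : cont01 f -> cont01 g -> cont01 (fun r : R => f r - g r).
Proof. by move=> cf cg; apply: cont01_D => //; exact: cont01_N. Qed.

Lemma green_bvp : green bvp.
Proof.
split.
- move=> f cf; apply: cont01_B; last exact: cont01_prim2.
  by apply: cont01_M; [exact: cont01_id|exact: cont01_cst].
- move=> f g t cf cg t01; rewrite /bvp (prim2D cf cg t01) (prim2D cf cg le01).
  by move: (prim2 f 1) (prim2 g 1) (prim2 f t) (prim2 g t) => *; ring.
- move=> a f t cf t01; rewrite /bvp (prim2Z a cf t01) (prim2Z a cf le01).
  by move: (prim2 f 1) (prim2 f t) => *; ring.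
- move=> f M t M0 cf t01 fM; rewrite /bvp.
  have h1 : `|prim2 f 1| <= M / 2 by apply: prim2_bound => //; exact: le01.
  have h2 : `|prim2 f t| <= M / 2.
    apply: prim2_bound => // r /andP[r0 rt]; apply: fM.
    by case/andP: t01 => _ t1; rewrite r0 (le_trans rt).
  apply: le_trans (ler_normB _ _) _; rewrite normrM (splitr M) lerD//.
  case/andP: t01 => t0 t1; rewrite (ger0_norm t0); apply: le_trans h1.
  by rewrite ler_piMl.
Qed.

Context {n : nat}.
Implicit Types (v : 'rV[R]_n) (X Y Z f g : R -> 'rV[R]_n) (r t M e : R).

Lemma rV_normP v (M : R) : 0 <= M -> (`|v| <= M <-> forall i, `|v 0 i| <= M).
Proof.
move=> M0; split=> [vM i|H].
  by apply: le_trans vM; rewrite [leRHS]/Num.Def.normr/= mx_normrE (le_bigmax _ _ (0, i)).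
rewrite [leLHS]/Num.Def.normr/= mx_normrE (bigmax_le _ M0)//= => -[i j] _ /=.
by rewrite ord1; exact: H.
Qed.

Lemma coord_le v i : `|v 0 i| <= `|v|.
Proof. by move: i; apply/(rV_normP v (normr_ge0 v)). Qed.

Lemma cont01_rVP f : cont01 f <-> forall i, cont01 (fun r : R => f r 0 i).
Proof.
split=> [cf i x|H].
  apply: (@continuous_comp (subspace `[0 : R, 1]) 'rV[R]_n R f (fun v : 'rV_n => v 0 i)).
    exact: cf.
  exact: coord_continuous.
rewrite /cont01; apply/subspace_continuousP => x x01; apply/cvgrPdist_le => e e0.
have : \forall t \near within `[0, 1] (nbhs x), forall i, `|f x 0 i - f t 0 i| <= e.
  apply: filter_forall => i.
  by have /subspace_continuousP/(_ _ x01)/cvgrPdist_le/(_ _ e0) := H i.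
apply: filterS => t tH; apply/(rV_normP (f x - f t) (ltW e0)) => i.
by have := tH i; rewrite !mxE.
Qed.

Lemma cont01_bounded f : cont01 f -> exists2 M, 0 <= M & forall t : R, 0 <= t <= 1 -> `|f t| <= M.
Proof.
move=> cf; have : compact (f @` `[0, 1]%classic).
  by apply: continuous_compact => //; exact: segment_compact.
move=> /compact_bounded[M [Mr fM]]; exists (`|M| + 1); first by rewrite addr_ge0.
move=> t t01; apply: (fM (`|M| + 1)); last by exists t => //=; rewrite in_itv.
by rewrite ltr_pwDr// ler_norm.
Qed.

Lemma cont01_uniform f : (forall e : R, 0 < e -> exists2 g : R -> 'rV[R]_n, cont01 g &
  forall t : R, 0 <= t <= 1 -> `|f t - g t| <= e) -> cont01 f.
Proof.
move=> H; rewrite /cont01; apply/subspace_continuousP => x x01; apply/cvgrPdist_le => e e0.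
have [g cg fg] := H (e / 3) ltac:(lra).
have : \forall t \near within `[0, 1] (nbhs x), `|g x - g t| <= e / 3.
  by apply: (cvgrPdist_le _ _).1; [move/subspace_continuousP : cg; exact|lra].
have : \forall t \near within `[0, 1] (nbhs x), `[0, 1]%classic t by exact: withinT.
move=> H1 H2; apply: filterS2 H1 H2 => t t01 gt.
have -> : f x - f t = (f x - g x) + (g x - g t) + - (f t - g t).
  by rewrite opprB !addrA subrK subrK.
apply: le_trans (ler_normD _ _) _; rewrite normrN.
apply: le_trans (lerD (ler_normD _ _) (lexx _)) _.
by have := fg _ x01; have := fg _ t01; lra.
Qed.

Definition vop (T : (R -> R) -> R -> R) f (t : R) : 'rV[R]_n :=
  \row_i T (fun r => f r 0 i) t.

Lemma cont01_vD f g : cont01 f -> cont01 g -> cont01 (fun r : R => f r + g r).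
Proof. by move=> cf cg x; apply: continuousD; [exact: cf|exact: cg]. Qed.
Lemma cont01_vZ (a : R -> R) f : cont01 a -> cont01 f -> cont01 (fun r : R => a r *: f r).
Proof. 
move=> ca /cont01_rVP cf; apply/cont01_rVP => i; under eq_fun do rewrite mxE.
by apply: cont01_M => //; exact: cf.
 Qed.
Lemma cont01_vN f : cont01 f -> cont01 (fun r : R => - f r).
Proof. by move=> cf x; apply: continuousN; exact: cf. Qed.
Lemma cont01_vcst v : cont01 (fun _ : R => v).
Proof. by apply: continuous_subspaceT => x; exact: cvg_cst. Qed.

Variables (T : (R -> R) -> R -> R) (gT : green T).

Lemma vop_W f : cont01 f -> cont01 (vop T f).
Proof.
move=> /cont01_rVP cf; apply/cont01_rVP => i; have := green_W gT (cf i).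
by congr cont01; apply/funext => r; rewrite mxE.
Qed.

Lemma vopD f g t : cont01 f -> cont01 g -> 0 <= t <= 1 ->
  vop T (fun r => f r + g r) t = vop T f t + vop T g t.
Proof.
move=> /cont01_rVP cf /cont01_rVP cg t01; apply/rowP => i; rewrite !mxE -(greenD gT)//.
by congr T; apply/funext => r; rewrite mxE.
Qed.

Lemma vopZ a f t : cont01 f -> 0 <= t <= 1 -> vop T (fun r => a *: f r) t = a *: vop T f t.
Proof.
move=> /cont01_rVP cf t01; apply/rowP => i; rewrite !mxE -(greenZ gT)//.
by congr T; apply/funext => r; rewrite mxE.
Qed.

Lemma vopB f g t : cont01 f -> cont01 g -> 0 <= t <= 1 ->
  vop T (fun r => f r - g r) t = vop T f t - vop T g t.
Proof.
move=> cf cg t01; rewrite -scaleN1r -vopZ// -vopD//; last exact: (cont01_vZ (@cont01_cst R (-1))).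
by congr vop; apply/funext => r; rewrite scaleN1r.
Qed.

Lemma vop_bound f M t : 0 <= M -> cont01 f -> 0 <= t <= 1 ->
  (forall r : R, 0 <= r <= 1 -> `|f r| <= M) -> `|vop T f t| <= M.
Proof.
move=> M0 /cont01_rVP cf t01 fM; apply/rV_normP => // i; rewrite mxE.
apply: (green_bound gT) => // r r01; apply: le_trans (fM _ r01); exact: coord_le.
Qed.

(** Limits of the iterates are taken separately for each [t]. The geometric rate is uniform in [t],
    and this yields both the continuity of the limit and the passage to the limit in the
    equation. *)
Lemma picard (F : R -> 'rV[R]_n -> 'rV[R]_n) (a : R -> 'rV[R]_n) (e L : R) :
  (forall Z, cont01 Z -> cont01 (fun r : R => F r (Z r))) ->
  (forall (r : R) (x y : 'rV[R]_n), 0 <= r <= 1 -> `|F r x - F r y| <= L * `|x - y|) ->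
  0 <= L -> `|e| * L <= 2^-1 -> cont01 a ->
  exists2 Z, cont01 Z &
    forall t : R, 0 <= t <= 1 -> Z t = a t + e *: vop T (fun r => F r (Z r)) t.
Proof.
move=> FW FL L0 eL Wa.
pose st Z t := a t + e *: vop T (fun r => F r (Z r)) t.
have stW Z : cont01 Z -> cont01 (st Z).
  by move=> WZ; apply: cont01_vD => //; apply: (cont01_vZ (@cont01_cst R e)); apply: vop_W; exact: FW.
have stL (Y Z : R -> 'rV[R]_n) (M : R) : cont01 Y -> cont01 Z -> 0 <= M -> (forall r : R, 0 <= r <= 1 -> `|Y r - Z r| <= M) ->
    forall t : R, 0 <= t <= 1 -> `|st Y t - st Z t| <= M / 2.
  move=> WY WZ M0 YZ t t01; rewrite /st opprD addrACA subrr add0r -scalerBr normrZ.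
  rewrite -vopB//; [|exact: FW..].
  have : `|vop T (fun r => F r (Y r) - F r (Z r)) t| <= L * M.
    apply: vop_bound => //; first by rewrite mulr_ge0.
      by apply: cont01_vD; [|apply: cont01_vN]; exact: FW.
    move=> r r01; apply: le_trans (FL _ _ _ r01) _.
    by rewrite ler_wpM2l// YZ.
  move=> /(ler_wpM2l (normr_ge0 e)) /le_trans; apply.
  by rewrite mulrA [M / 2]mulrC ler_wpM2r.
pose X k := iter k st a.
have XW k : cont01 (X k) by elim: k => //= k; exact: stW.
have [M M0 XM] : exists2 M, 0 <= M & forall t : R, 0 <= t <= 1 -> `|X 1%N t - X 0%N t| <= M.
  by apply: cont01_bounded; apply: cont01_vD; [|apply: cont01_vN]; exact: XW.
have XS k : forall t : R, 0 <= t <= 1 -> `|X k.+1 t - X k t| <= M / 2 ^+ k.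
  elim: k => [|k IH]; first by rewrite divr1.
  move=> t t01; rewrite exprSr invfM mulrA.
  apply: (stL (X k.+1) (X k)) => //.
  by rewrite divr_ge0// exprn_ge0.
(* The subtracted term is the tail of the geometric series. Keeping it makes the induction on [j]
   close. *)
have Xd k j (t : R) : 0 <= t <= 1 -> `|X (k + j)%N t - X k t| <= 2 * (M / 2 ^+ k) - 2 * (M / 2 ^+ (k + j)).
  move=> t01; elim: j => [|j IH]; first by rewrite addn0 !subrr normr0.
  rewrite -(subrK (X (k + j)%N t) (X (k + j.+1)%N t)) -addrA.
  apply: le_trans (ler_normD _ _) _; have := XS (k + j)%N t t01; rewrite -addnS => h.
  apply: le_trans (lerD h IH) _; rewrite addnS exprSr invfM.
  by set y := (2 ^+ (k+j))^-1; lra.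
have Xd2 k m (t : R) : 0 <= t <= 1 -> (k <= m)%N -> `|X m t - X k t| <= 2 * M / 2 ^+ k.
  move=> t01 /subnKC <-; apply: le_trans (Xd _ _ _ t01) _.
  have : 0 <= M / 2 ^+ (k + (m - k)) by rewrite divr_ge0// exprn_ge0.
  by lra.
have small (e' : R) : 0 < e' -> exists k, 2 * M / 2 ^+ k <= e'.
  move=> e'0; have : (fun k => (2 * M) * (2^-1) ^+ k) @ \oo --> (2 * M * 0 : R).
    apply: cvgM; first exact: cvg_cst.
    by apply: cvg_expr; rewrite ger0_norm ?invr_ge0//; lra.
  rewrite mulr0 => /cvgrPdist_le/(_ _ e'0)[k _ /(_ k (leqnn _))].
  by rewrite sub0r normrN exprVn => h; exists k; apply: le_trans h; exact: ler_norm.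
have Xc (t : R) : 0 <= t <= 1 -> cvgn (fun k => X k t).
  move=> t01; apply: cauchy_cvg; apply: cauchy_exP => e' e'0.
  have [k ke] := small (e' / 2) ltac:(lra); exists (X k t), k => // m /= km.
  rewrite -ball_normE /= distrC; apply: le_lt_trans (Xd2 _ _ _ t01 km) _.
  by apply: le_lt_trans ke _; lra.
pose Z t := lim (X ^~ t @ \oo).
have XZ k (t : R) : 0 <= t <= 1 -> `|Z t - X k t| <= 2 * M / 2 ^+ k.
  move=> t01; apply/ler_addgt0Pr => eta eta0.
  have /cvgrPdist_le/(_ _ eta0)[m _ mH] := Xc t t01.
  rewrite -(subrK (X (maxn m k) t) (Z t)) -addrA addrC.
  apply: le_trans (ler_normD _ _) (lerD _ _).
    by apply: Xd2; rewrite ?leq_maxr.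
  by apply: mH => /=; exact: leq_maxl.
have WZ : cont01 Z.
  apply: cont01_uniform => e' /small[k ke]; exists (X k) => // t t01.
  exact: le_trans (XZ _ _ t01) ke.
exists Z => // t t01; apply/eqP; rewrite -subr_eq0 -normr_le0; apply/ler_addgt0Pr => e' e'0.
have [k ke] := small (e' / 2) ltac:(lra).
rewrite add0r -/(st Z t) -(subrK (X k.+1 t) (Z t)) -addrA.
apply: le_trans (ler_normD _ _) _.
have h1 : `|st (X k) t - st Z t| <= (e' / 2) / 2.
  apply: (stL (X k) Z) => //; first lra.
  by move=> r r01; rewrite distrC (le_trans (XZ _ _ r01)).
have h2 : `|Z t - X k.+1 t| <= e' / 2.
  apply: le_trans (XZ _ _ t01) (le_trans _ ke).
  rewrite ler_wpM2l//; first lra.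
  by rewrite lef_pV2 ?posrE ?exprn_gt0// ler_weXn2l//; lra.
by move: h1 h2; rewrite /X /= -/(X k); lra.
Qed.

End Vector.

Notation "''d_' i h" := ('D_(delta_mx 0 i) h) (at level 10, i at level 8, h at level 8).

(** * Uniform Taylor bounds for smooth functions on a ball *)

Section Smooth.
Context {R : realType} {n : nat}.
Implicit Types (h : 'rV[R]_n -> R) (x y w : 'rV[R]_n) (M B : R).

Lemma smooth_D (E F : normedModType R) (f : E -> F) v : smooth f -> smooth ('D_v f).
Proof. by move=> sf k; have [_] := sf k.+1; exact. Qed.

Lemma smooth_diff (E F : normedModType R) (f : E -> F) (x : E) : smooth f -> differentiable f x.
Proof. by move=> sf; have [] := sf 1%N. Qed.

Lemma smooth_cont (E F : normedModType R) (f : E -> F) : smooth f -> continuous f.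
Proof. by move=> sf; exact: (sf 0%N). Qed.

Lemma deriveE_sum h x w : differentiable h x -> 'D_w h x = \sum_k w 0 k * 'd_k h x.
Proof.
move=> dh; rewrite deriveE// {1}(row_sum_delta w) linear_sum.
by apply: eq_bigr => k _; rewrite linearZ /= deriveE.
Qed.


Lemma is_derive_line h x w (t : R) : (forall y, differentiable h y) ->
  is_derive t 1 (fun t : R => h (x + t *: w)) ('D_w h (x + t *: w)).
Proof.
move=> dh; set y := x + t *: w.
have E : (fun u : R => u^-1 *: (((fun t : R => h (x + t *: w)) \o shift t) (u *: 1) - h y))
    = (fun u : R => u^-1 *: ((h \o shift y) (u *: w) - h y)).
  apply/funext => u /=; rewrite /y [u *: 1]mulr1 scalerDl addrCA.
  by [].
apply: DeriveDef; rewrite /derivable /derive E//.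
exact: diff_derivable.
Qed.

Lemma box_bounded h M : continuous h -> exists2 B : R, 0 <= B &
  forall x, `|x| <= M -> `|h x| <= B.
Proof.
move=> ch; have : compact (h @` [set x | `|x| <= M]).
  apply: continuous_compact; first exact: continuous_subspaceT.
  apply: bounded_closed_compact.
    exists M; split; first exact: num_real.
    by move=> u Mu x /= /le_trans; apply; exact: ltW.
  apply: (@preimage_closed _ _ (fun x : 'rV[R]_n => `|x|) [set y | y <= M]); last exact: closed_le.
  by move=> x _; exact: norm_continuous.
move=> /compact_bounded[B [Br hB]]; exists (`|B| + 1); first by rewrite addr_ge0.
move=> x xM; apply: (hB (`|B| + 1)); last by exists x.
by rewrite ltr_pwDr// ler_norm.
Qed.

Lemma sum_le_n m (F : 'I_m -> R) B : (forall i, `|F i| <= B) ->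
  `|\sum_i F i| <= m%:R * B.
Proof.
move=> FB; apply: le_trans (ler_norm_sum _ _ _) _.
apply: le_trans (ler_sum _ (fun i _ => FB i)) _.
by rewrite sumr_const card_ord mulr_natl.
Qed.

(** The two bounds on the intermediate point allow a second application, between [x] and [z], which
    produces the quadratic remainder in [smooth_tame]. *)
Lemma mean_value h x y M : (forall z, differentiable h z) ->
  `|x| <= M -> `|y| <= M ->
  exists2 z, `|z| <= M /\ `|z - x| <= `|y - x| &
    h y - h x = \sum_k (y - x) 0 k * 'd_k h z.
Proof.
move=> dh xM yM; set w := y - x.
have dl (t : R) := @is_derive_line h x w t dh.
have [|t t01] := MVT_segment ler01 (fun t _ => dl t).
  apply: derivable_within_continuous => t _.
  exact: (@ex_derive _ _ _ _ _ _ _ (dl t)).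
rewrite scale1r scale0r addr0 subrKC subr0 mulr1 deriveE_sum// => hE.
move: t01; rewrite in_itv/= => /andP[t0 t1].
exists (x + t *: w) => //; split.
  have -> : x + t *: w = (1 - t) *: x + t *: y.
    by rewrite /w scalerBr scalerBl scale1r addrCA addrC.
  apply: le_trans (ler_normD _ _) _; rewrite !normrZ !ger0_norm ?subr_ge0//.
  have -> : M = (1 - t) * M + t * M by ring.
  by rewrite lerD// ler_wpM2l// subr_ge0.
by rewrite addrC addKr normrZ ger0_norm// ler_piMl.
Qed.

(** The quantitative information that the estimates take from [V] and its derivatives. A single
    constant serves the three bounds, so that [finite_bound] can merge finitely many functions. *)
Definition tame M B h := forall x y, `|x| <= M -> `|y| <= M ->
  [/\ `|h x| <= B, `|h y - h x| <= B * `|y - x| &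
      `|h y - h x - \sum_k (y - x) 0 k * 'd_k h x| <= B * `|y - x| ^+ 2].

Lemma tame_le M B B' h : B <= B' -> tame M B h -> tame M B' h.
Proof.
move=> BB H x y xM yM; have [h1 h2 h3] := H x y xM yM.
split; first exact: le_trans h1 _.
- by apply: le_trans h2 _; rewrite ler_wpM2r.
- by apply: le_trans h3 _; rewrite ler_wpM2r// exprn_ge0.
Qed.

Lemma finite_bound (I : finType) (P : I -> R -> Prop) :
  (forall i B B', B <= B' -> P i B -> P i B') -> (forall i, exists B, P i B) ->
  exists2 B, 1 <= B & forall i, P i B.
Proof.
move=> mono /choice[f fP]; exists (1 + \sum_i `|f i|).
  by rewrite lerDl sumr_ge0.
move=> i; apply: mono (fP i); rewrite (bigD1 i)//=.
apply: le_trans (ler_norm _) _; rewrite addrCA lerDl addr_ge0// sumr_ge0//.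
Qed.

Lemma smooth_tame M h : smooth h -> exists B, tame M B h.
Proof.
move=> sh.
have [B B1 hB] : exists2 B, 1 <= B & forall k, forall x, `|x| <= M -> `|'d_k h x| <= B.
  apply: finite_bound => [k B B' BB H x /H/le_trans|k]; first exact.
  by have [B _] := @box_bounded ('d_k h) M (smooth_cont (smooth_D _ sh)); exists B.
have [C C1 hC] : exists2 C, 1 <= C & forall kl : 'I_n * 'I_n, forall x, `|x| <= M ->
    `|'d_(kl.2) ('d_(kl.1) h) x| <= C.
  apply: finite_bound => [k C C' CC H x /H/le_trans|[k l]]; first exact.
  have [C _] := @box_bounded ('d_l ('d_k h)) M (smooth_cont (smooth_D _ (smooth_D _ sh))).
  by exists C.
have [A _ hA] := @box_bounded h M (smooth_cont sh).
have n0 : (0 : R) <= n%:R by [].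
have mv (g : 'rV[R]_n -> R) K : 0 <= K -> smooth g ->
    (forall k x, `|x| <= M -> `|'d_k g x| <= K) ->
    forall x y, `|x| <= M -> `|y| <= M -> `|g y - g x| <= n%:R * (`|y - x| * K).
  move=> K0 sg gK x y xM yM; have [z [zM zx] ->] := mean_value (fun z => smooth_diff z sg) xM yM.
  apply: sum_le_n => k; rewrite normrM.
  by apply: ler_pM => //; [exact: coord_le|exact: gK].
(* One summand for each clause of [tame]: the values, the Lipschitz constant, and the remainder
   after two uses of the mean value theorem. *)
exists (`|A| + n%:R * B + n%:R * (n%:R * C)) => x y xM yM.
have nB : 0 <= n%:R * B by rewrite mulr_ge0//; lra.
have nC : 0 <= n%:R * (n%:R * C) by rewrite !mulr_ge0//; lra.
have y0 : 0 <= `|y - x| by [].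
have A0 : A <= `|A| by exact: ler_norm.
split.
- by apply: le_trans (hA _ xM) _; lra.
- apply: le_trans (mv h B _ sh hB x y xM yM) _; first lra.
  have -> : n%:R * (`|y - x| * B) = n%:R * B * `|y - x| :> R by ring.
  by apply: ler_wpM2r => //; have := normr_ge0 A; lra.
- have [z [zM zx] ->] := mean_value (fun z => smooth_diff z sh) xM yM.
  rewrite -sumrB; apply: (@le_trans _ _ (n%:R * (n%:R * C) * `|y - x| ^+ 2)); last first.
    by rewrite ler_wpM2r ?exprn_ge0//; have := normr_ge0 A; lra.
  have -> : n%:R * (n%:R * C) * `|y - x| ^+ 2 = n%:R * (`|y - x| * (n%:R * (`|y - x| * C))) :> R.
    by ring.
  apply: sum_le_n => k; rewrite -mulrBr normrM.
  apply: ler_pM => //; first exact: coord_le.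
  apply: le_trans (mv _ C _ (smooth_D _ sh) _ x z xM zM) _.
  + by lra.
  + by move=> l; exact: (hC (k, l)).
  + by rewrite ler_wpM2l// ler_wpM2r//; lra.
Qed.

End Smooth.

(** * Families of paths depending on a parameter *)

Section QuadraticFamilies.
Context {R : realType}.
Implicit Types (X Y : R -> R -> R) (B s r : R).

(* [X1] is the derivative of [X] in the parameter [s], uniformly in the time [r].  The
   remainder is required to be quadratic because this passes to products, compositions,
   integrals and fixed points by plain estimates. *)
Definition quad_deriv X X1 := exists2 B : R, 0 <= B & forall s s' r,
  `|s| <= 1 -> `|s'| <= 1 -> 0 <= r <= 1 ->
  [/\ `|X s r| <= B, `|X1 s r| <= B &
      `|X s' r - X s r - (s' - s) * X1 s r| <= B * (s' - s) ^+ 2].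

(** The Lipschitz bound is a consequence of the other clauses: with [d = |s' - s| <= 2], the sum
    [B d^2 + B d] is at most [3 B d]. *)
Lemma quad_deriv_incr X X1 : quad_deriv X X1 -> exists2 B : R, 0 <= B & forall s s' r,
  `|s| <= 1 -> `|s'| <= 1 -> 0 <= r <= 1 ->
  [/\ `|X s r| <= B, `|X1 s r| <= B, `|X s' r - X s r| <= B * `|s' - s| &
      `|X s' r - X s r - (s' - s) * X1 s r| <= B * (s' - s) ^+ 2].
Proof.
move=> [B B0 H]; exists (3 * B) => [|s s' r s1 s'1 r01]; first lra.
have [h1 h2 h3] := H s s' r s1 s'1 r01.
have d2 : `|s' - s| <= 2 by apply: le_trans (ler_normB _ _) _; lra.
split; [lra|lra| |].
- rewrite -[X s' r - X s r](subrK ((s' - s) * X1 s r)).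
  apply: le_trans (ler_normD _ _) _; rewrite normrM.
  apply: le_trans (lerD h3 (ler_wpM2l (normr_ge0 _) h2)) _.
  rewrite -(real_normK (num_real (s' - s))).
  have d0 := normr_ge0 (s' - s).
  have := ler_wpM2l (mulr_ge0 B0 d0) d2; set d := `|s' - s|; nra.
- by apply: le_trans h3 _; rewrite ler_wpM2r ?sqr_ge0//; lra.
Qed.

Lemma quad_deriv_cst (c : R -> R) B : (forall r, 0 <= r <= 1 -> `|c r| <= B) ->
  quad_deriv (fun _ r => c r) (fun _ _ => 0).
Proof.
move=> cB; exists `|B| => // s s' r _ _ r01.
rewrite mulr0 subrr subr0 normr0 mulr_ge0 ?sqr_ge0//.
by split=> //; apply: le_trans (cB _ r01) (ler_norm _).
Qed.

Lemma quad_derivD X X1 Y Y1 : quad_deriv X X1 -> quad_deriv Y Y1 ->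
  quad_deriv (fun s r => X s r + Y s r) (fun s r => X1 s r + Y1 s r).
Proof.
move=> [B B0 HX] [C C0 HY]; exists (B + C) => [|s s' r s1 s'1 r01]; first exact: addr_ge0.
have [h1 h2 h3] := HX s s' r s1 s'1 r01; have [k1 k2 k3] := HY s s' r s1 s'1 r01.
split; [exact: le_trans (ler_normD _ _) (lerD h1 k1)|exact: le_trans (ler_normD _ _) (lerD h2 k2)|].
have -> : X s' r + Y s' r - (X s r + Y s r) - (s' - s) * (X1 s r + Y1 s r) =
  (X s' r - X s r - (s' - s) * X1 s r) + (Y s' r - Y s r - (s' - s) * Y1 s r) by ring.
by rewrite [leRHS]mulrDl; apply: le_trans (ler_normD _ _) (lerD h3 k3).
Qed.

Lemma quad_derivM X X1 Y Y1 : quad_deriv X X1 -> quad_deriv Y Y1 ->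
  quad_deriv (fun s r => X s r * Y s r) (fun s r => X1 s r * Y s r + X s r * Y1 s r).
Proof.
move=> /quad_deriv_incr[B B0 HX] /quad_deriv_incr[C C0 HY].
exists (3 * B * C) => [|s s' r s1 s'1 r01]; first by rewrite !mulr_ge0.
have BC0 := mulr_ge0 B0 C0.
have [h1 h2 h4 h3] := HX s s' r s1 s'1 r01; have [k1 k2 k4 k3] := HY s s' r s1 s'1 r01.
have M (a b A D : R) : `|a| <= A -> `|b| <= D -> `|a * b| <= A * D.
  by move=> aA bD; rewrite normrM ler_pM.
split.
- by apply: le_trans (M _ _ _ _ h1 k1) _; lra.
- apply: le_trans (ler_normD _ _) _.
  by apply: le_trans (lerD (M _ _ _ _ h2 k1) (M _ _ _ _ h1 k2)) _; lra.
have -> : X s' r * Y s' r - X s r * Y s r - (s' - s) * (X1 s r * Y s r + X s r * Y1 s r) =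
  (X s' r - X s r - (s' - s) * X1 s r) * Y s r + X s r * (Y s' r - Y s r - (s' - s) * Y1 s r)
   + (X s' r - X s r) * (Y s' r - Y s r) by ring.
apply: le_trans (ler_normD _ _) _.
apply: le_trans (lerD (ler_normD _ _) (lexx _)) _.
apply: le_trans (lerD (lerD (M _ _ _ _ h3 k1) (M _ _ _ _ h1 k3)) (M _ _ _ _ h4 k4)) _.
by rewrite -(real_normK (num_real (s' - s))); set d := `|s' - s|; lra.
Qed.

Lemma quad_deriv_ext X X1 Y Y1 : (forall s r, X s r = Y s r) -> (forall s r, X1 s r = Y1 s r) ->
  quad_deriv X X1 -> quad_deriv Y Y1.
Proof.
by move=> XY XY1; have -> : X = Y by [apply/funext => s; apply/funext];
  have -> : X1 = Y1 by [apply/funext => s; apply/funext].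
Qed.

Lemma quad_deriv_sum (I : finType) (F F1 : I -> R -> R -> R) : (forall i, quad_deriv (F i) (F1 i)) ->
  quad_deriv (fun s r => \sum_i F i s r) (fun s r => \sum_i F1 i s r).
Proof.
move=> H; elim: (index_enum I) => [|i l IH].
  apply: (@quad_deriv_ext (fun _ _ => 0) (fun _ _ => 0)); [by move=> *; rewrite big_nil..|].
  by apply: (@quad_deriv_cst (fun=> 0) 0) => r _; rewrite normr0.
by apply: quad_deriv_ext (quad_derivD (H i) IH) => s r; rewrite big_cons.
Qed.

(** The strict inequality leaves room for a two-sided difference quotient, whose error at step [u]
    is at most [B |u|]. *)
Lemma quad_deriv_derive X X1 s r : quad_deriv X X1 -> `|s| < 1 -> 0 <= r <= 1 ->
  is_derive s 1 (fun s => X s r) (X1 s r).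
Proof.
move=> [B B0 H] s1 r01.
suff h : (fun u : R => u^-1 *: (((fun s => X s r) \o shift s) (u *: 1) - X s r)) @ 0^' --> X1 s r.
  by apply: DeriveDef; [apply/cvg_ex; exists (X1 s r)|exact: cvg_lim h].
apply/cvgrPdist_le => e e0.
have d0 : 0 < Num.min (1 - `|s|) (e / (B + 1)).
  by rewrite lt_min subr_gt0 s1 divr_gt0// ltr_wpDl.
have n0 : \forall u \near 0^', `|u : R| < Num.min (1 - `|s|) (e / (B + 1)) /\ u != 0.
  near=> u; split; last by near: u; exact: nbhs_dnbhs_neq.
  by near: u; apply: dnbhs0_lt.
apply: filterS n0 => u [].
rewrite lt_min => /andP[us ue] u0 /=.
have s'1 : `|u + s| <= 1 by apply: le_trans (ler_normD _ _) _; lra.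
have [_ _ h] := H s (u + s) r (ltW s1) s'1 r01.
rewrite [u *: 1]mulr1 -(ler_pM2l (_ : 0 < `|u|)) ?normr_gt0// -normrM.
rewrite -normrN /GRing.scale/= -mulrN opprB mulrBr mulrA mulfV// mul1r.
move: h; rewrite addrK => h; apply: le_trans h _.
rewrite -(real_normK (num_real u)) expr2 mulrCA ler_wpM2l//.
have B1 : 0 < B + 1 by lra.
move: ue; rewrite ltr_pdivlMr// => ue; have := normr_ge0 u; nra.
Unshelve. all: by end_near.
Qed.

(** By linearity the remainder of [T (X s)] is [T] of the remainder of [X], so the constant does not
    change. *)
Lemma quad_deriv_green T X X1 : green T -> (forall s, `|s| <= 1 -> cont01 (X s)) ->
  (forall s, `|s| <= 1 -> cont01 (X1 s)) -> quad_deriv X X1 ->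
  quad_deriv (fun s t => T (X s) t) (fun s t => T (X1 s) t).
Proof.
move=> gT WX WX1 [B B0 H]; exists B => // s s' r s1 s'1 r01.
have WXs := WX _ s1; have WXs' := WX _ s'1; have WX1s := WX1 _ s1.
split.
- by apply: (green_bound gT) => // u u01; have [] := H s s' u s1 s'1 u01.
- by apply: (green_bound gT) => // u u01; have [] := H s s' u s1 s'1 u01.
have -> : T (X s') r - T (X s) r - (s' - s) * T (X1 s) r =
    T (fun u => X s' u + (-1 * X s u + - (s' - s) * X1 s u)) r.
  rewrite !(greenD gT) ?(greenZ gT)//; first by rewrite mulN1r mulNr addrA.
  + exact: cont01_Z.
  + exact: cont01_Z.
  + by apply: cont01_D; exact: cont01_Z.
apply: (green_bound gT) => //.
- by rewrite mulr_ge0// sqr_ge0.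
- by apply: cont01_D => //; apply: cont01_D; exact: cont01_Z.
- move=> u u01; have [_ _] := H s s' u s1 s'1 u01.
  by rewrite mulN1r mulNr addrA.
Qed.

End QuadraticFamilies.

(** * Bounds and parameter derivatives for solutions of fixed point equations *)

Section FixedPoints.
Context {R : realType} {n : nat}.
Implicit Types (X Y : R -> R -> 'rV[R]_n) (B s r t e L : R) (Z f : R -> 'rV[R]_n).
Variables (T : (R -> R) -> R -> R) (gT : green T).

(** The common source of the a priori bounds, of uniqueness and of differentiability: it is applied
    to solutions, to differences of two solutions, and to first-order remainders. In each case [be]
    is the part of the integrand that the contraction does not absorb. *)
Lemma fix_bound Z f (a : R -> 'rV[R]_n) e L (al be : R) :
  cont01 Z -> cont01 f -> 0 <= L -> 0 <= be -> `|e| * L <= 2^-1 ->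
  (forall t, 0 <= t <= 1 -> Z t = a t + e *: vop T f t) ->
  (forall t, 0 <= t <= 1 -> `|a t| <= al) ->
  (forall r, 0 <= r <= 1 -> `|f r| <= L * `|Z r| + be) ->
  forall t, 0 <= t <= 1 -> `|Z t| <= 2 * (al + `|e| * be).
Proof.
move=> WZ Wf L0 be0 eL ZE aB fB; have [B _ ZB] := cont01_bounded WZ.
apply: (@contraction_bound _ _ [set t | 0 <= t <= 1] (fun t => `|Z t|) _ B) => //.
move=> M ZM t t01; have M0 : 0 <= M by apply: le_trans (ZM _ t01).
rewrite ZE//; apply: le_trans (ler_normD _ _) _; rewrite normrZ -addrA.
apply: lerD; first exact: aB.
have : `|vop T f t| <= L * M + be.
  apply: vop_bound => //; first by rewrite addr_ge0// mulr_ge0.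
  move=> r r01; apply: le_trans (fB r r01) _; rewrite lerD2r ler_wpM2l//.
  exact: ZM.
move=> /(ler_wpM2l (normr_ge0 e))/le_trans; apply.
by rewrite mulrDr [leRHS]addrC lerD2r mulrA [M / 2]mulrC ler_wpM2r.
Qed.

Definition quad_derivv X X1 := exists2 B : R, 0 <= B & forall s s' r,
  `|s| <= 1 -> `|s'| <= 1 -> 0 <= r <= 1 ->
  [/\ `|X s r| <= B, `|X1 s r| <= B, `|X s' r - X s r| <= B * `|s' - s| &
      `|X s' r - X s r - (s' - s) *: X1 s r| <= B * (s' - s) ^+ 2].

Lemma quad_derivv_intro X X1 B : 
  (forall s r, `|s| <= 1 -> 0 <= r <= 1 -> `|X s r| <= B) ->
  (forall s r, `|s| <= 1 -> 0 <= r <= 1 -> `|X1 s r| <= B) ->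
  (forall s s' r, `|s| <= 1 -> `|s'| <= 1 -> 0 <= r <= 1 ->
    `|X s' r - X s r - (s' - s) *: X1 s r| <= B * (s' - s) ^+ 2) ->
  quad_derivv X X1.
Proof.
move=> XB X1B H.
have B0 : 0 <= B by apply: le_trans (XB 0 0 _ _); rewrite ?normr0// lexx ler01.
exists (3 * B) => [|s s' r s1 s'1 r01]; first lra.
have h1 := XB s r s1 r01; have h2 := X1B s r s1 r01; have h3 := H s s' r s1 s'1 r01.
have d2 : `|s' - s| <= 2 by apply: le_trans (ler_normB _ _) _; lra.
split; [lra|lra| |].
- rewrite -[X s' r - X s r](subrK ((s' - s) *: X1 s r)).
  apply: le_trans (ler_normD _ _) _; rewrite normrZ.
  apply: le_trans (lerD h3 (ler_wpM2l (normr_ge0 _) h2)) _.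
  rewrite -(real_normK (num_real (s' - s))).
  have d0 := normr_ge0 (s' - s).
  have := ler_wpM2l (mulr_ge0 B0 d0) d2; set d := `|s' - s|; nra.
- by apply: le_trans h3 _; rewrite ler_wpM2r ?sqr_ge0//; lra.
Qed.

Lemma quad_derivv_coord X X1 i : quad_derivv X X1 -> quad_deriv (fun s r => X s r 0 i) (fun s r => X1 s r 0 i).
Proof.
move=> [B B0 H]; exists B => // s s' r s1 s'1 r01.
have [h1 h2 _ h3] := H s s' r s1 s'1 r01.
split; [exact: le_trans (coord_le _ _) h1|exact: le_trans (coord_le _ _) h2|].
by apply: le_trans h3; have := coord_le (X s' r - X s r - (s' - s) *: X1 s r) i; rewrite !mxE.
Qed.

Lemma quad_derivv_row (X X1 : 'I_n -> R -> R -> R) : (forall i, quad_deriv (X i) (X1 i)) ->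
  quad_derivv (fun s r => \row_i X i s r) (fun s r => \row_i X1 i s r).
Proof.
move=> H.
have [B B1 HB] : exists2 B, 1 <= B & forall i, forall s s' r, `|s| <= 1 -> `|s'| <= 1 -> 0 <= r <= 1 ->
  [/\ `|X i s r| <= B, `|X1 i s r| <= B &
      `|X i s' r - X i s r - (s' - s) * X1 i s r| <= B * (s' - s) ^+ 2].
  apply: finite_bound => [i B B' BB h s s' r s1 s'1 r01|i]; last by have [B _ h] := H i; exists B.
  have [h1 h2 h3] := h s s' r s1 s'1 r01.
  split; [exact: le_trans BB|exact: le_trans BB|].
  by apply: le_trans h3 _; rewrite ler_wpM2r// sqr_ge0.
have B0 : 0 <= B by lra.
apply: (@quad_derivv_intro _ _ B) => [s r s1 r01|s r s1 r01|s s' r s1 s'1 r01].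
- by apply/rV_normP => // i; rewrite mxE; have [] := HB i s s r s1 s1 r01.
- by apply/rV_normP => // i; rewrite mxE; have [] := HB i s s r s1 s1 r01.
- apply/rV_normP => [|i]; first by rewrite mulr_ge0// sqr_ge0.
  by rewrite !mxE; have [] := HB i s s' r s1 s'1 r01.
Qed.

(** The remainder [X s' - X s - (s' - s) X1 s] satisfies a fixed point equation of the same kind,
    with a source of size [C (s' - s)^2]. Hence [fix_bound] makes the remainder itself quadratic. *)
Lemma quad_deriv_fix X X1 (f f1 a a1 : R -> R -> 'rV[R]_n) e L B (C : R) : 0 <= L -> 0 <= C -> `|e| * L <= 2^-1 ->
  (forall s, `|s| <= 1 -> [/\ cont01 (X s), cont01 (X1 s), cont01 (f s) & cont01 (f1 s)]) ->
  (forall s t, `|s| <= 1 -> 0 <= t <= 1 -> X s t = a s t + e *: vop T (f s) t) ->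
  (forall s t, `|s| <= 1 -> 0 <= t <= 1 -> X1 s t = a1 s t + e *: vop T (f1 s) t) ->
  quad_derivv a a1 ->
  (forall s r, `|s| <= 1 -> 0 <= r <= 1 -> `|X s r| <= B) ->
  (forall s r, `|s| <= 1 -> 0 <= r <= 1 -> `|X1 s r| <= B) ->
  (forall s s' r, `|s| <= 1 -> `|s'| <= 1 -> 0 <= r <= 1 ->
    `|f s' r - f s r - (s' - s) *: f1 s r| <=
      L * `|X s' r - X s r - (s' - s) *: X1 s r| + C * (s' - s) ^+ 2) ->
  quad_derivv X X1.
Proof.
move=> L0 C0 eL HW XE X1E [A A0 HA] XB X1B H.
have eC : 0 <= `|e| * C by rewrite mulr_ge0.
have B0 : 0 <= B by apply: le_trans (XB 0 0 _ _); rewrite ?normr0// lexx ler01.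
apply: (@quad_derivv_intro _ _ (B + 2 * (A + `|e| * C))) => [s r s1 r01|s r s1 r01|s s' r s1 s'1 r01].
- by apply: le_trans (XB s r s1 r01) _; lra.
- by apply: le_trans (X1B s r s1 r01) _; lra.
have [WX WX1 Wf Wf1] := HW s s1; have [WX' WX1' Wf' Wf1'] := HW s' s'1.
set d := s' - s; have d0 : 0 <= d ^+ 2 by exact: sqr_ge0.
have -> : (B + 2 * (A + `|e| * C)) * d ^+ 2 =
  B * d ^+ 2 + 2 * (A * d ^+ 2 + `|e| * (C * d ^+ 2)) by ring.
apply: ler_wpDl; first exact: mulr_ge0.
have Wd (Y Y' Y1 : R -> 'rV[R]_n) : cont01 Y -> cont01 Y' -> cont01 Y1 -> cont01 (fun r => Y' r - Y r - d *: Y1 r).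
  move=> WY WY' WY1; apply: cont01_vD; last by apply: cont01_vN; apply: (cont01_vZ (@cont01_cst R d)).
  by apply: cont01_vD => //; exact: cont01_vN.
apply: (@fix_bound (fun r => X s' r - X s r - d *: X1 s r)
  (fun r => f s' r - f s r - d *: f1 s r) (fun r => a s' r - a s r - d *: a1 s r) e L) => //.
- exact: Wd.
- exact: Wd.
- exact: mulr_ge0.
- move=> t t01; rewrite !XE// X1E//.
  have -> : vop T (fun r => f s' r - f s r - d *: f1 s r) t =
    vop T (f s') t - vop T (f s) t - d *: vop T (f1 s) t.
    rewrite vopB//; [|by apply: cont01_vD => //; exact: cont01_vN|exact: (cont01_vZ (@cont01_cst R d))].
    by rewrite vopB// vopZ.
  by apply/rowP => i; rewrite !mxE; ring.
- by move=> t t01; have [] := HA s s' t s1 s'1 t01.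
- by move=> u u01; apply: H.
Qed.

(** The matrix is a plain function of two indices, so that each entry can be handled as a scalar
    family by [quad_deriv]. *)
Definition amul (A : 'I_n -> 'I_n -> R) (w : 'rV[R]_n) : 'rV[R]_n :=
  \row_i \sum_k A i k * w 0 k.

Lemma amulD A v w : amul A (v + w) = amul A v + amul A w.
Proof. by apply/rowP => i; rewrite !mxE -big_split; apply: eq_bigr => k _; rewrite mxE mulrDr. Qed.

Lemma amulZ A c v : amul A (c *: v) = c *: amul A v.
Proof. by apply/rowP => i; rewrite !mxE mulr_sumr; apply: eq_bigr => k _; rewrite mxE mulrCA. Qed.

Lemma amulB (A A' : 'I_n -> 'I_n -> R) x x' : amul A' x' - amul A x =
  amul A (x' - x) + amul (fun i k => A' i k - A i k) x'.
Proof.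
apply/rowP => i; rewrite !mxE -sumrB -big_split; apply: eq_bigr => k _ /=.
by rewrite !mxE; ring.
Qed.

(** The remainder of a product, split so that the remainder of [x] occurs in the first term only.
    That term is absorbed by the contraction; the other two are of second order in [d]. *)
Lemma amulB2 (A A' A1 : 'I_n -> 'I_n -> R) x x' y (d : R) :
  amul A' x' - amul A x - d *: (amul A y + amul A1 x) =
  amul A (x' - x - d *: y) + (amul (fun i k => A' i k - A i k - d * A1 i k) x' +
    amul (fun i k => d * A1 i k) (x' - x)).
Proof.
apply/rowP => i; rewrite !mxE mulrDr !mulr_sumr -sumrB -big_split -sumrB -!big_split.
by apply: eq_bigr => k _ /=; rewrite !mxE; ring.
Qed.

Lemma amul_bound A w (K M : R) : 0 <= K -> 0 <= M -> (forall i k, `|A i k| <= K) -> `|w| <= M ->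
  `|amul A w| <= n%:R * (K * M).
Proof.
move=> K0 M0 AK wM; apply/rV_normP => [|i]; first by rewrite !mulr_ge0.
rewrite mxE; apply: sum_le_n => k; rewrite normrM ler_pM//.
exact: le_trans (coord_le _ _) wM.
Qed.

Lemma cont01_amul (A : 'I_n -> 'I_n -> R -> R) Z : (forall i k, cont01 (A i k)) -> cont01 Z ->
  cont01 (fun r => amul (fun i k => A i k r) (Z r)).
Proof.
move=> WA /cont01_rVP WZ; apply/cont01_rVP => i; under eq_fun do rewrite mxE.
by apply: cont01_sum => k; apply: cont01_M; [exact: WA|exact: WZ].
Qed.

Lemma quad_derivv_amul (A A1 : 'I_n -> 'I_n -> R -> R -> R) X X1 :
  (forall i k, quad_deriv (A i k) (A1 i k)) -> quad_derivv X X1 ->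
  quad_derivv (fun s r => amul (fun i k => A i k s r) (X s r))
    (fun s r => amul (fun i k => A1 i k s r) (X s r) + amul (fun i k => A i k s r) (X1 s r)).
Proof.
move=> HA HX.
have -> : (fun s r => amul (fun i k => A1 i k s r) (X s r) + amul (fun i k => A i k s r) (X1 s r)) =
  (fun s r => \row_i \sum_k (A1 i k s r * X s r 0 k + A i k s r * X1 s r 0 k)).
  apply/funext => s; apply/funext => r; apply/rowP => i.
  by rewrite !mxE -big_split.
apply: quad_derivv_row => i; apply: quad_deriv_sum => k; apply: quad_derivM => //; exact: quad_derivv_coord.
Qed.

Lemma quad_derivvD X X1 Y Y1 : quad_derivv X X1 -> quad_derivv Y Y1 ->
  quad_derivv (fun s r => X s r + Y s r) (fun s r => X1 s r + Y1 s r).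
Proof.
move=> HX HY; have := quad_derivv_row (fun i => quad_derivD (quad_derivv_coord i HX) (quad_derivv_coord i HY)).
by congr quad_derivv; apply/funext => s; apply/funext => r; apply/rowP => i; rewrite !mxE.
Qed.

Lemma linear_exists (A : 'I_n -> 'I_n -> R -> R) (K e : R) (a c : R -> 'rV[R]_n) :
  0 <= K -> `|e| * (n%:R * K) <= 2^-1 -> (forall i k, cont01 (A i k)) ->
  (forall i k r, 0 <= r <= 1 -> `|A i k r| <= K) -> cont01 a -> cont01 c ->
  exists2 Z, cont01 Z & forall t, 0 <= t <= 1 ->
    Z t = a t + e *: vop T (fun r => amul (fun i k => A i k r) (Z r) + c r) t.
Proof.
move=> K0 eK WA AK Wa Wc.
apply: (picard gT (F := fun r z => amul (fun i k => A i k r) z + c r) (L := n%:R * K)) => //.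
- by move=> Z WZ; apply: cont01_vD => //; exact: cont01_amul.
- move=> r x y r01; rewrite opprD addrACA subrr addr0.
  have -> : - amul (fun i k => A i k r) y = amul (fun i k => A i k r) (- y).
    by rewrite -scaleN1r -amulZ scaleN1r.
  by rewrite -amulD -mulrA; apply: amul_bound => // i k; exact: AK.
- by rewrite mulr_ge0.
Qed.

Lemma regroup (P P' Q S c c' c1 : 'rV[R]_n) (d : R) :
  P' + c' - (P + c) - d *: (Q + (S + c1)) = P' - P - d *: (Q + S) + (c' - c - d *: c1).
Proof. by apply/rowP => i; rewrite !mxE; ring. Qed.

(** Formal differentiation of the equation gives for [X1] a linear equation with the same operator
    [A], hence with the same contraction factor; its solution is shown to be the derivative. As the
    new equation is again affine, the lemma can be applied to [X1] in turn. The bounds [Xb], [X1b]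
    and the Lipschitz bound [Xl] feed the remainder estimate through [amulB2]. *)
Lemma affine_derivative (A A1 : 'I_n -> 'I_n -> R -> R -> R) (K e : R) (a a1 c c1 : R -> R -> 'rV[R]_n) X :
  0 <= K -> `|e| * (n%:R * K) <= 2^-1 ->
  (forall i k s, `|s| <= 1 -> cont01 (A i k s) /\ cont01 (A1 i k s)) ->
  (forall i k s r, `|s| <= 1 -> 0 <= r <= 1 -> `|A i k s r| <= K) ->
  (forall i k, quad_deriv (A i k) (A1 i k)) ->
  (forall s, `|s| <= 1 -> [/\ cont01 (X s), cont01 (a1 s), cont01 (c s) & cont01 (c1 s)]) ->
  quad_derivv a a1 -> quad_derivv c c1 ->
  (forall s t, `|s| <= 1 -> 0 <= t <= 1 ->
    X s t = a s t + e *: vop T (fun r => amul (fun i k => A i k s r) (X s r) + c s r) t) ->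
  exists X1, [/\ forall s, `|s| <= 1 -> cont01 (X1 s),
    forall s t, `|s| <= 1 -> 0 <= t <= 1 ->
      X1 s t = a1 s t + e *: vop T (fun r => amul (fun i k => A i k s r) (X1 s r) +
        (amul (fun i k => A1 i k s r) (X s r) + c1 s r)) t & quad_derivv X X1].
Proof.
move=> K0 eK WA AK HA HW Ha Hc XE.
have nK0 : 0 <= n%:R * K by rewrite mulr_ge0.
(* With the condition on [s] inside the existential, [choice] gives a total function; its values
   outside [[-1, 1]] are arbitrary. *)
have ex s : exists Z, `|s| <= 1 -> cont01 Z /\ forall t, 0 <= t <= 1 ->
   Z t = a1 s t + e *: vop T (fun r => amul (fun i k => A i k s r) (Z r) +
        (amul (fun i k => A1 i k s r) (X s r) + c1 s r)) t.
  have [s1|ns1] := boolP (`|s| <= 1); last by exists 0.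
  have [WX Wa1 Wc_ Wc1] := HW s s1.
  have [|Z WZ ZE] := @linear_exists (fun i k => A i k s) K e (a1 s)
    (fun r => amul (fun i k => A1 i k s r) (X s r) + c1 s r) K0 eK
    (fun i k => (WA i k s s1).1) (fun i k r => AK i k s r s1) Wa1.
    by apply: cont01_vD => //; apply: cont01_amul => // i k; have [] := WA i k s s1.
  by exists Z.
have [X1 X1P] := choice ex.
exists X1; have WX1 s (s1 : `|s| <= 1) := (X1P s s1).1.
have X1E s t (s1 : `|s| <= 1) := (X1P s s1).2 t.
split=> //.
have [Ba Ba0 HBa] := Ha; have [Bc Bc0 HBc] := Hc.
have Xb s r : `|s| <= 1 -> 0 <= r <= 1 -> `|X s r| <= 2 * (Ba + `|e| * Bc).
  move=> s1; have [WX Wa1 Wc_ Wc1] := HW s s1.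
  apply: (@fix_bound (X s) (fun r => amul (fun i k => A i k s r) (X s r) + c s r) (a s) e (n%:R * K) Ba Bc) => //.
  - by apply: cont01_vD => //; apply: cont01_amul => // i k; have [] := WA i k s s1.
  - by move=> t t01; exact: XE.
  - by move=> t t01; have [] := HBa s s t s1 s1 t01.
  - move=> u u01; apply: le_trans (ler_normD _ _) _; apply: lerD.
      by rewrite -mulrA; apply: amul_bound => // i k; exact: AK.
    by have [] := HBc s s u s1 s1 u01.
set Bx := 2 * (Ba + `|e| * Bc) in Xb.
have Bx0 : 0 <= Bx by rewrite /Bx; have := mulr_ge0 (normr_ge0 e) Bc0; lra.
clearbody Bx.
have [D D1 HD] : exists2 D, 1 <= D & forall ik : 'I_n * 'I_n, forall s s' r,
    `|s| <= 1 -> `|s'| <= 1 -> 0 <= r <= 1 ->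
    [/\ `|A1 ik.1 ik.2 s r| <= D, `|A ik.1 ik.2 s' r - A ik.1 ik.2 s r| <= D * `|s' - s| &
      `|A ik.1 ik.2 s' r - A ik.1 ik.2 s r - (s' - s) * A1 ik.1 ik.2 s r| <= D * (s' - s) ^+ 2].
  apply: finite_bound => [i B B' BB h s s' r s1 s'1 r01|i].
    have [h1 h2 h3] := h s s' r s1 s'1 r01.
    split; first exact: le_trans BB.
    + by apply: le_trans h2 _; rewrite ler_wpM2r.
    + by apply: le_trans h3 _; rewrite ler_wpM2r// sqr_ge0.
  have [B _ h] := quad_deriv_incr (HA i.1 i.2); exists B => s s' r s1 s'1 r01.
  by have [] := h s s' r s1 s'1 r01.
have D0 : 0 <= D by lra.
have X1b s r : `|s| <= 1 -> 0 <= r <= 1 -> `|X1 s r| <= 2 * (Ba + `|e| * (n%:R * (D * Bx) + Bc)).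
  move=> s1; have [WX Wa1 Wc_ Wc1] := HW s s1.
  apply: (@fix_bound (X1 s) (fun r => amul (fun i k => A i k s r) (X1 s r) +
      (amul (fun i k => A1 i k s r) (X s r) + c1 s r)) (a1 s) e (n%:R * K) _ (n%:R * (D * Bx) + Bc)) => //.
  - exact: WX1.
  - apply: cont01_vD; last apply: cont01_vD => //.
      by apply: cont01_amul => // [i k|]; [have [] := WA i k s s1|exact: WX1].
    by apply: cont01_amul => // i k; have [] := WA i k s s1.
  - by rewrite addr_ge0// !mulr_ge0.
  - by move=> t t01; exact: X1E.
  - by move=> t t01; have [] := HBa s s t s1 s1 t01.
  - move=> u u01; apply: le_trans (ler_normD _ _) _; apply: lerD.
      by rewrite -mulrA; apply: amul_bound => // i k; exact: AK.
    apply: le_trans (ler_normD _ _) _; apply: lerD.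
      apply: amul_bound => // [i k|]; last exact: Xb.
      by have [] := HD (i, k) s s u s1 s1 u01.
    by have [] := HBc s s u s1 s1 u01.
have Xl s s' r : `|s| <= 1 -> `|s'| <= 1 -> 0 <= r <= 1 ->
    `|X s' r - X s r| <= 2 * (Ba + `|e| * (n%:R * (D * Bx) + Bc)) * `|s' - s|.
  move=> s1 s'1 r01; have [WX Wa1 Wc_ Wc1] := HW s s1; have [WX' Wa1' Wc' Wc1'] := HW s' s'1.
  set d := `|s' - s|; have d0 : 0 <= d by exact: normr_ge0.
  have -> : 2 * (Ba + `|e| * (n%:R * (D * Bx) + Bc)) * d =
     2 * (Ba * d + `|e| * ((n%:R * (D * Bx) + Bc) * d)) by ring.
  have WB s0 : `|s0| <= 1 -> cont01 (fun r => amul (fun i k => A i k s0 r) (X s0 r) + c s0 r).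
    move=> s01; have [? ? ? ?] := HW s0 s01.
    by apply: cont01_vD => //; apply: cont01_amul => // i k; have [] := WA i k s0 s01.
  apply: (@fix_bound (fun r => X s' r - X s r)
    (fun r => (amul (fun i k => A i k s' r) (X s' r) + c s' r) -
       (amul (fun i k => A i k s r) (X s r) + c s r))
    (fun r => a s' r - a s r) e (n%:R * K)) => //.
  - by apply: cont01_vD => //; exact: cont01_vN.
  - by apply: cont01_vD; [|apply: cont01_vN]; apply: WB.
  - by rewrite mulr_ge0// addr_ge0// !mulr_ge0.
  - move=> t t01; rewrite (XE s')// (XE s)// vopB//; [|exact: WB..].
    by rewrite scalerBr opprD addrACA.
  - by move=> t t01; have [] := HBa s s' t s1 s'1 t01.
  - move=> u u01.
    have -> : (amul (fun i k => A i k s' u) (X s' u) + c s' u) -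
       (amul (fun i k => A i k s u) (X s u) + c s u) =
       amul (fun i k => A i k s u) (X s' u - X s u) +
       (amul (fun i k => A i k s' u - A i k s u) (X s' u) + (c s' u - c s u)).
      by rewrite opprD addrACA (amulB (fun i k => A i k s u)) -addrA.
    apply: le_trans (ler_normD _ _) _; apply: lerD.
      by rewrite -mulrA; apply: amul_bound => // i k; exact: AK.
    rewrite mulrDl; apply: le_trans (ler_normD _ _) _; apply: lerD; last first.
      by have [] := HBc s s' u s1 s'1 u01.
    have -> : n%:R * (D * Bx) * d = n%:R * ((D * d) * Bx) by ring.
    apply: amul_bound => // [|i k|]; [exact: mulr_ge0| |exact: Xb].
    by have [] := HD (i, k) s s' u s1 s'1 u01.
set Bl := 2 * (Ba + `|e| * (n%:R * (D * Bx) + Bc)) in X1b Xl.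
have Bl0 : 0 <= Bl.
  by apply: le_trans (X1b 0 0 _ _); rewrite ?normr0// lexx ler01.
clearbody Bl.
apply: (@quad_deriv_fix X X1 (fun s r => amul (fun i k => A i k s r) (X s r) + c s r)
  (fun s r => amul (fun i k => A i k s r) (X1 s r) +
        (amul (fun i k => A1 i k s r) (X s r) + c1 s r)) a a1 e (n%:R * K) (Bx + Bl)
   (n%:R * (D * Bx) + n%:R * (D * Bl) + Bc)) => //.
- by rewrite !addr_ge0// !mulr_ge0.
- move=> s s1; have [WX Wa1 Wc_ Wc1] := HW s s1; split=> //; first exact: WX1.
    by apply: cont01_vD => //; apply: cont01_amul => // i k; have [] := WA i k s s1.
  apply: cont01_vD; last apply: cont01_vD => //.
    by apply: cont01_amul => // [i k|]; [have [] := WA i k s s1|exact: WX1].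
  by apply: cont01_amul => // i k; have [] := WA i k s s1.
- by move=> s r s1 r01; apply: le_trans (Xb s r s1 r01) _; lra.
- by move=> s r s1 r01; apply: le_trans (X1b s r s1 r01) _; lra.
move=> s s' r s1 s'1 r01; set d := s' - s.
have -> : amul (fun i k => A i k s' r) (X s' r) + c s' r - (amul (fun i k => A i k s r) (X s r) + c s r)
   - d *: (amul (fun i k => A i k s r) (X1 s r) + (amul (fun i k => A1 i k s r) (X s r) + c1 s r)) =
  amul (fun i k => A i k s r) (X s' r - X s r - d *: X1 s r) +
  (amul (fun i k => A i k s' r - A i k s r - d * A1 i k s r) (X s' r) +
   amul (fun i k => d * A1 i k s r) (X s' r - X s r) +
   (c s' r - c s r - d *: c1 s r)).
  by rewrite regroup (amulB2 (fun i k => A i k s r)) -addrA.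
apply: le_trans (ler_normD _ _) _; apply: lerD.
  by rewrite -mulrA; apply: amul_bound => // i k; exact: AK.
rewrite !mulrDl; apply: le_trans (ler_normD _ _) _; apply: lerD; last first.
  by have [] := HBc s s' r s1 s'1 r01.
apply: le_trans (ler_normD _ _) _; apply: lerD.
  have -> : n%:R * (D * Bx) * d ^+ 2 = n%:R * ((D * d ^+ 2) * Bx) by ring.
  apply: amul_bound => // [|i k|]; [by rewrite mulr_ge0// sqr_ge0| |exact: Xb].
  by have [] := HD (i, k) s s' r s1 s'1 r01.
have -> : n%:R * (D * Bl) * d ^+ 2 = n%:R * ((`|d| * D) * (Bl * `|d|)).
  by rewrite -(real_normK (num_real d)); ring.
apply: amul_bound; [by rewrite mulr_ge0|by rewrite mulr_ge0|move=> i k|exact: Xl].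
by rewrite normrM ler_wpM2l//; have [] := HD (i, k) s s' r s1 s'1 r01.
Qed.

End FixedPoints.

(** * The nonlinear equation with force [grad V] and its linearization *)

Section Potential.
Context {R : realType} {n : nat}.
Implicit Types (X Y : R -> R -> 'rV[R]_n) (B s r t e L : R) (Z f : R -> 'rV[R]_n).
Implicit Types (x y w q p o : 'rV[R]_n).

Lemma cont01_comp (h : 'rV[R]_n -> R) Z : continuous h -> cont01 Z -> cont01 (fun r => h (Z r)).
Proof.
move=> ch WZ x; apply: (@continuous_comp (subspace `[0 : R, 1]) 'rV[R]_n R Z h).
  exact: WZ.
exact: ch.
Qed.

(** Here [T] is abstract: that it only sees [[0, 1]] is extracted from linearity and from the bound
    with [M = 0]. *)
Lemma vop_ext T (gT : green T) Z f t : cont01 Z -> cont01 f -> 0 <= t <= 1 ->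
  (forall r, 0 <= r <= 1 -> Z r = f r) -> vop T Z t = vop T f t.
Proof.
move=> WZ Wf t01 Zf; apply/eqP; rewrite -subr_eq0 -vopB// -normr_le0.
apply: vop_bound => // [|r r01]; first by apply: cont01_vD => //; exact: cont01_vN.
by rewrite Zf// subrr normr0.
Qed.

Lemma quad_deriv_comp (h : 'rV[R]_n -> R) M X X1 : smooth h -> quad_derivv X X1 ->
  (forall s r, `|s| <= 1 -> 0 <= r <= 1 -> `|X s r| <= M) ->
  quad_deriv (fun s r => h (X s r)) (fun s r => \sum_k X1 s r 0 k * 'd_k h (X s r)).
Proof.
move=> sh [C C0 HX] XM; have [B hB] := smooth_tame M sh.
have [D D1 hD] : exists2 D, 1 <= D & forall k, forall x, `|x| <= M -> `|'d_k h x| <= D.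
  apply: finite_bound => [k b b' BB H x /H/le_trans|k]; first exact.
  by have [b _] := @box_bounded _ _ ('d_k h) M (smooth_cont (smooth_D _ sh)); exists b.
have D0 : 0 <= D by lra.
have B0 : 0 <= B.
  have xM := XM 0 0; rewrite normr0 lexx ler01 in xM.
  by have [h1 _ _] := hB _ _ (xM isT isT) (xM isT isT); exact: le_trans h1.
have nCD : 0 <= n%:R * (C * D) by rewrite !mulr_ge0.
have BCC : 0 <= B * C ^+ 2 by rewrite mulr_ge0// sqr_ge0.
(* The first summand bounds [h] itself, the second the derivative and the remainder of [X] seen
   through the gradient of [h], the third the Taylor remainder of [h]. *)
exists (B + n%:R * (C * D) + B * C ^+ 2) => [|s s' r s1 s'1 r01]; first by rewrite !addr_ge0.
have [h1 h2 h3 h4] := HX s s' r s1 s'1 r01.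
have [k1 k2 k3] := hB _ _ (XM s r s1 r01) (XM s' r s'1 r01).
split.
- by lra.
- apply: (@le_trans _ _ (n%:R * (C * D))); last lra.
  apply: sum_le_n => k; rewrite normrM ler_pM//; last by apply: hD; exact: XM.
  exact: le_trans (coord_le _ _) h2.
set d := s' - s in h4 *; have d0 : 0 <= d ^+ 2 by exact: sqr_ge0.
have -> : h (X s' r) - h (X s r) - d * (\sum_k X1 s r 0 k * 'd_k h (X s r)) =
   (h (X s' r) - h (X s r) - \sum_k (X s' r - X s r) 0 k * 'd_k h (X s r)) +
   \sum_k (X s' r - X s r - d *: X1 s r) 0 k * 'd_k h (X s r).
  rewrite -(addrA _ _ (\sum_k _)); congr (_ + _); rewrite mulr_sumr -!sumrN -big_split.
  by apply: eq_bigr => k _ /=; rewrite !mxE; ring.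
have h5 : `|\sum_k (X s' r - X s r - d *: X1 s r) 0 k * 'd_k h (X s r)| <= n%:R * (C * d ^+ 2 * D).
  apply: sum_le_n => k; rewrite normrM ler_pM//; last by apply: hD; exact: XM.
  exact: le_trans (coord_le _ _) h4.
have h6 : `|X s' r - X s r| ^+ 2 <= C ^+ 2 * d ^+ 2.
  rewrite -(real_normK (num_real d)) -exprMn ler_pXn2r// ?nnegrE ?mulr_ge0//.
apply: le_trans (ler_normD _ _) _; apply: le_trans (lerD k3 h5) _.
have := ler_wpM2l B0 h6; have := mulr_ge0 B0 d0.
have -> : n%:R * (C * d ^+ 2 * D) = n%:R * (C * D) * d ^+ 2 by ring.
by rewrite mulrA; set a := `|X s' r - X s r|; lra.
Qed.

(* The force composed with [clamp M] is globally Lipschitz; for small [e] the solution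
   stays where [clamp M] is the identity. *)
Definition clamp (M : R) x : 'rV[R]_n := \row_i Num.max (- M) (Num.min (x 0 i) M).

Lemma clamp_le M x : 0 <= M -> `|clamp M x| <= M.
Proof.
move=> M0; apply/rV_normP => // i; rewrite mxE ler_norml.
by rewrite le_max lexx/= ge_max ge_min lexx orbT andbT; lra.
Qed.

Lemma clamp_id M x : `|x| <= M -> clamp M x = x.
Proof.
move=> xM; have M0 : 0 <= M by apply: le_trans xM.
apply/rowP => i; rewrite mxE; have := (rV_normP x M0).1 xM i.
by rewrite ler_norml => /andP[h1 h2]; rewrite min_l// max_r.
Qed.

Lemma clamp_lip M x y : `|clamp M x - clamp M y| <= `|x - y|.
Proof.
apply/rV_normP => // i; rewrite !mxE; apply: le_trans (coord_le (x - y) i).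
rewrite !mxE; move: (x 0 i) (y 0 i) => a b.
have h1 : a - b <= `|a - b| by exact: ler_norm.
have h2 : b - a <= `|a - b| by rewrite distrC; exact: ler_norm.
rewrite ler_norml; move: (`|a - b| : R) h1 h2 => d h1 h2.
case: (leP (- M) (Num.min a M)); case: (leP (- M) (Num.min b M));
  case: (leP a M); case: (leP b M) => h3 h4 h5 h6;
  apply/andP; split; lra.
Qed.

Lemma clamp_cont M : continuous (clamp M).
Proof.
move=> x; apply/(@cvgrPdist_le R 'rV[R]_n 'rV[R]_n (nbhs x) (nbhs_filter x)) => e e0.
apply/nbhs_ballP; exists e => //= y; rewrite -ball_normE /= => xy.
exact: le_trans (clamp_lip M x y) (ltW xy).
Qed.

Lemma cont01_clamp M Z : cont01 Z -> cont01 (fun r => clamp M (Z r)).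
Proof.
move=> WZ u; apply: (@continuous_comp (subspace `[0 : R, 1]) _ _ Z (clamp M)).
  exact: WZ.
exact: clamp_cont.
Qed.

Variables (V : 'rV[R]_n -> R) (V_smooth : smooth V) (M K : R).

Definition V3 i k l x := 'd_l ('d_k ('d_i V)) x.
Definition V4 i k l m x := 'd_m ('d_l ('d_k ('d_i V))) x.

(** Two derivatives in [s] of the Hessian along a trajectory involve fourth derivatives of [V];
    their Lipschitz bound serves to compare them on the trajectory with those on the straight
    line. *)
Record Vtame : Prop := {
  Vtame_K : 1 <= K;
  Vtame0 : tame M K V;
  Vtame1 : forall i, tame M K ('d_i V);
  Vtame2 : forall i k, tame M K ('d_k ('d_i V));
  Vtame3 : forall i k l, tame M K (V3 i k l);
  Vtame4 : forall i k l m, tame M K (V4 i k l m) }.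

Hypothesis VT : Vtame.
Let K0 : 0 <= K. Proof. by have := Vtame_K VT; lra. Qed.
Let nK0 : 0 <= n%:R * K. Proof. by rewrite mulr_ge0. Qed.

Definition hs q i k := 'd_k ('d_i V) q.

Lemma hs_bound q : `|q| <= M -> forall i k, `|hs q i k| <= K.
Proof. by move=> qM i k; have [] := Vtame2 VT i k qM qM. Qed.

Lemma grad_bound q : `|q| <= M -> `|grad V q| <= K.
Proof.
by move=> qM; apply/rV_normP => // i; rewrite mxE; have [] := Vtame1 VT i qM qM.
Qed.

Lemma grad_lip x y : `|x| <= M -> `|y| <= M -> `|grad V y - grad V x| <= K * `|y - x|.
Proof.
move=> xM yM; apply/rV_normP => [|i]; first by rewrite mulr_ge0.
by rewrite !mxE; have [] := Vtame1 VT i xM yM.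
Qed.

Lemma grad_taylor x y : `|x| <= M -> `|y| <= M ->
  `|grad V y - grad V x - amul (hs x) (y - x)| <= K * `|y - x| ^+ 2.
Proof.
move=> xM yM; apply/rV_normP => [|i]; first by rewrite mulr_ge0// sqr_ge0.
rewrite !mxE; have [_ _] := Vtame1 VT i xM yM.
by under [in X in X -> _]eq_bigr do rewrite mulrC.
Qed.

Lemma cont01_grad Z : cont01 Z -> cont01 (fun r => grad V (Z r)).
Proof.
move=> WZ; apply/cont01_rVP => i; under eq_fun do rewrite mxE.
by apply: (cont01_comp (h := 'd_i V)) => //; apply: smooth_cont; exact: smooth_D.
Qed.

Lemma cont01_hs Z i k : cont01 Z -> cont01 (fun r => hs (Z r) i k).
Proof.
move=> WZ; apply: (cont01_comp (h := 'd_k ('d_i V))) => //; apply: smooth_cont.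
by do 2 apply: smooth_D.
Qed.

Variables (T : (R -> R) -> R -> R) (gT : green T).

Lemma nl_exists (a : R -> 'rV[R]_n) e : `|e| * K <= 2^-1 -> 1 <= M -> cont01 a ->
  (forall t, 0 <= t <= 1 -> `|a t| <= M - 1) ->
  exists Z, [/\ cont01 Z, forall t, 0 <= t <= 1 -> `|Z t| <= M &
    forall t, 0 <= t <= 1 -> Z t = a t + e *: vop T (fun r => grad V (Z r)) t].
Proof.
move=> eK M1 Wa aM; have M0 : 0 <= M by lra.
have [| |//|//|//|Z WZ ZE] := picard gT (F := fun _ z => grad V (clamp M z)) (a := a) (e := e) (L := K).
- by move=> Z WZ; apply: cont01_grad; exact: cont01_clamp.
- move=> r x y r01; apply: le_trans (grad_lip _ _) _; [exact: clamp_le..|].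
  by rewrite ler_wpM2l// clamp_lip.
have WF : cont01 (fun r => grad V (clamp M (Z r))).
  by apply: cont01_grad; exact: cont01_clamp.
have ZM t : 0 <= t <= 1 -> `|Z t| <= M.
  move=> t01; rewrite ZE//; apply: le_trans (ler_normD _ _) _; rewrite normrZ.
  have h : `|vop T (fun r => grad V (clamp M (Z r))) t| <= K.
    by apply: vop_bound => // r r01; apply: grad_bound; exact: clamp_le.
  move: (ler_wpM2l (normr_ge0 e) h) (aM t t01).
  by move: (`|e| * `|_|) (`|a t|) => c1 c2 h1 h2; lra.
exists Z; split; [exact: WZ|exact: ZM|move=> t t01].
rewrite {1}(ZE t t01); congr (_ + _ *: _).
apply: (vop_ext gT WF) => [||r r01]; [exact: cont01_grad|exact: t01|].
by rewrite (clamp_id (ZM r r01)).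
Qed.

Lemma nl_lip (a a' Z Z' : R -> 'rV[R]_n) e d : `|e| * K <= 2^-1 -> cont01 Z -> cont01 Z' ->
  (forall t, 0 <= t <= 1 -> `|Z t| <= M) -> (forall t, 0 <= t <= 1 -> `|Z' t| <= M) ->
  (forall t, 0 <= t <= 1 -> Z t = a t + e *: vop T (fun r => grad V (Z r)) t) ->
  (forall t, 0 <= t <= 1 -> Z' t = a' t + e *: vop T (fun r => grad V (Z' r)) t) ->
  (forall t, 0 <= t <= 1 -> `|a' t - a t| <= d) ->
  forall t, 0 <= t <= 1 -> `|Z' t - Z t| <= 2 * d.
Proof.
move=> eK WZ WZ' ZM Z'M ZE Z'E ad t t01.
rewrite -[d]addr0 -(mulr0 `|e|).
apply: (@fix_bound _ _ T gT (fun r => Z' r - Z r) (fun r => grad V (Z' r) - grad V (Z r))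
  (fun r => a' r - a r) e K) => //.
- by apply: cont01_vD => //; exact: cont01_vN.
- by apply: cont01_vD; [|apply: cont01_vN]; exact: cont01_grad.
- move=> u u01; rewrite ZE// Z'E// vopB//; [|exact: cont01_grad..].
  by rewrite scalerBr opprD addrACA.
- by move=> u u01; rewrite addr0; apply: grad_lip; [exact: ZM|exact: Z'M].
Qed.

Lemma nl_derivative X (a a1 : R -> R -> 'rV[R]_n) e :
  `|e| * K <= 2^-1 -> `|e| * (n%:R * K) <= 2^-1 ->
  (forall s, `|s| <= 1 -> cont01 (X s) /\ cont01 (a1 s)) -> quad_derivv a a1 ->
  (forall s t, `|s| <= 1 -> 0 <= t <= 1 -> `|X s t| <= M) ->
  (forall s t, `|s| <= 1 -> 0 <= t <= 1 ->
    X s t = a s t + e *: vop T (fun r => grad V (X s r)) t) ->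
  exists X1, [/\ forall s, `|s| <= 1 -> cont01 (X1 s),
    forall s t, `|s| <= 1 -> 0 <= t <= 1 ->
      X1 s t = a1 s t + e *: vop T (fun r => amul (hs (X s r)) (X1 s r)) t & quad_derivv X X1].
Proof.
move=> eK enK HW Ha XM XE.
have ex s : exists Z, `|s| <= 1 -> cont01 Z /\ forall t, 0 <= t <= 1 ->
   Z t = a1 s t + e *: vop T (fun r => amul (hs (X s r)) (Z r) + 0) t.
  have [s1|ns1] := boolP (`|s| <= 1); last by exists 0.
  have [WX Wa1] := HW s s1.
  have [| | | |Z WZ ZE] := @linear_exists _ _ T gT (fun i k r => hs (X s r) i k) K e (a1 s) (fun=> 0) K0 enK.
  - by move=> i k; exact: cont01_hs.
  - by move=> i k r r01; apply: hs_bound; exact: XM.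
  - by [].
  - exact: cont01_vcst.
  - by exists Z.
have [X1 X1P] := choice ex.
have WX1 s (s1 : `|s| <= 1) := (X1P s s1).1.
have X1E s t : `|s| <= 1 -> 0 <= t <= 1 ->
    X1 s t = a1 s t + e *: vop T (fun r => amul (hs (X s r)) (X1 s r)) t.
  move=> s1 t01; rewrite (X1P s s1).2//; congr (_ + _ *: vop T _ _).
  by apply/funext => r; rewrite addr0.
exists X1; split=> //.
have [Ba Ba0 HBa] := Ha.
have M0 : 0 <= M by apply: le_trans (XM 0 0 _ _); rewrite ?normr0// lexx ler01.
have X1b s r : `|s| <= 1 -> 0 <= r <= 1 -> `|X1 s r| <= 2 * (Ba + `|e| * 0).
  move=> s1; have [WX Wa1] := HW s s1.
  apply: (@fix_bound _ _ T gT (X1 s) (fun r => amul (hs (X s r)) (X1 s r)) (a1 s) e (n%:R * K)) => //.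
  - exact: WX1.
  - by apply: cont01_amul; [move=> i k; exact: cont01_hs|exact: WX1].
  - by move=> t t01; exact: X1E.
  - by move=> t t01; have [] := HBa s s t s1 s1 t01.
  - move=> u u01; rewrite addr0 -mulrA; apply: amul_bound => //; apply: hs_bound; exact: XM.
rewrite mulr0 addr0 in X1b.
have Xl s s' r : `|s| <= 1 -> `|s'| <= 1 -> 0 <= r <= 1 ->
    `|X s' r - X s r| <= 2 * (Ba * `|s' - s|).
  move=> s1 s'1 r01; have [WX _] := HW s s1; have [WX' _] := HW s' s'1.
  apply: (@nl_lip (a s) (a s') (X s) (X s') e) => // t t01.
  - exact: XM.
  - exact: XM.
  - exact: XE.
  - exact: XE.
  - by have [] := HBa s s' t s1 s'1 t01.
(* The source is the Taylor remainder of [grad V]: the constant [K] times the square of the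
   Lipschitz bound [2 Ba |s' - s|] of [X]. *)
apply: (@quad_deriv_fix _ _ T gT X X1 (fun s r => grad V (X s r)) (fun s r => amul (hs (X s r)) (X1 s r))
  a a1 e (n%:R * K) (M + 2 * Ba) (4 * K * Ba ^+ 2)) => //.
- by rewrite !mulr_ge0// sqr_ge0.
- move=> s s1; have [WX Wa1] := HW s s1; split=> //; [exact: WX1|exact: cont01_grad|].
  by apply: cont01_amul; [move=> i k; exact: cont01_hs|exact: WX1].
- by move=> s r s1 r01; apply: le_trans (XM s r s1 r01) _; lra.
- by move=> s r s1 r01; apply: le_trans (X1b s r s1 r01) _; lra.
move=> s s' r s1 s'1 r01; set d := s' - s.
have -> : grad V (X s' r) - grad V (X s r) - d *: amul (hs (X s r)) (X1 s r) =
  amul (hs (X s r)) (X s' r - X s r - d *: X1 s r) +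
  (grad V (X s' r) - grad V (X s r) - amul (hs (X s r)) (X s' r - X s r)).
  have -> : X s' r - X s r - d *: X1 s r = (X s' r - X s r) + (- d) *: X1 s r.
    by rewrite scaleNr.
  rewrite amulD amulZ; move: (amul _ _) (amul _ _) => P Q.
  by apply/rowP => j; rewrite !mxE; ring.
apply: le_trans (ler_normD _ _) _; apply: lerD.
  by rewrite -mulrA; apply: amul_bound => //; apply: hs_bound; exact: XM.
apply: le_trans (grad_taylor (XM s r s1 r01) (XM s' r s'1 r01)) _.
have := Xl s s' r s1 s'1 r01; rewrite -/d => h.
have -> : 4 * K * Ba ^+ 2 * d ^+ 2 = K * (2 * (Ba * `|d|)) ^+ 2.
  by rewrite -(real_normK (num_real d)); ring.
by rewrite ler_wpM2l// ler_pXn2r// ?nnegrE// !mulr_ge0.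
Qed.

End Potential.

Lemma Vtame_exists (R : realType) n (V : 'rV[R]_n -> R) (M : R) : smooth V ->
  exists K, Vtame V M K.
Proof.
move=> sV.
have tl (h : 'rV[R]_n -> R) B B' : B <= B' -> tame M B h -> tame M B' h by exact: tame_le.
have [K0 h0] := smooth_tame M sV.
have [K1 K11 h1] : exists2 K, 1 <= K & forall i, tame M K ('d_i V).
  by apply: finite_bound => [i|i]; [exact: tl|apply: smooth_tame; exact: smooth_D].
have [K2 K21 h2] : exists2 K, 1 <= K & forall i : 'I_n * 'I_n, tame M K ('d_(i.2) ('d_(i.1) V)).
  apply: finite_bound => [i|i]; [exact: tl|apply: smooth_tame; by do 2 apply: smooth_D].
have [K3 K31 h3] : exists2 K, 1 <= K & forall i : 'I_n * 'I_n * 'I_n, tame M K (V3 V i.1.1 i.1.2 i.2).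
  apply: finite_bound => [i|i]; [exact: tl|apply: smooth_tame; by do 3 apply: smooth_D].
have [K4 K41 h4] : exists2 K, 1 <= K & forall i : 'I_n * 'I_n * 'I_n * 'I_n,
    tame M K (V4 V i.1.1.1 i.1.1.2 i.1.2 i.2).
  apply: finite_bound => [i|i]; [exact: tl|apply: smooth_tame; by do 4 apply: smooth_D].
exists (`|K0| + K1 + K2 + K3 + K4).
have K00 : K0 <= `|K0| by exact: ler_norm.
have K0p : 0 <= `|K0| by [].
split.
- lra.
- by apply: tl h0; lra.
- by move=> i; apply: tl (h1 i); lra.
- by move=> i k; apply: tl (h2 (i, k)); lra.
- by move=> i k l; apply: tl (h3 (i, k, l)); lra.
- by move=> i k l m; apply: tl (h4 (i, k, l, m)); lra.
Qed.

(** * Variations of trajectories and Jacobi fields *)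

Section JetFamily.
Context {R : realType} {n : nat}.
Implicit Types (B s r t e L : R) (Z f : R -> 'rV[R]_n).
Variables (V : 'rV[R]_n -> R) (V_smooth : smooth V) (M K : R) (VT : Vtame V M K).

(** By the chain rule, [hs1] and [hs2] are the entries of the first two derivatives of the Hessian
    along [s |-> q s], where [p] and [o] stand for the first two derivatives of [q]. *)
Definition hs1 (q p : 'rV[R]_n) i k := \sum_l p 0 l * V3 V i k l q.
Definition hs2 (q p o : 'rV[R]_n) i k :=
  \sum_l (o 0 l * V3 V i k l q + p 0 l * \sum_m p 0 m * V4 V i k l m q).

(* [q s] is the trajectory issued from [(x, al + s w)] and [J s] the Jacobi field along it
   with [J s 0 = u] and [J s 1 = 0]; [p], [o] and [J1], [J2] are the first two derivatives
   in [s] of [q] and [J]. *)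
Record jet_family e (x al w u : 'rV[R]_n) (q p o J J1 J2 : R -> R -> 'rV[R]_n) : Prop := {
  jf_W : forall s, `|s| <= 1 -> [/\ cont01 (q s), cont01 (p s), cont01 (o s), cont01 (J s) & cont01 (J1 s) /\ cont01 (J2 s)];
  jf_M : forall s t, `|s| <= 1 -> 0 <= t <= 1 -> `|q s t| <= M;
  jf_q : forall s t, `|s| <= 1 -> 0 <= t <= 1 ->
    q s t = (x + t *: (al + s *: w)) + (- e) *: vop prim2 (fun r => grad V (q s r)) t;
  jf_p : forall s t, `|s| <= 1 -> 0 <= t <= 1 ->
    p s t = t *: w + (- e) *: vop prim2 (fun r => amul (hs V (q s r)) (p s r)) t;
  jf_o : forall s t, `|s| <= 1 -> 0 <= t <= 1 ->
    o s t = 0 + (- e) *: vop prim2 (fun r => amul (hs V (q s r)) (o s r) +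
      amul (hs1 (q s r) (p s r)) (p s r)) t;
  jf_J : forall s t, `|s| <= 1 -> 0 <= t <= 1 ->
    J s t = (1 - t) *: u + e *: vop bvp (fun r => amul (hs V (q s r)) (J s r)) t;
  jf_J1 : forall s t, `|s| <= 1 -> 0 <= t <= 1 ->
    J1 s t = 0 + e *: vop bvp (fun r => amul (hs V (q s r)) (J1 s r) +
      amul (hs1 (q s r) (p s r)) (J s r)) t;
  jf_J2 : forall s t, `|s| <= 1 -> 0 <= t <= 1 ->
    J2 s t = 0 + e *: vop bvp (fun r => amul (hs V (q s r)) (J2 s r) +
      (amul (hs1 (q s r) (p s r)) (J1 s r) +
        (amul (hs2 (q s r) (p s r) (o s r)) (J s r) +
         amul (hs1 (q s r) (p s r)) (J1 s r)))) t;
  jf_qd : quad_derivv q p;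
  jf_pd : quad_derivv p o;
  jf_Jd : quad_derivv J J1;
  jf_J1d : quad_derivv J1 J2;
  jf_hd : forall i k, quad_deriv (fun s r => hs V (q s r) i k) (fun s r => hs1 (q s r) (p s r) i k);
  jf_h1d : forall i k, quad_deriv (fun s r => hs1 (q s r) (p s r) i k)
    (fun s r => hs2 (q s r) (p s r) (o s r) i k) }.

Lemma cont01_V3 Z i k l : cont01 Z -> cont01 (fun r => V3 V i k l (Z r)).
Proof.
move=> WZ; apply: (cont01_comp (h := V3 V i k l)) => //; apply: smooth_cont.
by do 3 apply: smooth_D.
Qed.

Lemma cont01_V4 Z i k l m : cont01 Z -> cont01 (fun r => V4 V i k l m (Z r)).
Proof.
move=> WZ; apply: (cont01_comp (h := V4 V i k l m)) => //; apply: smooth_cont.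
by do 4 apply: smooth_D.
Qed.

Lemma cont01_hs1 (q p : R -> 'rV[R]_n) i k : cont01 q -> cont01 p -> cont01 (fun r => hs1 (q r) (p r) i k).
Proof.
by move=> Wq /cont01_rVP Wp; apply: cont01_sum => l; apply: cont01_M; [exact: Wp|exact: cont01_V3].
Qed.

Lemma cont01_hs2 (q p o : R -> 'rV[R]_n) i k : cont01 q -> cont01 p -> cont01 o ->
  cont01 (fun r => hs2 (q r) (p r) (o r) i k).
Proof.
move=> Wq /cont01_rVP Wp /cont01_rVP Wo; apply: cont01_sum => l; apply: cont01_D; apply: cont01_M.
- exact: Wo.
- exact: cont01_V3.
- exact: Wp.
- by apply: cont01_sum => m; apply: cont01_M; [exact: Wp|exact: cont01_V4].
Qed.

Lemma quad_derivv_line (x al w : 'rV[R]_n) :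
  quad_derivv (fun s t => x + t *: (al + s *: w)) (fun _ t => t *: w).
Proof.
apply: (@quad_derivv_intro _ _ _ _ (`|x| + `|al| + `|w|)) => [s r s1 /andP[r0 r1]|s r s1 /andP[r0 r1]|].
- rewrite -addrA; apply: le_trans (ler_normD _ _) _; rewrite lerD2l normrZ ger0_norm//.
  apply: (@le_trans _ _ `|al + s *: w|); first by rewrite ler_piMl.
  apply: le_trans (ler_normD _ _) _; rewrite lerD2l normrZ.
  by rewrite ler_piMl.
- rewrite normrZ ger0_norm//; apply: (@le_trans _ _ `|w|); first by rewrite ler_piMl.
  by rewrite lerDr addr_ge0.
move=> s s' r s1 s'1 r01.
have -> : x + r *: (al + s' *: w) - (x + r *: (al + s *: w)) - (s' - s) *: (r *: w) = 0.
  by apply/rowP => i; rewrite !mxE; ring.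
by rewrite normr0 mulr_ge0 ?sqr_ge0// !addr_ge0.
Qed.

Lemma quad_derivv_fixed f : cont01 f -> quad_derivv (fun _ t => f t) (fun _ _ => 0).
Proof.
move=> /cont01_bounded[B B0 fB]; apply: (@quad_derivv_intro _ _ _ _ B) => [s r s1 r01|s r s1 r01|s s' r _ _ _].
- exact: fB.
- by rewrite normr0.
- by rewrite scaler0 subrr subr0 normr0 mulr_ge0 ?sqr_ge0.
Qed.

Lemma cont01_affine (x v : 'rV[R]_n) : cont01 (fun t : R => x + t *: v).
Proof. by apply: cont01_vD; [exact: cont01_vcst|apply: cont01_vZ; [exact: cont01_id|exact: cont01_vcst]]. Qed.

Lemma vop_addr0 (T : (R -> R) -> R -> R) f t : vop T (fun r => f r + 0) t = vop T f t.
Proof. by under eq_fun do rewrite addr0. Qed.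

Lemma vop_addrr0 (T : (R -> R) -> R -> R) f g t :
  vop T (fun r => f r + (g r + 0)) t = vop T (fun r => f r + g r) t.
Proof. by under eq_fun do rewrite addr0. Qed.

(** The factor [n + 1] covers both contraction conditions: [e K] for the nonlinear equation and
    [e n K] for the linear ones. [nl_derivative] differentiates [q] into [p]; after that all
    equations are affine with the same coefficient [hs V (q s)], and [affine_derivative] yields [o]
    from [p], [J1] from [J], and [J2] from [J1]. *)
Lemma jet_family_exists e (x al w u : 'rV[R]_n) : 0 <= e -> e * ((n%:R + 1) * K) <= 2^-1 ->
  `|x| + `|al| + `|w| <= M - 1 ->
  exists q p o J J1 J2, jet_family e x al w u q p o J J1 J2.
Proof.
move=> e0 eK xM.
have K0 : 0 <= K by have := Vtame_K VT; lra.
have nK0 : 0 <= n%:R * K by rewrite mulr_ge0.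
have enK : `|e| * (n%:R * K) <= 2^-1.
  by rewrite ger0_norm//; apply: le_trans eK; rewrite ler_wpM2l// mulrDl mul1r lerDl.
have eK1 : `|e| * K <= 2^-1.
  by rewrite ger0_norm//; apply: le_trans eK; rewrite ler_wpM2l// mulrDl mul1r lerDr.
have M1 : 1 <= M.
  by have : 0 <= `|x| + `|al| + `|w| by [rewrite !addr_ge0|]; lra.
have lineM s t : `|s| <= 1 -> 0 <= t <= 1 -> `|x + t *: (al + s *: w)| <= M - 1.
  move=> s1 /andP[t0 t1]; apply: le_trans xM.
  rewrite -addrA; apply: le_trans (ler_normD _ _) _; rewrite lerD2l normrZ ger0_norm//.
  apply: (@le_trans _ _ `|al + s *: w|); first by rewrite ler_piMl.
  apply: le_trans (ler_normD _ _) _; rewrite lerD2l normrZ.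
  by rewrite ler_piMl.
have exq s : exists Z, `|s| <= 1 -> [/\ cont01 Z,
    forall t, 0 <= t <= 1 -> `|Z t| <= M & forall t, 0 <= t <= 1 ->
    Z t = (x + t *: (al + s *: w)) + (- e) *: vop prim2 (fun r => grad V (Z r)) t].
  have [s1|ns1] := boolP (`|s| <= 1); last by exists 0.
  have [|||t t01|Z [WZ ZM ZE]] := @nl_exists _ _ V V_smooth M K VT _ green_prim2
    (fun t => x + t *: (al + s *: w)) (- e).
  - by rewrite normrN.
  - exact: M1.
  - exact: cont01_affine.
  - exact: lineM.
  - by exists Z.
have [q qP] := choice exq.
have Wq s (s1 : `|s| <= 1) : cont01 (q s) by have [] := qP s s1.
have qM s t : `|s| <= 1 -> 0 <= t <= 1 -> `|q s t| <= M by move=> s1; have [] := qP s s1; auto.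
have qE s t (s1 : `|s| <= 1) (t01 : 0 <= t <= 1) : q s t = (x + t *: (al + s *: w)) + (- e) *: vop prim2 (fun r => grad V (q s r)) t.
  by have [_ _] := qP s s1; exact.
have Ww : cont01 (fun t : R => t *: w) by apply: cont01_vZ; [exact: cont01_id|exact: cont01_vcst].
have [||s s1|||//|p [Wp pE qdp]] := @nl_derivative _ _ V V_smooth M K VT _ green_prim2 q
   (fun s t => x + t *: (al + s *: w)) (fun _ t => t *: w) (- e).
- by rewrite normrN.
- by rewrite normrN.
- by split; [exact: Wq|].
- exact: quad_derivv_line.
- exact: qM.
have Wh i k s (s1 : `|s| <= 1) : cont01 (fun r => hs V (q s r) i k) by apply: cont01_hs; [|exact: Wq].
have Wh1 i k s (s1 : `|s| <= 1) : cont01 (fun r => hs1 (q s r) (p s r) i k).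
  by apply: cont01_hs1; [exact: Wq|exact: Wp].
have hK i k s r (s1 : `|s| <= 1) (r01 : 0 <= r <= 1) : `|hs V (q s r) i k| <= K.
  by apply: (hs_bound VT); exact: qM.
have hqd i k : quad_deriv (fun s r => hs V (q s r) i k) (fun s r => hs1 (q s r) (p s r) i k).
  by apply: (@quad_deriv_comp _ _ ('d_k ('d_i V)) M q p) => //; do 2 apply: smooth_D.
have W0 : cont01 (fun _ : R => 0 : 'rV[R]_n) by exact: cont01_vcst.
have qd0 : quad_derivv (fun _ _ => 0) (fun _ _ => 0 : 'rV[R]_n) by exact: (quad_derivv_fixed W0).
have [||||||||o [Wo oE pdo]] := @affine_derivative _ _ _ green_prim2
   (fun i k s r => hs V (q s r) i k) (fun i k s r => hs1 (q s r) (p s r) i k) K (- e)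
   (fun _ t => t *: w) (fun _ _ => 0) (fun _ _ => 0) (fun _ _ => 0) p K0.
- by rewrite normrN.
- by move=> i k s s1; split; [exact: Wh|exact: Wh1].
- exact: hK.
- exact: hqd.
- by move=> s s1; split=> //; exact: Wp.
- exact: (quad_derivv_fixed Ww).
- exact: qd0.
- move=> s t s1 t01; by rewrite vop_addr0 -pE.
have h1qd i k : quad_deriv (fun s r => hs1 (q s r) (p s r) i k) (fun s r => hs2 (q s r) (p s r) (o s r) i k).
  apply: quad_deriv_sum => l; apply: (@quad_derivM _ _ _ (fun s r => V3 V i k l (q s r))
    (fun s r => \sum_m p s r 0 m * V4 V i k l m (q s r))); first exact: quad_derivv_coord.
  by apply: (@quad_deriv_comp _ _ (V3 V i k l) M q p) => //; do 3 apply: smooth_D.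
have Wh2 i k s (s1 : `|s| <= 1) : cont01 (fun r => hs2 (q s r) (p s r) (o s r) i k).
  by apply: cont01_hs2; [exact: Wq|exact: Wp|exact: Wo].
have Wu : cont01 (fun t : R => (1 - t) *: u).
  apply: cont01_vZ; last exact: cont01_vcst.
  by apply: cont01_D; [exact: cont01_cst|apply: cont01_N; exact: cont01_id].
have exJ s : exists Z, `|s| <= 1 -> cont01 Z /\ forall t, 0 <= t <= 1 ->
   Z t = (1 - t) *: u + e *: vop bvp (fun r => amul (hs V (q s r)) (Z r) + 0) t.
  have [s1|ns1] := boolP (`|s| <= 1); last by exists 0.
  have [| | | |Z WZ ZE] := @linear_exists _ _ bvp green_bvp (fun i k r => hs V (q s r) i k) K e
    (fun t => (1 - t) *: u) (fun=> 0) K0 enK.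
  - by move=> i k; exact: Wh.
  - by move=> i k r r01; exact: hK.
  - by [].
  - by [].
  - by exists Z.
have [J JP] := choice exJ.
have WJ s (s1 : `|s| <= 1) := (JP s s1).1.
have [|||||||J1 [WJ1 J1E JdJ1]] := @affine_derivative _ _ _ green_bvp
   (fun i k s r => hs V (q s r) i k) (fun i k s r => hs1 (q s r) (p s r) i k) K e
   (fun _ t => (1 - t) *: u) (fun _ _ => 0) (fun _ _ => 0) (fun _ _ => 0) J K0 enK.
- by move=> i k s s1; split; [exact: Wh|exact: Wh1].
- exact: hK.
- exact: hqd.
- by move=> s s1; split=> //; exact: WJ.
- exact: (quad_derivv_fixed Wu).
- exact: qd0.
- move=> s t s1 t01; exact: (JP s s1).2.
have WhJ s (s1 : `|s| <= 1) : cont01 (fun r => amul (hs1 (q s r) (p s r)) (J s r)).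
  by apply: cont01_amul => // [i k|]; [exact: Wh1|exact: WJ].
have [|||||||J2 [WJ2 J2E J1dJ2]] := @affine_derivative _ _ _ green_bvp
   (fun i k s r => hs V (q s r) i k) (fun i k s r => hs1 (q s r) (p s r) i k) K e
   (fun _ _ => 0) (fun _ _ => 0) (fun s r => amul (hs1 (q s r) (p s r)) (J s r))
   (fun s r => amul (hs2 (q s r) (p s r) (o s r)) (J s r) + amul (hs1 (q s r) (p s r)) (J1 s r))
   J1 K0 enK.
- by move=> i k s s1; split; [exact: Wh|exact: Wh1].
- exact: hK.
- exact: hqd.
- move=> s s1; split; [exact: WJ1|by []|exact: WhJ|].
  apply: cont01_vD; first by apply: cont01_amul => // [i k|]; [exact: Wh2|exact: WJ].
  by apply: cont01_amul => // [i k|]; [exact: Wh1|exact: WJ1].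
- exact: qd0.
- by apply: (@quad_derivv_amul _ _ (fun i k s r => hs1 (q s r) (p s r) i k)
    (fun i k s r => hs2 (q s r) (p s r) (o s r) i k)).
- move=> s t s1 t01; by rewrite (J1E s t s1 t01) vop_addrr0.
have oE' s t : `|s| <= 1 -> 0 <= t <= 1 ->
    o s t = 0 + (- e) *: vop prim2 (fun r => amul (hs V (q s r)) (o s r) +
      amul (hs1 (q s r) (p s r)) (p s r)) t.
  move=> s1 t01; by rewrite (oE s t s1 t01) vop_addrr0.
have JE' s t : `|s| <= 1 -> 0 <= t <= 1 ->
    J s t = (1 - t) *: u + e *: vop bvp (fun r => amul (hs V (q s r)) (J s r)) t.
  by move=> s1 t01; have := (JP s s1).2 t t01; rewrite vop_addr0; exact.
have J1E' s t : `|s| <= 1 -> 0 <= t <= 1 ->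
    J1 s t = 0 + e *: vop bvp (fun r => amul (hs V (q s r)) (J1 s r) +
      amul (hs1 (q s r) (p s r)) (J s r)) t.
  move=> s1 t01; by rewrite (J1E s t s1 t01) vop_addrr0.
have WW s (s1 : `|s| <= 1) : [/\ cont01 (q s), cont01 (p s), cont01 (o s), cont01 (J s) & cont01 (J1 s) /\ cont01 (J2 s)].
  split; [exact: Wq|exact: Wp|exact: Wo|exact: WJ|].
  by split; [exact: WJ1|exact: WJ2].
exists q, p, o, J, J1, J2.
by split; [exact: WW|exact: qM|exact: qE|exact: pE|exact: oE'|exact: JE'|exact: J1E'|
  exact: J2E|exact: qdp|exact: pdo|exact: JdJ1|exact: J1dJ2|exact: hqd|exact: h1qd].
Qed.

End JetFamily.

(** * Expansion of the jets for small [e] *)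

Section Estimates.
Context {R : realType} {n : nat}.
Implicit Types (B s r t e L : R) (Z f : R -> 'rV[R]_n).
Variables (V : 'rV[R]_n -> R) (V_smooth : smooth V) (M K : R) (VT : Vtame V M K).
Let K0 : 0 <= K. Proof. by have := Vtame_K VT; lra. Qed.
Local Notation N := (n%:R : R).

Lemma hs1_bound q p (P : R) i k : 0 <= P -> `|q| <= M -> `|p| <= P ->
  `|hs1 V q p i k| <= N * (P * K).
Proof.
move=> P0 qM pP; apply: sum_le_n => l; rewrite normrM ler_pM//.
  exact: le_trans (coord_le _ _) pP.
by have [] := Vtame3 VT i k l qM qM.
Qed.

Lemma hs2_bound q p o (P O : R) i k : 0 <= P -> 0 <= O ->
  `|q| <= M -> `|p| <= P -> `|o| <= O ->
  `|hs2 V q p o i k| <= N * (O * K + P * (N * (P * K))).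
Proof.
move=> P0 O0 qM pP oO; apply: sum_le_n => l; apply: le_trans (ler_normD _ _) _.
apply: lerD; rewrite normrM ler_pM//.
- exact: le_trans (coord_le _ _) oO.
- by have [] := Vtame3 VT i k l qM qM.
- exact: le_trans (coord_le _ _) pP.
apply: sum_le_n => m; rewrite normrM ler_pM//.
  exact: le_trans (coord_le _ _) pP.
by have [] := Vtame4 VT i k l m qM qM.
Qed.

Lemma prod_diff (a b c c' : R) : a * c - b * c' = (a - b) * c + b * (c - c').
Proof. by ring. Qed.

(** The second jet [o] is compared with [0] because the straight line is affine in [s]. It enters
    the bound through its own size [O], which is of order [e] in the application. *)
Lemma hs2_diff q q' p p' o (P O d : R) i k : 0 <= P -> 0 <= O -> 0 <= d ->
  `|q| <= M -> `|q'| <= M -> `|p| <= P -> `|p'| <= P -> `|o| <= O ->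
  `|q - q'| <= d -> `|p - p'| <= d ->
  `|hs2 V q p o i k - hs2 V q' p' 0 i k| <=
    N * (O * K + (d * (N * (P * K)) + P * (N * (d * K + P * (K * d))))).
Proof.
move=> P0 O0 d0 qM q'M pP p'P oO quad_deriv pd; rewrite /hs2 -sumrB; apply: sum_le_n => l.
rewrite [X in _ - (X * _ + _)]mxE mul0r add0r -addrA.
apply: le_trans (ler_normD _ _) _; apply: lerD.
  rewrite normrM ler_pM//; first exact: le_trans (coord_le _ _) oO.
  by have [] := Vtame3 VT i k l qM qM.
rewrite prod_diff.
apply: le_trans (ler_normD _ _) _; apply: lerD; rewrite normrM ler_pM//.
- by apply: le_trans pd; have := coord_le (p - p') l; rewrite !mxE.
- apply: sum_le_n => m; rewrite normrM ler_pM//.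
    exact: le_trans (coord_le _ _) pP.
  by have [] := Vtame4 VT i k l m qM qM.
- exact: le_trans (coord_le _ _) p'P.
rewrite -sumrB; apply: sum_le_n => m.
rewrite prod_diff.
apply: le_trans (ler_normD _ _) _; apply: lerD; rewrite normrM ler_pM//.
- by apply: le_trans pd; have := coord_le (p - p') m; rewrite !mxE.
- by have [] := Vtame4 VT i k l m qM qM.
- exact: le_trans (coord_le _ _) p'P.
have [_ h _] := Vtame4 VT i k l m q'M qM; apply: le_trans h _.
by rewrite ler_wpM2l.
Qed.

Lemma sum5 (a b c c' d e : R) :
  (a + b + c + (c' + d)) * e = a * e + (b * e + (c * e + (c' * e + d * e))).
Proof. by ring. Qed.

(* The second derivative in [s] of [Hess V (q s r) (J s r)]; [jet2_ref] is its value for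
   [e = 0]. *)
Definition jet2 (q p o J J1 J2 : R -> R -> 'rV[R]_n) s r : 'rV[R]_n :=
  amul (hs2 V (q s r) (p s r) (o s r)) (J s r) + amul (hs1 V (q s r) (p s r)) (J1 s r) +
  (amul (hs1 V (q s r) (p s r)) (J1 s r) + amul (hs V (q s r)) (J2 s r)).

Definition jet2_ref (x al w u : 'rV[R]_n) r : 'rV[R]_n :=
  amul (hs2 V (x + r *: al) (r *: w) 0) ((1 - r) *: u).

(** The equations for [o], [J1] and [J2] have no term outside the factor [e], so [fix_bound] with
    [al := 0] makes all three of order [e]. Only the product of [hs2] with [J] survives at order
    zero, and it differs by order [e] from its value on the straight line. *)
Lemma jet_estimate : exists2 C : R, 0 <= C &
  forall e x al w u q p o J J1 J2, 0 <= e <= 1 -> e * ((N + 1) * K) <= 2^-1 ->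
  `|w| <= 1 -> `|u| <= 1 -> `|x| + `|al| + `|w| <= M - 1 ->
  jet_family V M e x al w u q p o J J1 J2 ->
  forall r, 0 <= r <= 1 -> `|jet2 q p o J J1 J2 0 r - jet2_ref x al w u r| <= C * e.
Proof.
(* Here [2] bounds [p] and [J]. [A] bounds the entries of [hs1], [A2] the sources of [o] and [J1],
   [A3] the entries of [hs2], [A4] the source of [J2]; [d e] bounds the deviation of [q], [p], [J]
   from their values at [e = 0], [B2 e] that of [hs2], and [H] the entries of [hs2] on the straight
   line. Bodies are cleared so that the constants are atoms for the arithmetic tactics. *)
pose A := N * (2 * K); have A0 : 0 <= A by rewrite !mulr_ge0.
have AE : A = N * (2 * K) by []; clearbody A.
pose A2 := N * (A * 2); have A20 : 0 <= A2 by rewrite !mulr_ge0.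
have A2E : A2 = N * (A * 2) by []; clearbody A2.
pose A3 := N * (2 * A2 * K + 2 * (N * (2 * K))).
have A30 : 0 <= A3 by rewrite mulr_ge0// addr_ge0// !mulr_ge0.
have A3E : A3 = N * (2 * A2 * K + 2 * (N * (2 * K))) by []; clearbody A3.
pose A4 := N * (A * (2 * A2)) + (N * (A3 * 2) + N * (A * (2 * A2))).
have A40 : 0 <= A4 by rewrite !addr_ge0// !mulr_ge0.
have A4E : A4 = N * (A * (2 * A2)) + (N * (A3 * 2) + N * (A * (2 * A2))) by []; clearbody A4.
pose d := K + N * (K * 2); have d0 : 0 <= d by rewrite addr_ge0// !mulr_ge0.
have dE : d = K + N * (K * 2) by []; clearbody d.
pose B2 := N * (2 * A2 * K + (d * (N * (2 * K)) + 2 * (N * (d * K + 2 * (K * d))))).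
have B20 : 0 <= B2.
  by rewrite mulr_ge0// addr_ge0 ?mulr_ge0// addr_ge0 ?mulr_ge0// addr_ge0 ?mulr_ge0.
have B2E : B2 = N * (2 * A2 * K + (d * (N * (2 * K)) + 2 * (N * (d * K + 2 * (K * d))))) by [].
clearbody B2.
pose H := N * (0 * K + 1 * (N * (1 * K))).
have H0 : 0 <= H by rewrite /H mul0r add0r mul1r !mulr_ge0.
have HE : H = N * (0 * K + 1 * (N * (1 * K))) by []; clearbody H.
exists (N * (H * d) + N * (B2 * 2) + N * (A * (2 * A2)) +
   (N * (A * (2 * A2)) + N * (K * (2 * A4)))).
  by rewrite !addr_ge0// !mulr_ge0.
move=> e x al w u q p o J J1 J2 /andP[e0 e1] eK w1 u1 xM jf r r01.
have z1 : `|0 : R| <= 1 by rewrite normr0.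
have [Wq Wp Wo WJ [WJ1 WJ2]] := jf_W jf z1.
have nK0 : 0 <= N * K by rewrite mulr_ge0.
have enK : `|e| * (N * K) <= 2^-1.
  by rewrite ger0_norm//; apply: le_trans eK; rewrite ler_wpM2l// mulrDl mul1r lerDl.
have enK' : `|- e| * (N * K) <= 2^-1 by rewrite normrN.
have hK t : 0 <= t <= 1 -> forall i k, `|hs V (q 0 t) i k| <= K.
  by move=> t01; apply: (hs_bound VT); exact: (jf_M jf).
have Wh i k : cont01 (fun r => hs V (q 0 r) i k) by exact: cont01_hs.
have Wh1 i k : cont01 (fun r => hs1 V (q 0 r) (p 0 r) i k) by exact: cont01_hs1.
have Wh2 i k : cont01 (fun r => hs2 V (q 0 r) (p 0 r) (o 0 r) i k) by exact: cont01_hs2.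
have WhY f : cont01 f -> cont01 (fun r => amul (hs V (q 0 r)) (f r)) by exact: cont01_amul.
have Wh1Y f : cont01 f -> cont01 (fun r => amul (hs1 V (q 0 r) (p 0 r)) (f r)) by exact: cont01_amul.
have Wh2Y f : cont01 f -> cont01 (fun r => amul (hs2 V (q 0 r) (p 0 r) (o 0 r)) (f r)) by exact: cont01_amul.
have hY t (v : 'rV[R]_n) : 0 <= t <= 1 -> `|amul (hs V (q 0 t)) v| <= N * K * `|v|.
  by move=> t01; rewrite -mulrA; apply: amul_bound => //; exact: hK.
have scale_le t (v : 'rV[R]_n) : 0 <= t <= 1 -> `|v| <= 1 -> `|t *: v| <= 1.
  by move=> /andP[t0 t1] v1; rewrite normrZ ger0_norm// mulr_ile1.
have p2 t : 0 <= t <= 1 -> `|p 0 t| <= 2.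
  move=> t01; apply: le_trans (fix_bound green_prim2 Wp (WhY _ Wp) nK0 (lexx 0) enK'
    (fun t => jf_p jf z1) (al := 1) _ _ t01) _.
  - by move=> t' t'01; exact: scale_le.
  - by move=> t' t'01; rewrite addr0; exact: hY.
  - by rewrite mulr0 addr0 mulr1.
have sub01 t : 0 <= t <= 1 -> 0 <= 1 - t <= 1 by lra.
have J2b t : 0 <= t <= 1 -> `|J 0 t| <= 2.
  move=> t01; apply: le_trans (fix_bound green_bvp WJ (WhY _ WJ) nK0 (lexx 0) enK
    (fun t => jf_J jf z1) (al := 1) _ _ t01) _.
  - by move=> t' /sub01 t'01; exact: scale_le.
  - by move=> t' t'01; rewrite addr0; exact: hY.
  - by rewrite mulr0 addr0 mulr1.
have h1A t : 0 <= t <= 1 -> forall i k, `|hs1 V (q 0 t) (p 0 t) i k| <= A.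
  by move=> t01 i k; rewrite AE; apply: hs1_bound => //; [exact: (jf_M jf)|exact: p2].
have ob t : 0 <= t <= 1 -> `|o 0 t| <= 2 * A2 * e.
  move=> t01; apply: le_trans (fix_bound green_prim2 Wo (cont01_vD (WhY _ Wo) (Wh1Y _ Wp)) nK0 A20 enK'
    (fun t => jf_o jf z1) (al := 0) _ _ t01) _.
  - by move=> t' t'01; rewrite normr0.
  - move=> t' t'01; apply: le_trans (ler_normD _ _) (lerD (hY _ _ t'01) _).
    by rewrite A2E; apply: amul_bound => //; [exact: h1A|exact: p2].
  - by rewrite add0r normrN ger0_norm// -mulrA [e * _]mulrC.
have J1b t : 0 <= t <= 1 -> `|J1 0 t| <= 2 * A2 * e.
  move=> t01; apply: le_trans (fix_bound green_bvp WJ1 (cont01_vD (WhY _ WJ1) (Wh1Y _ WJ)) nK0 A20 enK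
    (fun t => jf_J1 jf z1) (al := 0) _ _ t01) _.
  - by move=> t' t'01; rewrite normr0.
  - move=> t' t'01; apply: le_trans (ler_normD _ _) (lerD (hY _ _ t'01) _).
    by rewrite A2E; apply: amul_bound => //; [exact: h1A|exact: J2b].
  - by rewrite add0r ger0_norm// -mulrA [e * _]mulrC.
have A2e : 0 <= 2 * A2 * e by rewrite !mulr_ge0.
have A2e1 : 2 * A2 * e <= 2 * A2 by rewrite ler_piMr// mulr_ge0.
have h2A t : 0 <= t <= 1 -> forall i k, `|hs2 V (q 0 t) (p 0 t) (o 0 t) i k| <= A3.
  move=> t01 i k; rewrite A3E; apply: hs2_bound => //.
  - by rewrite mulr_ge0.
  - exact: (jf_M jf).
  - exact: p2.
  - exact: le_trans (ob _ t01) A2e1.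
have J2bb t : 0 <= t <= 1 -> `|J2 0 t| <= 2 * A4 * e.
  move=> t01.
  have Wf := cont01_vD (WhY _ WJ2) (cont01_vD (Wh1Y _ WJ1) (cont01_vD (Wh2Y _ WJ) (Wh1Y _ WJ1))).
  apply: le_trans (fix_bound green_bvp WJ2 Wf nK0 A40 enK
    (fun t => jf_J2 jf z1) (al := 0) _ _ t01) _.
  - by move=> t' t'01; rewrite normr0.
  - move=> t' t'01; apply: le_trans (ler_normD _ _) (lerD (hY _ _ t'01) _).
    have h1J : `|amul (hs1 V (q 0 t') (p 0 t')) (J1 0 t')| <= N * (A * (2 * A2)).
      apply: amul_bound => //; [by rewrite mulr_ge0|exact: h1A|].
      exact: le_trans (J1b _ t'01) A2e1.
    rewrite A4E; apply: le_trans (ler_normD _ _) (lerD h1J _).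
    apply: le_trans (ler_normD _ _) (lerD _ h1J).
    by apply: amul_bound => //; [exact: h2A|exact: J2b].
  - by rewrite add0r ger0_norm// -mulrA [e * _]mulrC.
have de : 0 <= d * e by rewrite mulr_ge0.
have quad_deriv : `|q 0 r - (x + r *: al)| <= d * e.
  rewrite (jf_q jf z1 r01) scale0r addr0 addrC addKr normrZ normrN ger0_norm//.
  have : `|vop prim2 (fun r => grad V (q 0 r)) r| <= K.
    apply: (vop_bound green_prim2) => //; first exact: cont01_grad.
    by move=> t t01; apply: (grad_bound VT); exact: (jf_M jf).
  move=> h; rewrite mulrC ler_wpM2r//; apply: le_trans h _.
  by rewrite dE lerDl !mulr_ge0.
have lin_le (Y : R -> 'rV[R]_n) T (gT : green T) : cont01 Y -> (forall t, 0 <= t <= 1 -> `|Y t| <= 2) ->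
    `|e *: vop T (fun r => amul (hs V (q 0 r)) (Y r)) r| <= d * e.
  move=> WY Y2; rewrite normrZ ger0_norm// mulrC ler_wpM2r//.
  apply: (@le_trans _ _ (N * (K * 2))); last by rewrite dE lerDr.
  apply: (vop_bound gT) => //; [by rewrite !mulr_ge0|exact: WhY|].
  by move=> t t01; apply: amul_bound => //; [exact: hK|exact: Y2].
have pd : `|p 0 r - r *: w| <= d * e.
  rewrite (jf_p jf z1 r01) addrC addKr scaleNr normrN.
  exact: (lin_le _ _ green_prim2 Wp p2).
have Jd : `|J 0 r - (1 - r) *: u| <= d * e.
  rewrite (jf_J jf z1 r01) addrC addKr.
  exact: (lin_le _ _ green_bvp WJ J2b).
have refM : `|x + r *: al| <= M.
  apply: le_trans (ler_normD _ _) _; rewrite normrZ.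
  case/andP: r01 => r0 r1; rewrite ger0_norm//.
  have h : r * `|al| <= `|al| by rewrite ler_piMl.
  have := normr_ge0 w; lra.
have rw1 : `|r *: w| <= 1 by exact: scale_le.
have h2d i k : `|hs2 V (q 0 r) (p 0 r) (o 0 r) i k - hs2 V (x + r *: al) (r *: w) 0 i k| <= B2 * e.
  have -> : B2 * e = N * ((2 * A2 * e) * K + ((d * e) * (N * (2 * K)) +
     2 * (N * ((d * e) * K + 2 * (K * (d * e)))))) by rewrite B2E; ring.
  apply: hs2_diff => //; [exact: (jf_M jf)|exact: p2|by lra|exact: ob].
(* Five terms, in the order of the summands of the constant: the variation of [J], the variation of
   [hs2], twice the term in [J1], and the term in [J2]. *)
rewrite /jet2 /jet2_ref -(addrA (amul (hs2 V (q 0 r) _ _) _)) addrAC.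
rewrite (amulB (hs2 V (x + r *: al) (r *: w) 0)) sum5 -!addrA.
apply: le_trans (ler_normD _ _) (lerD _ _).
  have -> : N * (H * d) * e = N * (H * (d * e)) by ring.
  by apply: amul_bound => // i k; rewrite HE; apply: hs2_bound => //; rewrite normr0.
apply: le_trans (ler_normD _ _) (lerD _ _).
  have -> : N * (B2 * 2) * e = N * ((B2 * e) * 2) by ring.
  by apply: amul_bound => //; [rewrite mulr_ge0|exact: J2b].
have h1J : `|amul (hs1 V (q 0 r) (p 0 r)) (J1 0 r)| <= N * (A * (2 * A2)) * e.
  have -> : N * (A * (2 * A2)) * e = N * (A * (2 * A2 * e)) by ring.
  by apply: amul_bound => //; [exact: h1A|exact: J1b].
apply: le_trans (ler_normD _ _) (lerD h1J _).
apply: le_trans (ler_normD _ _) (lerD h1J _).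
have -> : N * (K * (2 * A4)) * e = N * (K * (2 * A4 * e)) by ring.
by apply: amul_bound => //; [rewrite !mulr_ge0|exact: hK|exact: J2bb].
Qed.

End Estimates.

(** * Second derivative in [s] and the Hessian integral *)

Section SecondDerivative.
Context {R : realType} {n : nat}.
Implicit Types (B s r t e L : R) (Z f : R -> 'rV[R]_n) (x al w u : 'rV[R]_n).
Variables (V : 'rV[R]_n -> R) (V_smooth : smooth V) (M K : R) (VT : Vtame V M K).

Lemma is_derive_mull (c : R) (f : R -> R) s df :
  is_derive s 1 f df -> is_derive s 1 (fun s => c * f s) (c * df).
Proof. by move=> d; exact: is_deriveZ. Qed.

Lemma derive1_matrix m1 m2 (F : R -> 'M[R]_(m1, m2)) (G : 'M[R]_(m1, m2)) s :
  (forall i j, is_derive s 1 (fun s => F s i j) (G i j)) -> derive1 F s = G.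
Proof.
move=> H; rewrite derive1E derive_mx.
  by apply/matrixP => i j; rewrite mxE; exact: derive_val.
by apply/derivable_mxP => i j; exact: ex_derive.
Qed.

Lemma derive_line_sum (h : 'rV[R]_n -> R) x al w s t : smooth h ->
  is_derive s 1 (fun s => h (x + t *: (al + s *: w)))
    (\sum_l (t *: w) 0 l * 'd_l h (x + t *: (al + s *: w))).
Proof.
move=> sh; have E s0 : x + t *: (al + s0 *: w) = (x + t *: al) + s0 *: (t *: w).
  by rewrite scalerDr addrA !scalerA mulrC.
under eq_fun do rewrite E.
have dh y : differentiable h y by exact: smooth_diff.
have := is_derive_line (x + t *: al) (t *: w) s dh.
rewrite deriveE_sum// -E; exact.
Qed.

(** The indices are swapped because [Hess] has the entries ['d_i ('d_j V)] while [hs q i k] is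
    ['d_k ('d_i V)]. The swap disappears in the quadratic form of [hess_integralE], by exchanging
    the two sums. *)
Lemma hess_second_derivative x al w t :
  derive1n 2 (fun s : R => Hess V (x + t *: (al + s *: w))) 0 =
  \matrix_(i, j) hs2 V (x + t *: al) (t *: w) 0 j i.
Proof.
have V3s i k l : smooth (V3 V i k l) by do 3 apply: smooth_D.
have V2s i k : smooth ('d_k ('d_i V)) by do 2 apply: smooth_D.
have E1 : derive1 (fun s : R => Hess V (x + t *: (al + s *: w))) = fun s =>
    \matrix_(i, j) \sum_l (t *: w) 0 l * V3 V j i l (x + t *: (al + s *: w)).
  apply/funext => s; apply: derive1_matrix => i j; rewrite mxE.
  by under eq_fun do rewrite mxE; apply: derive_line_sum.
rewrite derive1nS derive1n1 E1; apply: derive1_matrix => i j; rewrite mxE.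
under eq_fun do rewrite mxE.
have E2 : hs2 V (x + t *: al) (t *: w) 0 j i =
    \sum_l (t *: w) 0 l * \sum_m (t *: w) 0 m * V4 V j i l m (x + t *: (al + 0 *: w)).
  rewrite scale0r addr0; apply: eq_bigr => l _.
  by rewrite [X in X * _ + _]mxE mul0r add0r.
rewrite E2.
have -> : (fun s : R => \sum_l (t *: w) 0 l * V3 V j i l (x + t *: (al + s *: w))) =
    \sum_l (fun s : R => (t *: w) 0 l * V3 V j i l (x + t *: (al + s *: w))).
  by apply/funext => s; rewrite fct_sumE.
apply: is_derive_sum => l.
have := derive_line_sum x al w 0 t (V3s j i l) => d3.
exact: is_derive_mull.
Qed.

Lemma cont01_jet2_ref x al w u : cont01 (jet2_ref V x al w u).
Proof.
have Ww : cont01 (fun r : R => r *: w) by apply: cont01_vZ; [exact: cont01_id|exact: cont01_vcst].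
apply: cont01_amul => [i k|].
  apply: (@cont01_hs2 _ _ V V_smooth (fun r => x + r *: al) (fun r => r *: w) (fun=> 0)).
  - exact: cont01_affine.
  - exact: Ww.
  - exact: cont01_vcst.
apply: cont01_vZ; last exact: cont01_vcst.
by apply: cont01_D; [exact: cont01_cst|apply: cont01_N; exact: cont01_id].
Qed.

Lemma prim2_sum m (F : 'I_m -> R -> R) (c : 'I_m -> R) t : (forall i, cont01 (F i)) ->
  0 <= t <= 1 -> prim2 (fun r => \sum_i c i * F i r) t = \sum_i c i * prim2 (F i) t.
Proof.
move=> WF t01; elim: (index_enum _) => [|i l IH].
  under eq_fun do rewrite big_nil.
  have -> : (fun _ : R => 0 : R) = (fun r => 0 * (fun _ : R => 0 : R) r).
    by apply/funext => r; rewrite mul0r.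
  by rewrite prim2Z ?mul0r ?big_nil//; exact: cont01_cst.
under eq_fun do rewrite big_cons; rewrite big_cons prim2D//; first by rewrite prim2Z ?IH.
  exact: cont01_Z.
elim: l {IH} => [|j l IH]; first by under eq_fun do rewrite big_nil; exact: cont01_cst.
by under eq_fun do rewrite big_cons; apply: cont01_D => //; exact: cont01_Z.
Qed.

Lemma hess_integralE x al u w :
  hess_integral V x al u w = dotv u (vop prim2 (jet2_ref V x al w u) 1).
Proof.
rewrite /hess_integral -prim2E /dotv.
have WJ i : cont01 (fun r => jet2_ref V x al w u r 0 i) by move/cont01_rVP : (@cont01_jet2_ref x al w u); exact.
transitivity (prim2 (fun r => \sum_i u 0 i * jet2_ref V x al w u r 0 i) 1); last first.
  by rewrite prim2_sum ?le01//; apply: eq_bigr => i _; rewrite mxE.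
apply: prim2_ext => t t01; rewrite hess_second_derivative.
under eq_bigr do rewrite mxE mulr_sumr.
under [RHS]eq_bigr do rewrite mxE mulr_sumr.
rewrite exchange_big; apply: eq_bigr => i _; apply: eq_bigr => j _ /=.
by rewrite !mxE; ring.
Qed.

Lemma cont01_jet2 e x al w u q p o J J1 J2 s : jet_family V M e x al w u q p o J J1 J2 ->
  `|s| <= 1 -> cont01 (jet2 V q p o J J1 J2 s).
Proof.
move=> jf s1; have [Wq Wp Wo WJ [WJ1 WJ2]] := jf_W jf s1.
have Wh i k : cont01 (fun r => hs V (q s r) i k) by exact: cont01_hs.
have Wh1 i k : cont01 (fun r => hs1 V (q s r) (p s r) i k) by exact: cont01_hs1.
have Wh2 i k : cont01 (fun r => hs2 V (q s r) (p s r) (o s r) i k) by exact: cont01_hs2.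
by apply: cont01_vD; apply: cont01_vD; exact: cont01_amul.
Qed.

(** A second derivative at [0] requires the first one on a neighbourhood, hence the two clauses:
    [G1] on the whole open interval, then one more derivative at [0]. *)
Lemma jet_second_derivative e x al w u q p o J J1 J2 : jet_family V M e x al w u q p o J J1 J2 ->
  exists G1 : R -> R,
   (forall s, `|s| < 1 -> is_derive s 1 (fun s =>
      dotv u (vop prim2 (fun r => amul (hs V (q s r)) (J s r)) 1)) (G1 s)) /\
   is_derive (0 : R) 1 G1 (dotv u (vop prim2 (jet2 V q p o J J1 J2 0) 1)).
Proof.
move=> jf.
have qdA := quad_derivv_amul (jf_hd jf) (jf_Jd jf).
have qdB := quad_derivvD (quad_derivv_amul (jf_h1d jf) (jf_Jd jf)) (quad_derivv_amul (jf_hd jf) (jf_J1d jf)).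
pose F1 s r := amul (hs1 V (q s r) (p s r)) (J s r) + amul (hs V (q s r)) (J1 s r).
have main (X X1 : R -> R -> 'rV[R]_n) : (forall s, `|s| <= 1 -> cont01 (X s) /\ cont01 (X1 s)) -> quad_derivv X X1 ->
    forall s, `|s| < 1 ->
    is_derive s 1 (fun s => dotv u (vop prim2 (X s) 1)) (dotv u (vop prim2 (X1 s) 1)).
  move=> HW HX s s1.
  have -> : (fun s => dotv u (vop prim2 (X s) 1)) =
      \sum_i (fun s => u 0 i * prim2 (fun r => X s r 0 i) 1).
    by apply/funext => s0; rewrite fct_sumE; apply: eq_bigr => i _; rewrite mxE.
  have -> : dotv u (vop prim2 (X1 s) 1) = \sum_i u 0 i * prim2 (fun r => X1 s r 0 i) 1.
    by apply: eq_bigr => i _; rewrite mxE.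
  apply: is_derive_sum => i.
  have WX s0 : `|s0| <= 1 -> cont01 (fun r => X s0 r 0 i) by move=> /HW[/cont01_rVP+ _]; exact.
  have WX1 s0 : `|s0| <= 1 -> cont01 (fun r => X1 s0 r 0 i) by move=> /HW[_ /cont01_rVP+]; exact.
  have := quad_deriv_derive (quad_deriv_green green_prim2 WX WX1 (quad_derivv_coord i HX)) s1 (@le01 R) => d.
  exact: is_derive_mull.
have WA s : `|s| <= 1 -> cont01 (fun r => amul (hs V (q s r)) (J s r)) /\ cont01 (F1 s).
  move=> s1; have [Wq Wp Wo WJ [WJ1 WJ2]] := jf_W jf s1.
  have Wh i k : cont01 (fun r => hs V (q s r) i k) by exact: cont01_hs.
  have Wh1 i k : cont01 (fun r => hs1 V (q s r) (p s r) i k) by exact: cont01_hs1.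
  by split; [exact: cont01_amul|apply: cont01_vD; exact: cont01_amul].
have WB s : `|s| <= 1 -> cont01 (F1 s) /\ cont01 (jet2 V q p o J J1 J2 s).
  by move=> s1; split; [have [] := WA s s1|exact: (cont01_jet2 jf)].
have d1 := main _ _ WA qdA.
have d2 := main _ _ WB qdB.
exists (fun s => dotv u (vop prim2 (F1 s) 1)).
split; first exact: d1.
by apply: d2; rewrite normr0.
Qed.

End SecondDerivative.

(** * Hamiltonian flow *)

Lemma is_derive_linear (R : realType) (E F : normedModType R) (l : E -> F) (z : R -> E) (r : R) (dz : E) :
  (forall a b, l (a - b) = l a - l b) -> (forall (c : R) a, l (c *: a) = c *: l a) ->
  continuous l -> is_derive r 1 z dz -> is_derive r 1 (fun r => l (z r)) (l dz).
Proof.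
move=> lB lZ lc d.
have c1 : (fun h : R => h^-1 *: ((z \o shift r) (h *: 1) - z r)) @ 0^' --> dz.
  rewrite -(@derive_val _ _ _ _ _ _ _ d); exact: (@ex_derive _ _ _ _ _ _ _ d).
have c2 : (fun h : R => h^-1 *: (((fun r => l (z r)) \o shift r) (h *: 1) - l (z r))) @ 0^' --> l dz.
  under eq_fun do rewrite /= -lB -lZ.
  exact: (continuous_cvg _ (lc dz) c1).
by apply: DeriveDef; [apply/cvg_ex; exists (l dz)|exact: cvg_lim c2].
Qed.

Section Hamiltonian.
Context {R : realType} {n : nat}.
Implicit Types (p q v x al : 'rV[R]_n) (t r : R).

Lemma is_derive_coord p v i : is_derive p v (fun p => p 0 i) (v 0 i).
Proof.
have c : (fun h : R => h^-1 *: (((fun p : 'rV[R]_n => p 0 i) \o shift p) (h *: v) - p 0 i)) @ 0^' --> v 0 i.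
  apply/cvgrPdist_le => eta eta0.
  have n0 : \forall h \near (0 : R)^', h != 0 by exact: nbhs_dnbhs_neq.
  apply: filterS n0 => h h0 /=.
  by rewrite !mxE addrK /GRing.scale/= mulrA mulVf// mul1r subrr normr0 ltW.
by apply: DeriveDef; [apply/cvg_ex; exists (v 0 i)|exact: cvg_lim c].
Qed.

Lemma dotv_ge0 p : 0 <= dotv p p.
Proof. by apply: sumr_ge0 => i _; rewrite -expr2 sqr_ge0. Qed.

Lemma enorm_sqr p : enorm p ^+ 2 = dotv p p.
Proof. by rewrite sqr_sqrtr// dotv_ge0. Qed.

Variables (V : 'rV[R]_n -> R) (V_smooth : smooth V) (e : R).

Lemma hamiltonian_fieldE (z : 'rV[R]_n * 'rV[R]_n) :
  hamiltonian_field (hamiltonian V e) z = (z.2, - (e *: grad V z.1)).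
Proof.
rewrite /hamiltonian_field /hamiltonian/=; congr pair.
  apply/rowP => i; rewrite mxE.
  have -> : (fun p => 2^-1 * enorm p ^+ 2 + e * V z.1) =
      (fun p => 2^-1 * \sum_j p 0 j * p 0 j + e * V z.1).
    by apply/funext => p; rewrite enorm_sqr.
  have d1 : is_derive z.2 (delta_mx 0 i) (\sum_j (fun p : 'rV[R]_n => p 0 j * p 0 j))
     (\sum_j (2 * z.2 0 j * (delta_mx 0 i : 'rV[R]_n) 0 j)).
    apply: is_derive_sum => j.
    have d := is_derive_coord z.2 (delta_mx 0 i) j.
    have -> : 2 * z.2 0 j * (delta_mx 0 i : 'rV[R]_n) 0 j =
        z.2 0 j *: (delta_mx 0 i : 'rV[R]_n) 0 j + z.2 0 j *: (delta_mx 0 i : 'rV[R]_n) 0 j.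
      by rewrite /GRing.scale/=; ring.
    exact: (is_deriveM d d).
  have d2 : is_derive z.2 (delta_mx 0 i) (fun p => 2^-1 * \sum_j p 0 j * p 0 j + e * V z.1)
      (2^-1 * (\sum_j (2 * z.2 0 j * (delta_mx 0 i : 'rV[R]_n) 0 j)) + 0).
    have d3 := is_deriveZ 2^-1 d1.
    have := is_deriveD d3 (is_derive_cst (e * V z.1) z.2 (delta_mx 0 i)).
    by congr is_derive; apply/funext => p; rewrite /= !fctE fct_sumE.
  rewrite (@derive_val _ _ _ _ _ _ _ d2) addr0 (bigD1 i)//= big1 => [|j ji].
    by rewrite mxE !eqxx mulr1 addr0 mulrA mulVf// mul1r.
  by rewrite mxE/= (negbTE ji) mulr0.
congr (- _); apply/rowP => i; rewrite !mxE.
have dV : is_derive z.1 (delta_mx 0 i) V ('d_i V z.1).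
  by apply/derivableP/diff_derivable; exact: smooth_diff.
have d3 := is_deriveZ e dV.
have d2 := is_deriveD (is_derive_cst (2^-1 * enorm z.2 ^+ 2) z.1 (delta_mx 0 i)) d3.
by rewrite (@derive_val _ _ _ _ _ _ _ d2) add0r.
Qed.

Lemma flow_graph_coord T z0 z1 :
  flow_graph (hamiltonian_field (hamiltonian V e)) T z0 z1 ->
  exists (a b : R) (z : R -> 'rV[R]_n * 'rV[R]_n),
   [/\ a < 0 < b, a < T < b, z 0 = z0, z T = z1 &
     forall r, a < r < b -> forall i,
       is_derive r 1 (fun r => (z r).1 0 i) ((z r).2 0 i) /\
       is_derive r 1 (fun r => (z r).2 0 i) (- e * grad V (z r).1 0 i)].
Proof.
move=> [a [b [z [ab aTb z00 zT dz]]]]; exists a, b, z; split=> // r rab i.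
have := dz r rab; rewrite hamiltonian_fieldE => d.
have lc1 : continuous (fun w : 'rV[R]_n * 'rV[R]_n => w.1 0 i).
  move=> w; apply: (@continuous_comp _ _ _ fst (fun v : 'rV[R]_n => v 0 i)); first exact: cvg_fst.
  exact: coord_continuous.
have lc2 : continuous (fun w : 'rV[R]_n * 'rV[R]_n => w.2 0 i).
  move=> w; apply: (@continuous_comp _ _ _ snd (fun v : 'rV[R]_n => v 0 i)); first exact: cvg_snd.
  exact: coord_continuous.
split.
- apply: (@is_derive_linear _ _ _ (fun w : 'rV[R]_n * 'rV[R]_n => w.1 0 i) z r _ _ _ lc1 d).
    by move=> u v; rewrite /= !mxE.
  by move=> c u; rewrite /= !mxE.
- have := @is_derive_linear _ _ _ (fun w : 'rV[R]_n * 'rV[R]_n => w.2 0 i) z r _ _ _ lc2 d.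
  rewrite /= !mxE mulNr; apply.
    by move=> u v; rewrite /= !mxE.
  by move=> c u; rewrite /= !mxE.
Qed.

(* The path [z] is only known on [0, T]; [stop T] extends it continuously. *)
Definition stop (T r : R) : R := Num.min (Num.max r 0) T.

Lemma stop_itv T r : 0 <= T -> 0 <= stop T r <= T.
Proof. by move=> T0; rewrite /stop le_min le_max lexx orbT T0/= ge_min lexx orbT. Qed.

Lemma stop_id T r : 0 <= r <= T -> stop T r = r.
Proof. by move=> /andP[r0 rT]; rewrite /stop max_l// min_l. Qed.

Lemma cont01_stop (T : R) (c : R -> R) : 0 <= T ->
  (forall r, 0 <= r <= T -> {for r, continuous c}) -> cont01 (fun r => c (stop T r)).
Proof.
move=> T0 cc; apply: continuous_subspaceT => x; apply: continuous_comp; last first.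
  by apply: cc; exact: stop_itv.
rewrite /stop; apply: (@continuous_min _ _ (fun r => Num.max r 0) (fun=> T)); last exact: cvg_cst.
by apply: (@continuous_max _ _ id (fun=> 0)); [exact: cvg_id|exact: cvg_cst].
Qed.

(** Unlike the bound in [green], this one looks at [f] up to time [t] only. That causality is what
    allows arguments on a part [[0, T]] of the time interval, or up to an exit time. *)
Lemma vop_prim2_bound (f : R -> 'rV[R]_n) (B t : R) : 0 <= B -> cont01 f -> 0 <= t <= 1 ->
  (forall r, 0 <= r <= t -> `|f r| <= B) -> `|vop prim2 f t| <= B / 2.
Proof.
move=> B0 /cont01_rVP Wf t01 fB; apply/rV_normP => [|i]; first lra.
rewrite mxE; apply: prim2_bound => // r r01.
exact: le_trans (coord_le _ _) (fB _ r01).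
Qed.

(** * Integral curves stay in the ball and agree with the fixed point *)

Section Trajectory.
Variables (M K : R) (VT : Vtame V M K) (e0 : 0 <= e) (eK : e * K <= 2^-1).
Variables (x al : 'rV[R]_n) (xM : `|x| + `|al| <= M - 2).
Variables (T : R) (T01 : 0 <= T <= 1).
Variables (z : R -> 'rV[R]_n * 'rV[R]_n) (z0 : z 0 = (x, al)).
Hypothesis dz : forall r, 0 <= r <= T -> forall i,
       is_derive r 1 (fun r => (z r).1 0 i) ((z r).2 0 i) /\
       is_derive r 1 (fun r => (z r).2 0 i) (- e * grad V (z r).1 0 i).

Let T0 : 0 <= T. Proof. by case/andP: T01. Qed.

Let cont1 i r : 0 <= r <= T -> {for r, continuous (fun r => (z r).1 0 i)}.
Proof.
move=> /dz/(_ i)[d _]; apply: differentiable_continuous; apply/derivable1_diffP.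
exact: ex_derive.
Qed.

Let cont2 i r : 0 <= r <= T -> {for r, continuous (fun r => (z r).2 0 i)}.
Proof.
move=> /dz/(_ i)[_ d]; apply: differentiable_continuous; apply/derivable1_diffP.
exact: ex_derive.
Qed.

Lemma cont01_traj1 : cont01 (fun r => (z (stop T r)).1).
Proof. by apply/cont01_rVP => i; apply: (cont01_stop (c := fun r => (z r).1 0 i)) => // r; exact: cont1. Qed.

Lemma cont01_traj2 : cont01 (fun r => (z (stop T r)).2).
Proof. by apply/cont01_rVP => i; apply: (cont01_stop (c := fun r => (z r).2 0 i)) => // r; exact: cont2. Qed.

Let WG := cont01_grad V_smooth cont01_traj1.

Lemma traj_momentum t : 0 <= t <= T ->
  (z t).2 = al + (- e) *: vop prim (fun r => grad V (z (stop T r)).1) t.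
Proof.
move=> /andP[t0 tT]; have t01 : 0 <= t <= 1 by rewrite t0 (le_trans tT); case/andP: T01.
apply/rowP => i; rewrite !mxE.
have WGi : cont01 (fun r => grad V (z (stop T r)).1 0 i) by move: WG => /cont01_rVP; exact.
have drv r : 0 <= r <= t -> is_derive r 1 (fun r => (z r).2 0 i) (- e * grad V (z (stop T r)).1 0 i).
  move=> /andP[r0 rt]; have rT : 0 <= r <= T by rewrite r0 (le_trans rt).
  by rewrite stop_id//; have [] := dz rT i.
have WF : cont01 (fun r => - e * grad V (z (stop T r)).1 0 i) by exact: cont01_Z.
have := prim_FTC t01 WF drv.
by rewrite primZ//; [rewrite z0/= => ->; rewrite addrC subrK|case/andP: t01].
Qed.

Lemma traj_position t : 0 <= t <= T ->
  (z t).1 = (x + t *: al) + (- e) *: vop prim2 (fun r => grad V (z (stop T r)).1) t.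
Proof.
move=> /andP[t0 tT]; have t01 : 0 <= t <= 1 by rewrite t0 (le_trans tT); case/andP: T01.
apply/rowP => i; rewrite !mxE.
have WGi : cont01 (fun r => grad V (z (stop T r)).1 0 i) by move: WG => /cont01_rVP; exact.
have W2i : cont01 (fun r => (z (stop T r)).2 0 i) by move: cont01_traj2 => /cont01_rVP; exact.
have drv r : 0 <= r <= t -> is_derive r 1 (fun r => (z r).1 0 i) ((z (stop T r)).2 0 i).
  move=> /andP[r0 rt]; have rT : 0 <= r <= T by rewrite r0 (le_trans rt).
  by rewrite stop_id//; have [] := dz rT i.
have := prim_FTC t01 W2i drv.
rewrite z0/= => H; apply/eqP; rewrite -addrA addrC -subr_eq -H.
have t1 : t <= 1 by case/andP: t01.
rewrite [t * _]mulrC -(prim_cst (al 0 i) t0) prim2_prim -primZ//; last exact: cont01_prim.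
rewrite -primD//; [|exact: cont01_cst|by apply: cont01_Z; exact: cont01_prim].
apply/eqP; apply: prim_ext => r /andP[r0 rt]; have rT : 0 <= r <= T by rewrite r0 (le_trans rt).
by rewrite stop_id// traj_momentum// !mxE.
Qed.

Let K0 : 0 <= K. Proof. by have := Vtame_K VT; lra. Qed.

Lemma traj_bound t : 0 <= t <= T -> `|(z t).1| <= M - 3 / 2.
Proof.
(* At the first exit time from the ball of radius [M] the estimate [est] is violated. *)
pose S := [set t | 0 <= t <= T /\ M < `|(z t).1|].
have est t1 : 0 <= t1 <= T -> (forall r, 0 <= r <= t1 -> `|(z r).1| <= M) -> `|(z t1).1| <= M - 3 / 2.
  move=> t1T H; have t101 : 0 <= t1 <= 1.
    by case/andP: t1T => -> /= /le_trans; apply; case/andP: T01.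
  have h : `|vop prim2 (fun r => grad V (z (stop T r)).1) t1| <= K / 2.
    apply: vop_prim2_bound => // r /andP[r0 rt]; apply: (grad_bound VT).
    have rT : 0 <= r <= T by rewrite r0 (le_trans rt); case/andP: t1T.
    by rewrite stop_id//; apply: H; rewrite r0.
  rewrite traj_position//; apply: le_trans (ler_normD _ _) _; rewrite normrZ normrN (ger0_norm e0).
  have h2 : `|x + t1 *: al| <= M - 2.
    apply: le_trans xM; apply: le_trans (ler_normD _ _) _; rewrite lerD2l normrZ.
    by case/andP: t101 => t10 t11; rewrite ger0_norm// ler_piMl.
  have h3 : e * (K / 2) <= 1 / 2 by rewrite mulrA; move: eK; lra.
  have -> : M - 3 / 2 = (M - 2) + 1 / 2 by lra.
  exact: lerD h2 (le_trans (ler_wpM2l e0 h) h3).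
have S0 : S = set0.
  apply/seteqP; split=> // t1 St1; have Sne : S !=set0 by exists t1.
  have hS : has_inf S by split=> //; exists 0 => t2 [/andP[]].
  set ti := inf S.
  have ti0 : 0 <= ti by apply: lb_le_inf => // t2 [/andP[]].
  have tiT : ti <= T by apply: le_trans (ge_inf hS.2 St1) _; case: St1 => /andP[].
  have below r : 0 <= r < ti -> `|(z r).1| <= M - 3 / 2.
    move=> /andP[r0 rti]; apply: est => [|r' /andP[r'0 r'r]].
      by rewrite r0 (le_trans (ltW rti)).
    rewrite leNgt; apply/negP => h; have : S r'.
      by split=> //; rewrite r'0 (le_trans r'r)// (le_trans (ltW rti)).
    by move/(ge_inf hS.2); rewrite leNgt (le_lt_trans r'r).
  have tiTT : 0 <= ti <= T by rewrite ti0.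
  (* The tolerance [1/2] is spent twice: from [M - 3/2] just before [ti] to [M - 1] at [ti], then to
     [M - 1/2] at a nearby point of [S], where the norm should exceed [M]. *)
  have near_ti : \forall r \near ti, forall i, `|(z ti).1 0 i - (z r).1 0 i| <= 1 / 2.
    have H i : \forall r \near ti, `|(z ti).1 0 i - (z r).1 0 i| <= 1 / 2.
      have /cvgrPdist_le/(_ (1 / 2)) := @cont1 i ti tiTT; apply; lra.
    exact: (@filter_forall _ _ _ (nbhs ti) _ H).
  have /nbhs_ballP[d /= d0 dH] := near_ti.
  have nr r : `|ti - r| < d -> `|(z ti).1 - (z r).1| <= 1 / 2.
    move=> rd; apply/rV_normP => [|i]; first lra.
    by rewrite !mxE; apply: (dH r); rewrite -ball_normE.
  have zti : `|(z ti).1| <= M - 1.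
    have [ti0'|ti_pos] := leP ti 0.
      have -> : ti = 0 by lra.
      rewrite z0/=; apply: (@le_trans _ _ (`|x| + `|al|)); first by rewrite lerDl.
      by apply: le_trans xM _; lra.
    pose r := Num.max 0 (ti - d / 2).
    have r0 : 0 <= r by rewrite le_max lexx.
    have rti : r < ti by rewrite gt_max ti_pos/=; lra.
    have rd : `|ti - r| < d.
      rewrite ger0_norm; last lra.
      have : ti - d / 2 <= r by rewrite le_max lexx orbT.
      by lra.
    rewrite -(subrK (z r).1 (z ti).1); apply: le_trans (ler_normD _ _) _.
    have := nr _ rd; have := below r; rewrite r0 rti => /(_ isT); lra.
  have [t2 St2 t2d] := inf_adherent d0 hS.
  have tit2 : ti <= t2 by exact: (ge_inf hS.2 St2).
  have : `|(z t2).1| <= M - 1 / 2.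
    have t2n : `|ti - t2| < d by rewrite ler0_norm; move: t2d; rewrite -/ti; lra.
    rewrite -[(z t2).1](subKr (z ti).1); apply: le_trans (ler_normB _ _) _.
    by have := nr _ t2n; lra.
  by case: St2 => _; lra.
move=> tT; apply: est => // r /andP[r0 rt]; rewrite leNgt; apply/negP => h.
suff : S r by rewrite S0.
by split=> //; rewrite r0 (le_trans rt)//; case/andP: tT.
Qed.

(** Both paths stay in the ball, so [grad V] is [K]-Lipschitz along them and [2 * M] is an a priori
    bound for their distance. The causal bound on [prim2] closes the contraction on [[0, T]], where
    [z] is known. *)
Lemma traj_unique (Q : R -> 'rV[R]_n) : cont01 Q -> (forall t, 0 <= t <= 1 -> `|Q t| <= M) ->
  (forall t, 0 <= t <= 1 -> Q t = (x + t *: al) + (- e) *: vop prim2 (fun r => grad V (Q r)) t) ->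
  forall t, 0 <= t <= T -> (z t).1 = Q t.
Proof.
move=> WQ QM QE t tT; apply/eqP; rewrite -subr_eq0 -normr_le0 -[leRHS](mulr0 2).
have lt1 r : 0 <= r <= T -> 0 <= r <= 1.
  by move=> /andP[-> /= /le_trans]; apply; case/andP: T01.
apply: (@contraction_bound _ _ [set t | 0 <= t <= T] (fun t => `|(z t).1 - Q t|) 0 (2 * M)) tT.
  move=> r rT; apply: le_trans (ler_normB _ _) _.
  by have := traj_bound rT; have := QM _ (lt1 _ rT); lra.
move=> B HB r rT; have r01 := lt1 _ rT.
have B0 : 0 <= B by apply: le_trans (HB _ rT).
have WGQ := cont01_grad V_smooth WQ.
rewrite (traj_position rT) (QE _ r01) opprD addrACA subrr add0r -scalerBr -(vopB green_prim2 WG WGQ r01).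
rewrite normrZ normrN (ger0_norm e0) add0r.
have h : `|vop prim2 (fun r => grad V (z (stop T r)).1 - grad V (Q r)) r| <= (K * B) / 2.
  apply: (vop_prim2_bound (mulr_ge0 K0 B0) (cont01_vD WG (cont01_vN WGQ)) r01).
  move=> r' /andP[r'0 r'r]; have r'T : 0 <= r' <= T by rewrite r'0 (le_trans r'r); case/andP: rT.
  rewrite stop_id//; apply: le_trans (grad_lip VT _ _) _.
  - exact: (QM _ (lt1 _ r'T)).
  - by apply: le_trans (traj_bound r'T) _; lra.
  - by rewrite ler_wpM2l//; exact: HB.
apply: le_trans (ler_wpM2l e0 h) _.
have := ler_wpM2r B0 eK; lra.
Qed.

End Trajectory.

End Hamiltonian.

(** * Initial and boundary value problems and the flow *)

Section Orbits.
Context {R : realType} {n : nat}.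
Implicit Types (p q v x y al be : 'rV[R]_n) (t r : R) (Q : R -> 'rV[R]_n).
Variables (V : 'rV[R]_n -> R) (V_smooth : smooth V) (M K : R) (VT : Vtame V M K).
Variables (e : R) (e0 : 0 <= e) (eK : e * K <= 2^-1).
Local Notation Hf := (hamiltonian_field (hamiltonian V e)).

Definition ivp x al Q := [/\ cont01 Q, forall t, 0 <= t <= 1 -> `|Q t| <= M &
  forall t, 0 <= t <= 1 -> Q t = (x + t *: al) + (- e) *: vop prim2 (fun r => grad V (Q r)) t].

Definition bv x y Q := [/\ cont01 Q, forall t, 0 <= t <= 1 -> `|Q t| <= M &
  forall t, 0 <= t <= 1 -> Q t = ((1 - t) *: x + t *: y) + e *: vop bvp (fun r => grad V (Q r)) t].

(** The derivative at [0] of a solution [Q] of the boundary value problem: with this initial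
    velocity the two integral equations become algebraically equivalent, because [bvp f t] is
    [t * prim2 f 1 - prim2 f t]. *)
Definition velocity x y Q := y - x + e *: vop prim2 (fun r => grad V (Q r)) 1.

Let K0 : 0 <= K. Proof. by have := Vtame_K VT; lra. Qed.
Let eKN : `|- e| * K <= 2^-1. Proof. by rewrite normrN ger0_norm. Qed.
Let eKe : `|e| * K <= 2^-1. Proof. by rewrite ger0_norm. Qed.

Lemma vop_bvp (f : R -> 'rV[R]_n) t : vop bvp f t = t *: vop prim2 f 1 - vop prim2 f t.
Proof. by apply/rowP => i; rewrite !mxE. Qed.

Lemma cont01_line x y : cont01 (fun t : R => (1 - t) *: x + t *: y).
Proof.
apply: cont01_vD; apply: cont01_vZ; [|exact: cont01_vcst|exact: cont01_id|exact: cont01_vcst].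
by apply: cont01_D; [exact: cont01_cst|apply: cont01_N; exact: cont01_id].
Qed.

Lemma ivp_bv x al Q : ivp x al Q -> bv x (Q 1) Q.
Proof.
move=> [WQ QM QE]; split=> // t t01; rewrite vop_bvp {1}(QE t t01) (QE 1 (@le01 R)).
by move: (vop _ _ 1) (vop _ _ t) => a b; apply/rowP => i; rewrite !mxE; ring.
Qed.

Lemma ivp_velocity x al Q : ivp x al Q -> velocity x (Q 1) Q = al.
Proof.
move=> [WQ QM QE]; rewrite /velocity {1}(QE 1 (@le01 R)).
by move: (vop _ _ 1) => a; apply/rowP => i; rewrite !mxE; ring.
Qed.

Lemma bv_ivp x y Q : bv x y Q -> ivp x (velocity x y Q) Q.
Proof.
move=> [WQ QM QE]; split=> // t t01; rewrite {1}(QE t t01) vop_bvp /velocity.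
by move: (vop _ _ 1) (vop _ _ t) => a b; apply/rowP => i; rewrite !mxE; ring.
Qed.

Lemma bv_end x y Q : bv x y Q -> Q 1 = y.
Proof.
move=> [WQ QM QE]; rewrite (QE 1 (@le01 R)) vop_bvp.
by move: (vop _ _ 1) => a; apply/rowP => i; rewrite !mxE; ring.
Qed.

Lemma bv_exists x y : `|x| + `|y| <= M - 1 -> exists Q, bv x y Q.
Proof.
move=> xyM; have M1 : 1 <= M.
  by have : 0 <= `|x| + `|y| by [rewrite addr_ge0|]; lra.
have [t /andP[t0 t1]|Q HQ] := nl_exists V_smooth VT green_bvp eKe M1 (@cont01_line x y); last by exists Q.
apply: le_trans xyM; apply: le_trans (ler_normD _ _) _; rewrite !normrZ !ger0_norm ?subr_ge0//.
by apply: lerD; rewrite ler_piMl//; lra.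
Qed.

Lemma ivp_exists x al : `|x| + `|al| <= M - 1 -> exists Q, ivp x al Q.
Proof.
move=> xyM; have M1 : 1 <= M.
  by have : 0 <= `|x| + `|al| by [rewrite addr_ge0|]; lra.
have [t /andP[t0 t1]|Q HQ] := nl_exists V_smooth VT green_prim2 eKN M1 (@cont01_affine _ _ x al); last by exists Q.
apply: le_trans xyM; apply: le_trans (ler_normD _ _) _; rewrite !normrZ !ger0_norm//.
by rewrite lerD2l ler_piMl.
Qed.

Lemma bv_lip x y Q x' Q' : bv x y Q -> bv x' y Q' ->
  forall t, 0 <= t <= 1 -> `|Q' t - Q t| <= 2 * `|x' - x|.
Proof.
move=> [WQ QM QE] [WQ' QM' QE'].
apply: (nl_lip V_smooth VT green_bvp eKe WQ WQ' QM QM' QE QE') => t /andP[t0 t1].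
rewrite opprD addrACA subrr addr0 -scalerBr normrZ ger0_norm ?subr_ge0//.
by rewrite ler_piMl//; lra.
Qed.

Lemma ivp_unique x al Q Q' : ivp x al Q -> ivp x al Q' ->
  forall t, 0 <= t <= 1 -> Q' t = Q t.
Proof.
move=> [WQ QM QE] [WQ' QM' QE'] t t01; apply/eqP; rewrite -subr_eq0 -normr_le0.
rewrite -[leRHS](mulr0 2); apply: (nl_lip V_smooth VT green_prim2 eKN WQ WQ' QM QM' QE QE') => // r r01.
by rewrite subrr normr0.
Qed.

(** One unit of the factor [2] comes from [- (x' - x)], the other from [e K] times the factor [2] in
    [bv_lip]. *)
Lemma velocity_lip x y Q x' Q' : bv x y Q -> bv x' y Q' ->
  `|velocity x' y Q' - velocity x y Q| <= 2 * `|x' - x|.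
Proof.
move=> H H'; have lip := bv_lip H H'; case: H => WQ QM _; case: H' => WQ' QM' _.
have WG := cont01_grad V_smooth WQ; have WG' := cont01_grad V_smooth WQ'.
have -> : velocity x' y Q' - velocity x y Q =
   - (x' - x) + e *: vop prim2 (fun r => grad V (Q' r) - grad V (Q r)) 1.
  rewrite (vopB green_prim2 WG' WG (@le01 R)) /velocity.
  by move: (vop _ _ _) (vop _ _ _) => a b; apply/rowP => i; rewrite !mxE; ring.
apply: le_trans (ler_normD _ _) _; rewrite normrN normrZ (ger0_norm e0).
have d0 : 0 <= 2 * `|x' - x| by rewrite mulr_ge0.
have h : `|vop prim2 (fun r => grad V (Q' r) - grad V (Q r)) 1| <= K * (2 * `|x' - x|).
  apply: (vop_bound green_prim2 (mulr_ge0 K0 d0) (cont01_vD WG' (cont01_vN WG)) (@le01 R)) => r r01.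
  apply: le_trans (grad_lip VT (QM r r01) (QM' r r01)) _.
  by rewrite ler_wpM2l// lip.
have h2 := ler_wpM2l e0 h; have h3 := ler_wpM2r d0 eK.
move: (`|x' - x| : R) (e * `|vop _ _ _|) h2 h3 => d c h2 h3.
by rewrite mulrA in h2; lra.
Qed.

(** [flow] chooses an integral curve separately for each time. A curve reaching time [1] shows that
    none of these values is a default, and uniqueness, through the fixed point [Q], places all of
    them on a single curve [z]. *)
Lemma flow_orbit x al : `|x| + `|al| <= M - 2 -> flow_defined Hf 1 (x, al) ->
  exists z : R -> 'rV[R]_n * 'rV[R]_n, [/\ z 0 = (x, al),
    forall r, 0 <= r <= 1 -> forall i,
      is_derive r 1 (fun r => (z r).1 0 i) ((z r).2 0 i) /\
      is_derive r 1 (fun r => (z r).2 0 i) (- e * grad V (z r).1 0 i) &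
    forall t, 0 <= t <= 1 -> Phi V e t x al = (z t).1].
Proof.
move=> xM [z1 fg].
have [a [b [z [/andP[a0 b0] /andP[a1 b1] z0 zT dz]]]] := flow_graph_coord V_smooth fg.
have [Q [WQ QM QE]] : exists Q, ivp x al Q by apply: ivp_exists; lra.
have dz01 r : 0 <= r <= 1 -> forall i,
      is_derive r 1 (fun r => (z r).1 0 i) ((z r).2 0 i) /\
      is_derive r 1 (fun r => (z r).2 0 i) (- e * grad V (z r).1 0 i).
  by move=> /andP[r0 r1]; apply: dz; apply/andP; split; lra.
exists z; split=> // t t01; have [t0 t1] := andP t01.
rewrite (traj_unique V_smooth VT e0 eK xM (@le01 R) z0 dz01 WQ QM QE t01).
have : flow_graph Hf t (x, al) (flow Hf t (x, al)).
  apply: (@xgetPex _ (x, al) (flow_graph Hf t (x, al))).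
  have [a' [b' [z' [/andP[a0' b0'] /andP[a1' b1'] z0' _ dz']]]] := fg.
  exists (z' t), a', b', z'; split=> //; first by rewrite a0'.
  by apply/andP; split; lra.
move=> /(flow_graph_coord V_smooth)[a' [b' [z' [/andP[a0' b0'] /andP[a1' b1'] z0' zT' dz']]]].
rewrite /Phi -zT'; apply: (traj_unique V_smooth VT e0 eK xM t01 z0' _ WQ QM QE) => //.
  by move=> r /andP[r0 rt]; apply: dz'; apply/andP; split; lra.
by rewrite t0 lexx.
Qed.

Lemma Phi_ivp x al Q : `|x| + `|al| <= M - 2 -> flow_defined Hf 1 (x, al) -> ivp x al Q ->
  forall t, 0 <= t <= 1 -> Phi V e t x al = Q t.
Proof.
move=> xM fd [WQ QM QE] t t01; have [z [z0 dz ->]] := flow_orbit xM fd; last by [].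
exact: (traj_unique V_smooth VT e0 eK xM (@le01 R) z0 dz WQ QM QE t01).
Qed.

End Orbits.

(** * First variation of the cost *)

Section SmoothPaths.
Context {R : realType}.

Lemma smooth_add (E F : normedModType R) (f g : E -> F) : smooth f -> smooth g -> smooth (f + g).
Proof.
move=> sf sg k; elim: k f g sf sg => [|k IH] f g sf sg.
  by move=> x; apply: continuousD; [exact: (smooth_cont sf)|exact: (smooth_cont sg)].
split=> [x|v]; first by apply: differentiableD; exact: smooth_diff.
have -> : 'D_v (f + g) = 'D_v f + 'D_v g.
  by apply/funext => x; rewrite deriveD//; apply: diff_derivable; exact: smooth_diff.
by apply: IH; exact: smooth_D.
Qed.

Lemma smooth_cst (E F : normedModType R) (c : F) : smooth (fun _ : E => c).
Proof.
move=> k; elim: k c => [|k IH] c; first by move=> x; exact: cvg_cst.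
split=> [x|v]; first exact: differentiable_cst.
have -> : 'D_v (fun _ : E => c) = fun=> 0 by apply/funext => x; rewrite derive_cst.
exact: IH.
Qed.

Lemma smooth_line (E : normedModType R) (w : E) : smooth (fun t : R => (1 - t) *: w).
Proof.
have dk (x : R) : is_diff x (fun t : R => 1 - t) (fun t => - t).
  by apply: is_diff_eq; apply/funext => t /=; rewrite add0r.
have d (x : R) : differentiable (fun t : R => (1 - t) *: w) x.
  by apply: differentiableZl; exact: ex_diff.
case=> [|k]; first by move=> x; exact: differentiable_continuous.
split=> [//|v].
have -> : 'D_v (fun t : R => (1 - t) *: w) = fun=> - v *: w.
  apply/funext => x; rewrite deriveE//= diffZl; last exact: ex_diff.
  by rewrite /= diff_val.
exact: smooth_cst.
Qed.

End SmoothPaths.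

Section Action.
Context {R : realType} {n : nat}.
Implicit Types (p q v x y al be w : 'rV[R]_n) (t r : R) (Q : R -> 'rV[R]_n).
Variables (V : 'rV[R]_n -> R) (V_smooth : smooth V) (e : R).

Lemma action_prim (g : R -> 'rV[R]_n) (L : R -> R) : cont01 L ->
  (forall t, 0 < t < 1 -> lagrangian V e (g t, derive1 g t) = L t) -> action V e g = prim L 1.
Proof.
by move=> WL gL; apply: prim_interior.
Qed.

Lemma cont01_lagrangian (q p : R -> 'rV[R]_n) : cont01 q -> cont01 p -> cont01 (fun r => lagrangian V e (q r, p r)).
Proof.
move=> Wq /cont01_rVP Wp; apply: cont01_D.
  under eq_fun do rewrite enorm_sqr.
  by apply: cont01_Z; apply: cont01_sum => i; apply: cont01_M.
by apply: cont01_N; apply: cont01_Z; apply: (cont01_comp (h := V)) => //; exact: smooth_cont.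
Qed.

(** The upper bound on [V] enters here. It keeps the set of actions bounded below, without which
    [inf] in [cost] would be a default value. *)
Lemma action_lbound (C : R) (g : R -> 'rV[R]_n) : 0 <= e -> (forall x, V x <= C) ->
  smooth_path g -> - (e * C) <= action V e g.
Proof.
move=> e0 VC [g0 sg gg0].
have Wg : cont01 g0 by apply: continuous_subspaceT; exact: smooth_cont.
have Wg' : cont01 (derive1 g0).
  have -> : derive1 g0 = 'D_1 g0 by apply/funext => t; rewrite derive1E.
  by apply: continuous_subspaceT; apply: smooth_cont; exact: smooth_D.
rewrite (action_prim (cont01_lagrangian Wg Wg')); last first.
  move=> t /andP[t0 t1]; rewrite gg0; last by rewrite !ltW.
  congr (lagrangian V e (_, _)); rewrite !derive1E; apply: near_eq_derive.
  have : t \in `]0, 1[%R by rewrite in_itv/= t0.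
  move=> /near_in_itvoo; apply: filterS => u; rewrite in_itv/= => /andP[u0 u1].
  by apply: gg0; rewrite !ltW.
rewrite -[leLHS]mulr1 -(prim_cst (- (e * C)) (@ler01 R)); apply: prim_le => //.
- exact: cont01_cst.
- exact: cont01_lagrangian.
move=> r _; rewrite /lagrangian/= enorm_sqr.
have := ler_wpM2l e0 (VC (g0 r)); have := dotv_ge0 (derive1 g0 r).
by move: (dotv _ _) => d; lra.
Qed.

Lemma cost_le (C : R) x y (g : R -> 'rV[R]_n) : 0 <= e -> (forall x, V x <= C) ->
  admissible x y g -> cost V e x y <= action V e g.
Proof.
move=> e0 VC gxy; apply: ge_inf; last by exists g.
by exists (- (e * C)) => _ [g' [sg' _ _] <-]; exact: action_lbound.
Qed.

Lemma dotv_bound u v : `|dotv u v| <= n%:R * (`|u| * `|v|).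
Proof. by apply: sum_le_n => i; rewrite normrM ler_pM//; exact: coord_le. Qed.

End Action.

Section Cost.
Context {R : realType} {n : nat}.
Implicit Types (p q v x y al be w : 'rV[R]_n) (t r : R) (Q : R -> 'rV[R]_n).
Variables (V : 'rV[R]_n -> R) (V_smooth : smooth V) (M K : R) (VT : Vtame V M K).
Variables (e : R) (e0 : 0 <= e) (eK : e * K <= 2^-1).
Variables (C : R) (VC : forall x, V x <= C).
Let K0 : 0 <= K. Proof. by have := Vtame_K VT; lra. Qed.

(* Comparing with the path [Phi t x al + (1 - t) w]: the first variation of the action is a
   boundary term, [- dotv al w]. *)
Lemma cost_semiconcave x al w : `|x| + `|al| <= M - 2 -> regular V e x al -> `|w| <= 1 ->
  cost V e (x + w) (Phi V e 1 x al) <=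
    cost V e x (Phi V e 1 x al) - dotv al w + (n%:R + 1) * `|w| ^+ 2.
Proof.
move=> xM [fd [[[g0 sg0 gg0] Phi0 _] Phimin] _] w1.
have [z [z0 dz Phiz]] := flow_orbit V_smooth VT e0 eK xM fd.
have z1M := traj_bound V_smooth VT e0 eK xM (@le01 R) z0 dz.
have WZ1 := cont01_traj1 (@le01 R) dz; have WZ2 := cont01_traj2 (@le01 R) dz.
set Z1 := fun r => (z (stop 1 r)).1 in WZ1; set Z2 := fun r => (z (stop 1 r)).2 in WZ2.
pose g v t := Phi V e t x al + (1 - t) *: v.
pose L v t := lagrangian V e (Z1 t + (1 - t) *: v, Z2 t - v).
have Wv v : cont01 (fun t : R => (1 - t) *: v).
  by apply: cont01_vZ; [apply: cont01_D; [exact: cont01_cst|apply: cont01_N; exact: cont01_id]|exact: cont01_vcst].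
have WL v : cont01 (L v).
  apply: (@cont01_lagrangian _ _ V V_smooth e (fun t => Z1 t + (1 - t) *: v) (fun t => Z2 t - v)).
    by apply: cont01_vD.
  by apply: cont01_vD => //; apply: cont01_vN; exact: cont01_vcst.
(* [Phi] is known to agree with the smooth curve [z] only on [[0, 1]], so velocities are compared in
   the open interval. *)
have gaction v : action V e (g v) = prim (L v) 1.
  apply: action_prim => // t /andP[t0 t1].
  have t01 : 0 <= t <= 1 by rewrite !ltW.
  rewrite /L /Z1 /Z2 stop_id// /g Phiz//; congr (lagrangian V e (_, _)).
  apply: derive1_matrix => i j; rewrite ord1 !mxE.
  have d1 : is_derive t 1 (fun t : R => (z t).1 0 j + (1 - t) * v 0 j) ((z t).2 0 j - v 0 j).
    have [dzj _] := dz t t01 j.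
    have dl : is_derive t 1 (fun t : R => (1 - t) * v 0 j) (- v 0 j).
      by apply: is_derive_eq; rewrite /GRing.scale/=; ring.
    exact: is_deriveD.
  apply: near_eq_is_derive d1.
  have : t \in `]0, 1[%R by rewrite in_itv/= t0.
  move=> /near_in_itvoo; apply: filterS => u; rewrite in_itv/= => /andP[u0 u1].
  by rewrite !mxE Phiz// !ltW.
have g0E : g 0 = fun t => Phi V e t x al.
  by apply/funext => t; rewrite /g scaler0 addr0.
have cost0 : cost V e x (Phi V e 1 x al) = prim (L 0) 1 by rewrite -gaction g0E Phimin.
have adm : admissible (x + w) (Phi V e 1 x al) (g w).
  split.
  - exists (g0 + (fun t : R => (1 - t) *: w)); first by apply: smooth_add => //; exact: smooth_line.
    by move=> t t01; rewrite /g gg0.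
  - by rewrite /g Phi0 subr0 scale1r.
  - by rewrite /g subrr scale0r addr0.
apply: le_trans (cost_le V_smooth e0 VC adm) _; rewrite gaction cost0.
(* By the equation of motion, the part of [L w - L 0] that is linear in [w] is the total derivative
   of [psi], and [psi 1 = 0]. *)
pose psi t := (1 - t) * dotv (z t).2 w.
pose psi' t := - dotv (Z2 t) w - (1 - t) * (e * dotv (grad V (Z1 t)) w).
have Wdot (f : R -> 'rV[R]_n) : cont01 f -> cont01 (fun r => dotv (f r) w).
  by move=> /cont01_rVP Wf; apply: cont01_sum => i; apply: cont01_M => //; exact: cont01_cst.
have Wpsi' : cont01 psi'.
  apply: cont01_B; first by apply: cont01_N; exact: Wdot.
  apply: cont01_M; first by apply: cont01_B; [exact: cont01_cst|exact: cont01_id].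
  by apply: cont01_Z; apply: Wdot; exact: cont01_grad.
have intpsi : prim psi' 1 = - dotv al w.
  have -> : - dotv al w = psi 1 - psi 0 by rewrite /psi subrr mul0r sub0r subr0 mul1r z0.
  apply: prim_FTC => //; first exact: le01.
  move=> r r01; rewrite /psi' /Z1 /Z2 stop_id//.
  have dd : is_derive r 1 (fun t => dotv (z t).2 w) (- e * dotv (grad V (z r).1) w).
    have -> : (fun t => dotv (z t).2 w) = \sum_i (fun t => w 0 i * (z t).2 0 i).
      by apply/funext => t; rewrite fct_sumE; apply: eq_bigr => i _; rewrite mulrC.
    have -> : - e * dotv (grad V (z r).1) w = \sum_i w 0 i * (- e * grad V (z r).1 0 i).
      by rewrite /dotv mulr_sumr; apply: eq_bigr => i _; ring.
    by apply: is_derive_sum => i; apply: is_derive_mull; have [] := dz r r01 i.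
  have d1 : is_derive r 1 (fun t : R => 1 - t) (-1).
    have := is_deriveB (is_derive_cst (1 : R) r 1) (is_derive_id r (1 : R)).
    by rewrite sub0r.
  have := is_deriveM d1 dd; rewrite /psi.
  move=> d; apply: (@is_derive_eq _ _ _ _ _ _ _ _ d); rewrite /GRing.scale/=.
  by move: (dotv _ _) (dotv _ _) => a b; ring.
(* The kinetic remainder [dotv w w / 2] is at most [n / 2] times [|w|^2], and the potential one at
   most [e K |w|^2], that is, half of [|w|^2]. The margin [3/2] left by [traj_bound] keeps the
   varied path in the ball for [|w| <= 1]. *)
have LL t : 0 <= t <= 1 -> L w t <= L 0 t + (psi' t + (n%:R + 1) * `|w| ^+ 2).
  move=> t01; have [t0 t1] := andP t01.
  rewrite /L /psi' /Z1 /Z2 stop_id// /lagrangian/= !enorm_sqr subr0 scaler0 addr0.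
  have w2 : dotv (z t).2 w + dotv (z t).2 w + dotv ((z t).2 - w) ((z t).2 - w) =
      dotv (z t).2 (z t).2 + dotv w w.
    by rewrite /dotv -!big_split; apply: eq_bigr => i _; rewrite !mxE/=; ring.
  have zM : `|(z t).1| <= M by apply: le_trans (z1M t t01) _; lra.
  have tw : `|(1 - t) *: w| <= `|w|.
    by rewrite normrZ ger0_norm ?subr_ge0// ler_piMl//; lra.
  have zwM : `|(z t).1 + (1 - t) *: w| <= M.
    apply: le_trans (ler_normD _ _) _.
    have -> : M = (M - 3 / 2) + 3 / 2 by lra.
    apply: lerD (z1M t t01) _; apply: le_trans tw _; lra.
  have [_ _ hV] := Vtame0 VT zM zwM.
  have zw : (z t).1 + (1 - t) *: w - (z t).1 = (1 - t) *: w by rewrite addrC addKr.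
  rewrite {}zw in hV.
  have sumE : \sum_k ((1 - t) *: w) 0 k * 'd_k V (z t).1 = (1 - t) * dotv (grad V (z t).1) w.
    by rewrite /dotv mulr_sumr; apply: eq_bigr => k _; rewrite !mxE; ring.
  rewrite sumE ler_norml in hV; case/andP: hV => hV _.
  have ww : dotv w w <= n%:R * `|w| ^+ 2.
    by apply: le_trans (ler_norm _) _; rewrite expr2; exact: dotv_bound.
  have tw2 : `|(1 - t) *: w| ^+ 2 <= `|w| ^+ 2 by rewrite ler_pXn2r// nnegrE.
  have nn : 0 <= n%:R * `|w| ^+ 2 by rewrite mulr_ge0// exprn_ge0.
  have h1 := ler_wpM2l e0 hV; have h2 := ler_wpM2l K0 tw2; have h3 := ler_wpM2l e0 h2.
  have h4 : e * (K * `|w| ^+ 2) <= 2^-1 * `|w| ^+ 2 by rewrite mulrA ler_wpM2r// exprn_ge0.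
  have ew : 0 <= `|w| ^+ 2 by rewrite exprn_ge0.
  rewrite (addrC (z t).1) in h1 *.
  move: h1 h3 h4 w2 ww nn ew.
  move: (dotv (z t).2 w) (dotv (_ - _) _) (dotv (z t).2 (z t).2) (dotv w w) (dotv (grad V _) w)
    (`|w| ^+ 2) (`|_| ^+ 2) (V (z t).1) (V (_ + _)) => a1 a2 a3 a4 a5 a6 a7 a8 a9.
  move=> h1 h3 h4 w2 ww nn ew.
  have h1' : e * (- (K * a7)) <= e * (a9 - a8 - (1 - t) * a5) by [].
  have -> : (n%:R + 1) * a6 = n%:R * a6 + a6 by ring.
  move: (n%:R * a6) nn ww => N nn ww.
  lra.
have Wc : cont01 (fun _ : R => (n%:R + 1) * `|w| ^+ 2) by exact: cont01_cst.
have Wpc : cont01 (fun t => psi' t + (n%:R + 1) * `|w| ^+ 2) by exact: cont01_D.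
apply: (@le_trans _ _ (prim (fun t => L 0 t + (psi' t + (n%:R + 1) * `|w| ^+ 2)) 1)).
  by apply: prim_le => //; apply: cont01_D.
rewrite (primD (WL 0) Wpc (lexx 1)) (primD Wpsi' Wc (lexx 1)) intpsi.
by rewrite prim_cst ?ler01// mulr1 addrA.
Qed.

End Cost.

Section Expansion.
Context {R : realType} {n : nat}.
Implicit Types (x y al be w : 'rV[R]_n).

Lemma dotv_linear al : linear (dotv al).
Proof.
move=> a u v; rewrite /dotv scaler_sumr -big_split; apply: eq_bigr => i _.
by rewrite !mxE /GRing.scale/=; ring.
Qed.

HB.instance Definition _ al :=
  GRing.isLinear.Build R 'rV[R]_n R _ (dotv al) (dotv_linear al).

Lemma dotv_delta al i : dotv al (delta_mx 0 i) = al 0 i.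
Proof.
rewrite /dotv (bigD1 i)//= big1 ?addr0 => [|j ji]; first by rewrite mxE !eqxx mulr1.
by rewrite mxE (negbTE ji) andbF mulr0.
Qed.

Lemma dotvNl al w : dotv (- al) w = - dotv al w.
Proof. by rewrite /dotv -sumrN; apply: eq_bigr => i _; rewrite mxE mulNr. Qed.

Lemma dotv_continuous al : continuous (dotv al).
Proof.
have c i : continuous (fun w : 'rV[R]_n => al 0 i * w 0 i).
  have ci : continuous (fun w : 'rV[R]_n => w 0 i) by exact: coord_continuous.
  move=> w; apply: (@continuousM _ _ (fun=> al 0 i) (fun w : 'rV[R]_n => w 0 i)).
    exact: cst_continuous.
  exact: ci.
rewrite /dotv; elim: (index_enum 'I_n) => [|i l IH].
  rewrite (_ : (fun _ => _) = fun=> 0); last by apply/funext => w; rewrite big_nil.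
  exact: cst_continuous.
rewrite (_ : (fun _ => _) = fun w => al 0 i * w 0 i + \sum_(j <- l) al 0 j * w 0 j).
  move=> w; apply: (@continuousD _ _ _ (fun w => al 0 i * w 0 i) (fun w => \sum_(j <- l) al 0 j * w 0 j)).
    exact: c.
  exact: IH.
by apply/funext => w; rewrite big_cons.
Qed.

Lemma is_diff_quadratic (f : 'rV[R]_n -> R) x al (A d : R) : 0 <= A -> 0 < d ->
  (forall w, `|w| < d -> `|f (x + w) - f x - dotv al w| <= A * `|w| ^+ 2) ->
  is_diff x f (dotv al).
Proof.
move=> A0 d0 fE.
have o : f \o shift x = cst (f x) + dotv al +o_ (0 : 'rV[R]_n) id.
  apply/eqaddoP => eps eps0.
  have r0 : 0 < Num.min d (eps / (A + 1)).
    by rewrite lt_min d0 divr_gt0//; apply: ltr_wpDl.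
  apply/nbhs_ballP; exists (Num.min d (eps / (A + 1))) => //= w.
  rewrite -ball_normE/= sub0r normrN lt_min => /andP[wd we].
  have := fE w wd; rewrite !fctE/= (addrC w) opprD addrA => /le_trans; apply.
  rewrite expr2 mulrA ler_wpM2r//.
  have A1 : 0 < A + 1 by apply: ltr_wpDl.
  move: we; rewrite ltr_pdivlMr// => we.
  by have w0 := normr_ge0 w; lra.
have dE : 'd f x = dotv al :> (_ -> _) by apply: diff_unique => //; exact: dotv_continuous.
split; last exact: dE.
by apply/diff_locallyP; rewrite dE; split=> //; exact: dotv_continuous.
Qed.

Lemma is_diff_grad (f : 'rV[R]_n -> R) x al : is_diff x f (dotv al) -> grad f x = al.
Proof.
move=> fE; apply/rowP => i; rewrite mxE deriveE; last exact: ex_diff.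
by rewrite diff_val dotv_delta.
Qed.

End Expansion.

(** * Gradient of the cost and the c-exponential *)

Section CostExpansion.
Context {R : realType} {n : nat}.
Implicit Types (x y al be w : 'rV[R]_n) (t r : R) (Q : R -> 'rV[R]_n).
Variables (V : 'rV[R]_n -> R) (V_smooth : smooth V) (B M K : R) (VT : Vtame V M K).
Variables (e : R) (e0 : 0 <= e) (eK : e * K <= 2^-1).
Variables (C : R) (VC : forall x, V x <= C).
Variables (D : set ('rV[R]_n * 'rV[R]_n)) (D_open : open D).
Hypothesis D_regular : forall x al, D (x, al) -> regular V e x al.
Hypothesis D_bound : forall x al, D (x, al) -> `|x| <= B /\ `|al| <= B.
Hypothesis BM : 3 * B + 5 <= M.
Let K0 : 0 <= K. Proof. by have := Vtame_K VT; lra. Qed.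

Lemma D_norm_sum x al : D (x, al) -> `|x| + `|al| <= M - 2.
Proof.
move=> Dx; have [xB aB] := D_bound Dx.
apply: le_trans (lerD xB aB) _; have B0 := le_trans (normr_ge0 x) xB.
by move: BM => BM'; lra.
Qed.

Lemma D_ivp x al : D (x, al) -> exists2 Q, ivp V M e x al Q &
  forall t, 0 <= t <= 1 -> Phi V e t x al = Q t.
Proof.
move=> Dx; have xM := D_norm_sum Dx; have [|Q HQ] := @ivp_exists _ _ _ V_smooth _ _ VT _ e0 eK x al.
  by apply: le_trans xM _; lra.
exists Q => //; apply: (Phi_ivp V_smooth VT e0 eK xM _ HQ).
by case: (D_regular Dx).
Qed.

Lemma D_endpoint x al : D (x, al) -> `|Phi V e 1 x al| <= 2 * B + 1.
Proof.
move=> Dx; have [Q HQ ->] := D_ivp Dx; last exact: le01.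
have [xB aB] := D_bound Dx; have [WQ QM QE] := HQ.
rewrite (QE 1 (@le01 R)) scale1r; apply: le_trans (ler_normD _ _) _.
have h : `|vop prim2 (fun r => grad V (Q r)) 1| <= K.
  apply: (vop_bound green_prim2 K0 (cont01_grad V_smooth WQ) (@le01 R)) => r r01.
  exact: (grad_bound VT (QM r r01)).
have h2 := ler_wpM2l e0 h; rewrite normrZ normrN (ger0_norm e0).
have := ler_normD x al.
move: (`|x + al| : R) (`|x| : R) (`|al| : R) (e * `|_|) xB aB h2 => a b c d *; move: eK => eK'; lra.
Qed.

Lemma nearby x al : D (x, al) -> exists2 d, 0 < d <= 1 & forall x', `|x' - x| < d ->
  (exists Q, bv V M e x' (Phi V e 1 x al) Q) /\
  forall Q, bv V M e x' (Phi V e 1 x al) Q ->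
    [/\ D (x', velocity V e x' (Phi V e 1 x al) Q),
        Phi V e 1 x' (velocity V e x' (Phi V e 1 x al) Q) = Phi V e 1 x al &
        `|velocity V e x' (Phi V e 1 x al) Q - al| <= 2 * `|x' - x|].
Proof.
move=> Dx; have [Q HQ HP] := D_ivp Dx; have [xB aB] := D_bound Dx.
have yB := D_endpoint Dx; have y1 := HP 1 (@le01 R); set y := Phi V e 1 x al in yB y1 *.
have HQb : bv V M e x y Q by rewrite y1; exact: (ivp_bv HQ).
have [d0 /= d00 dD] : nbhs_ball (x, al) D by apply/nbhs_ballP; exact: D_open.
(* By [velocity_lip] the velocity moves at most twice as far as the point, so [d0 / 4] keeps the
   pair in [D]. The bound [1] keeps [bv_exists] applicable. *)
have dmin : 0 < Num.min 1 (d0 / 4) <= 1 by rewrite lt_min ltr01 divr_gt0//= ge_min lexx.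
exists (Num.min 1 (d0 / 4)) => // x'; rewrite lt_min => /andP[x1 xd].
split.
  apply: (bv_exists V_smooth VT e0 eK).
  have : `|x'| <= `|x| + `|x' - x| by rewrite -[in leLHS](subrK x x') addrC ler_normD.
  by move: (`|x'| : R) (`|x| : R) (`|x' - x| : R) (`|y| : R) xB aB yB x1 => *; move: BM => BM'; lra.
move=> Q' HQ'.
have vl : `|velocity V e x' y Q' - al| <= 2 * `|x' - x|.
  have vE : velocity V e x y Q = al by rewrite y1; exact: (ivp_velocity HQ).
  by have := velocity_lip V_smooth VT e0 eK HQb HQ'; rewrite vE.
have Dx' : D (x', velocity V e x' y Q').
  apply: dD; split; rewrite -ball_normE/= distrC; first by have := normr_ge0 (x' - x); lra.
  by apply: le_lt_trans vl _; lra.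
split=> //.
rewrite (Phi_ivp V_smooth VT e0 eK (D_norm_sum Dx') _ (bv_ivp HQ') (@le01 R)); first exact: (bv_end HQ').
by case: (D_regular Dx').
Qed.

(** The lower bound is the upper bound of [cost_semiconcave] at [(x + w, al')], moved back by [- w].
    Replacing [al'] by [al] costs [2 n |w|^2], which added to [(n + 1) |w|^2] gives the constant. *)
Lemma cost_expansion x al : D (x, al) -> exists2 d, 0 < d & forall w, `|w| < d ->
  `|cost V e (x + w) (Phi V e 1 x al) - cost V e x (Phi V e 1 x al) - dotv (- al) w| <=
    (3 * n%:R + 1) * `|w| ^+ 2.
Proof.
move=> Dx; have [d /andP[d0 d1] H] := nearby Dx; exists d => // w wd.
have w1 : `|w| <= 1 by rewrite ltW// (lt_le_trans wd).
have up := cost_semiconcave V_smooth VT e0 eK VC (D_norm_sum Dx) (D_regular Dx) w1.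
have [|[Q HQ] /(_ Q HQ)[Dx' P' vl]] := H (x + w); first by rewrite addrC addKr.
have wN : `|- w| <= 1 by rewrite normrN.
have := cost_semiconcave V_smooth VT e0 eK VC (D_norm_sum Dx') (D_regular Dx') wN.
set y := Phi V e 1 x al in up HQ Dx' P' vl *; set al' := velocity V e (x + w) y Q in Dx' P' vl *.
rewrite P' addrK normrN => lo.
have h1 : `|dotv (al' - al) w| <= 2 * (n%:R * `|w| ^+ 2).
  apply: le_trans (dotv_bound _ _) _; rewrite (addrC x w) addrK in vl.
  have := ler_wpM2l (ler0n R n) (ler_wpM2r (normr_ge0 w) vl).
  by rewrite expr2; move: (`|al' - al| : R) => a h; apply: le_trans h _; lra.
have E1 : dotv (al' - al) w = dotv al' w - dotv al w.
  by rewrite /dotv -sumrB; apply: eq_bigr => i _; rewrite !mxE mulrBl.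
have E2 : dotv al' (- w) = - dotv al' w by rewrite linearN.
rewrite E2 in lo; rewrite dotvNl; rewrite E1 ler_norml in h1; move/andP: h1 => [h1 h1'].
have ew : 0 <= n%:R * `|w| ^+ 2 by rewrite mulr_ge0// exprn_ge0.
have up' : (n%:R + 1) * `|w| ^+ 2 = n%:R * `|w| ^+ 2 + `|w| ^+ 2 by ring.
have E3 : (3 * n%:R + 1) * `|w| ^+ 2 = 3 * (n%:R * `|w| ^+ 2) + `|w| ^+ 2 by ring.
rewrite up' in up lo; rewrite E3 ler_norml.
move: (dotv al' w) (dotv al w) (cost V e (x + w) y) (cost V e x y) (n%:R * `|w| ^+ 2) (`|w| ^+ 2) up lo h1 h1' ew.
move=> a b c c' N w2 up lo h1 h1' ew.
by apply/andP; split; lra.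
Qed.

Lemma cost_is_diff x al : D (x, al) ->
  is_diff x (cost V e ^~ (Phi V e 1 x al)) (dotv (- al)).
Proof.
move=> Dx; have [d d0 H] := cost_expansion Dx.
apply: (is_diff_quadratic _ d0 H); by rewrite addr_ge0// mulr_ge0.
Qed.

(** Every point of [Kset] over [x] is the end point of some [(x, al')] in [D], and the gradient
    there is [- al']; equal gradients thus force equal end points. *)
Lemma cexp_Phi x al : D (x, al) ->
  cexp (cost V e) (Kset V e D) x al = Phi V e 1 x al.
Proof.
move=> Dx; apply: get_unique => /=.
  have h := cost_is_diff Dx; split; last exact: is_diff_grad.
    by exists (x, al).
  exact: ex_diff.
move=> y [[[x' al'] /= Dx' [xx <-]] _ gy].
rewrite xx in Dx' gy *; have := is_diff_grad (cost_is_diff Dx').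
by rewrite gy => /oppr_inj <-.
Qed.

End CostExpansion.

(** * Second variation of the cost and cross-curvature *)

Section Curves.
Context {R : realType}.

Lemma near_ball0 (P : R -> Prop) (s d : R) : `|s| < d -> (forall t, `|t| < d -> P t) -> \forall t \near s, P t.
Proof.
move=> sd H; apply/nbhs_ballP; exists (d - `|s|) => /=; first by rewrite subr_gt0.
move=> t; rewrite -ball_normE/= => st; apply: H.
rewrite -[t](subrK s) (le_lt_trans (ler_normD _ _))// distrC.
by move: (`|_| : R) (`|s| : R) sd st => a b *; lra.
Qed.

Lemma derive1n2_eq (f h : R -> R) (c d : R) : 0 < d ->
  (forall s : R, `|s| < d -> is_derive s 1 f (h s)) -> is_derive (0 : R) 1 h c ->
  derive1n 2 f 0 = c.
Proof.
move=> d0 fh hc; rewrite derive1nS derive1n1 derive1E.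
rewrite (@near_eq_derive _ _ _ _ h); first exact: derive_val.
apply: (@near_ball0 _ _ d); first by rewrite normr0.
by move=> t /fh ft; rewrite derive1E; exact: derive_val.
Qed.

Lemma MVT_sym (f df : R -> R) (a b : R) : (forall t : R, is_derive t 1 f (df t)) ->
  exists2 c, (forall M, `|a| <= M -> `|b| <= M -> `|c| <= M) /\ `|c - a| <= `|b - a| &
    f b - f a = df c * (b - a).
Proof.
move=> fdf; have cont (u v : R) : {within `[u, v], continuous f}.
  by apply: derivable_within_continuous => t _; exact: (@ex_derive _ _ _ _ _ _ _ (fdf t)).
have [ab|/ltW ba] := leP a b.
  have [c] := MVT_segment ab (fun t _ => fdf t) (@cont a b).
  rewrite in_itv/= => /andP[ac cb] fE; exists c => //; split.
    by move=> M; rewrite !ler_norml => /andP[a1 a2] /andP[b1 b2]; apply/andP; split; lra.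
  by rewrite !ger0_norm ?subr_ge0//; lra.
have [c] := MVT_segment ba (fun t _ => fdf t) (@cont b a).
rewrite in_itv/= => /andP[bc ca] fE; exists c => //; last by rewrite -opprB fE; ring.
split; first by move=> M; rewrite !ler_norml => /andP[a1 a2] /andP[b1 b2]; apply/andP; split; lra.
by rewrite !ler0_norm ?subr_le0//; lra.
Qed.

Context {n : nat}.
Implicit Types (g : R -> 'rV[R]_n) (y : 'rV[R]_n).

Lemma smooth_derive_coord g (t : R) i : smooth g -> is_derive t 1 (fun t => g t 0 i) ('D_1 g t 0 i).
Proof.
move=> sg; apply: (@is_derive_linear _ _ _ (fun v : 'rV[R]_n => v 0 i)).
- by move=> a b; rewrite !mxE.
- by move=> a b; rewrite !mxE.
- exact: coord_continuous.
- by apply: DeriveDef => //; apply: diff_derivable; exact: smooth_diff.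
Qed.

Lemma is_derive_along (f : 'rV[R]_n -> R) (al : 'rV[R]_n) g (t : R) : is_diff (g t) f (dotv al) ->
  differentiable g t -> is_derive t 1 (fun t => f (g t)) (dotv al ('D_1 g t)).
Proof.
move=> hf dg; have df : differentiable f (g t) by exact: ex_diff.
have dfg : differentiable (f \o g) t by exact: differentiable_comp.
apply: DeriveDef; first exact: diff_derivable.
have dE : 'd f (g t) = dotv al :> (_ -> _) by exact: diff_val.
by rewrite (deriveE _ dfg) (diff_comp dg df) (deriveE _ dg) -dE.
Qed.

Lemma smooth_bounded1 g : smooth g -> exists2 B : R, 0 <= B & forall t : R, `|t| <= 1 -> `|g t| <= B.
Proof.
move=> sg; have : compact (g @` `[- 1, 1]%classic).
  apply: continuous_compact; last exact: segment_compact.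
  by apply: continuous_subspaceT; exact: smooth_cont.
move=> /compact_bounded[M [Mr fM]]; exists (`|M| + 1); first by rewrite addr_ge0.
move=> t t01; apply: (fM (`|M| + 1)); last by exists t => //=; rewrite in_itv/= -ler_norml.
by rewrite ltr_pwDr// ler_norm.
Qed.

Lemma curve_taylor g : smooth g -> exists2 B : R, 0 <= B & forall t t' : R,
  `|t| <= 1 -> `|t'| <= 1 -> `|g t' - g t - (t' - t) *: 'D_1 g t| <= B * (t' - t) ^+ 2.
Proof.
move=> sg; have sg1 := smooth_D (1 : R) sg.
have [B B0 gB] := smooth_bounded1 (smooth_D (1 : R) sg1).
exists B => // t t' t1 t'1; apply/rV_normP => [|i]; first by rewrite mulr_ge0// sqr_ge0.
have [c [cM ct] E1] := MVT_sym t t' (fun r => smooth_derive_coord r i sg).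
have [c' [c'M _] E2] := MVT_sym t c (fun r => smooth_derive_coord r i sg1).
rewrite !mxE E1 [(t' - t) * _]mulrC -mulrBl E2 !normrM.
have -> : (t' - t) ^+ 2 = `|t' - t| * `|t' - t| by rewrite -expr2 real_normK ?num_real.
rewrite mulrA ler_wpM2r//.
apply: ler_pM => //; apply: le_trans (coord_le _ _) _; apply: gB.
by apply: c'M => //; exact: cM.
Qed.

(** Families are parametrized by [[-1, 1]]; the factor [rho] restricts them to times at which [g] is
    close to its starting point. *)
Lemma curve_qdv g y (rho : R) : smooth g -> 0 <= rho <= 1 ->
  quad_derivv (fun s r => (1 - r) *: g (rho * s) + r *: y)
      (fun s r => (1 - r) *: (rho *: 'D_1 g (rho * s))).
Proof.
move=> sg /andP[rho0 rho1].
have [B0 B00 g0B] := smooth_bounded1 sg.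
have [B1 B10 g1B] := smooth_bounded1 (smooth_D (1 : R) sg).
have [B2 B20 g2B] := curve_taylor sg.
have y0 := normr_ge0 y.
have rs s : `|s| <= 1 -> `|rho * s| <= 1.
  by move=> s1; rewrite normrM ger0_norm// mulr_ile1.
have contr (c : R) (v : 'rV[R]_n) : 0 <= c <= 1 -> `|c *: v| <= `|v|.
  by move=> /andP[c0 c1]; rewrite normrZ ger0_norm// ler_piMl.
have r1 (r : R) : 0 <= r <= 1 -> 0 <= 1 - r <= 1 by lra.
apply: (@quad_derivv_intro _ _ _ _ (B0 + B1 + B2 + `|y|)).
- move=> s r s1 r01; apply: le_trans (ler_normD _ _) _.
  have := le_trans (contr _ _ (r1 r r01)) (g0B _ (rs _ s1)).
  have := contr _ y r01.
  by move: (`|r *: y| : R) (`|_ *: g _| : R) (`|y| : R) y0 => *; lra.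
- move=> s r s1 r01.
  have h : `|rho *: 'D_1 g (rho * s)| <= B1.
    by apply: le_trans (contr _ _ _) (g1B _ (rs _ s1)); rewrite rho0.
  have := le_trans (contr _ _ (r1 r r01)) h.
  by move: (`|(1 - r) *: _| : R) (`|y| : R) y0 => *; lra.
- move=> s s' r s1 s'1 r01.
  have -> : (1 - r) *: g (rho * s') + r *: y - ((1 - r) *: g (rho * s) + r *: y) -
      (s' - s) *: ((1 - r) *: (rho *: 'D_1 g (rho * s))) =
      (1 - r) *: (g (rho * s') - g (rho * s) - (rho * s' - rho * s) *: 'D_1 g (rho * s)).
    by apply/rowP => i; rewrite !mxE; ring.
  apply: le_trans (contr _ _ (r1 r r01)) _.
  apply: le_trans (g2B _ _ (rs _ s1) (rs _ s'1)) _.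
  rewrite -mulrBr exprMn mulrA ler_wpM2r ?sqr_ge0//.
  have rho2 : rho ^+ 2 <= 1 by rewrite expr_le1.
  by have := ler_wpM2l B20 rho2; move: (`|y| : R) y0 => *; lra.
Qed.

End Curves.

Section SecondVariation.
Context {R : realType} {n : nat}.
Implicit Types (x y al be w u : 'rV[R]_n) (t r : R) (Q J : R -> 'rV[R]_n).
Variables (V : 'rV[R]_n -> R) (V_smooth : smooth V) (B M K : R) (VT : Vtame V M K).
Variables (e : R) (e0 : 0 <= e) (eK : e * ((n%:R + 1) * K) <= 2^-1).
Variables (C : R) (VC : forall x, V x <= C).
Variables (D : set ('rV[R]_n * 'rV[R]_n)) (D_open : open D).
Hypothesis D_regular : forall x al, D (x, al) -> regular V e x al.
Hypothesis D_bound : forall x al, D (x, al) -> `|x| <= B /\ `|al| <= B.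
Hypothesis BM : 3 * B + 5 <= M.
Let K0 : 0 <= K. Proof. by have := Vtame_K VT; lra. Qed.
Let nK0 : 0 <= n%:R * K. Proof. by rewrite mulr_ge0. Qed.
Let enK : `|e| * (n%:R * K) <= 2^-1.
Proof. by rewrite ger0_norm//; apply: le_trans eK; rewrite ler_wpM2l// mulrDl mul1r lerDl. Qed.
Let eK1' : `|e| * K <= 2^-1.
Proof. by rewrite ger0_norm//; apply: le_trans eK; rewrite ler_wpM2l// mulrDl mul1r lerDr. Qed.
Let eK1 : e * K <= 2^-1. Proof. by have := eK1'; rewrite ger0_norm. Qed.

Lemma jacobi_unique (Q Q' Z Z' : R -> 'rV[R]_n) (a : R -> 'rV[R]_n) :
  cont01 Q -> cont01 Q' -> cont01 Z -> cont01 Z' -> (forall t, 0 <= t <= 1 -> `|Q t| <= M) ->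
  (forall t, 0 <= t <= 1 -> Q' t = Q t) ->
  (forall t, 0 <= t <= 1 -> Z t = a t + e *: vop bvp (fun r => amul (hs V (Q r)) (Z r)) t) ->
  (forall t, 0 <= t <= 1 -> Z' t = a t + e *: vop bvp (fun r => amul (hs V (Q' r)) (Z' r)) t) ->
  forall t, 0 <= t <= 1 -> Z' t = Z t.
Proof.
move=> WQ WQ' WZ WZ' QM QQ ZE ZE' t t01.
have WA (X Y : R -> 'rV[R]_n) : cont01 X -> cont01 Y -> cont01 (fun r => amul (hs V (X r)) (Y r)).
  by move=> WX WY; apply: cont01_amul => // i k; exact: cont01_hs.
apply/eqP; rewrite -subr_eq0 -normr_le0.
have -> : 0 = 2 * (0 + `|e| * 0) :> R by rewrite !(mulr0, addr0).
apply: (@fix_bound _ _ _ green_bvp (fun r => Z' r - Z r)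
   (fun r => amul (hs V (Q' r)) (Z' r) - amul (hs V (Q r)) (Z r)) (fun=> 0) e (n%:R * K) 0 0 _ _ nK0 (lexx 0) enK _ _ _ t t01).
- by apply: cont01_vD => //; exact: cont01_vN.
- by apply: cont01_vD; [|apply: cont01_vN]; exact: WA.
- move=> r r01; rewrite (ZE' r r01) (ZE r r01) (vopB green_bvp (WA _ _ WQ' WZ') (WA _ _ WQ WZ) r01).
  by move: (vop _ _ _) (vop _ _ _) => b c; apply/rowP => i; rewrite !mxE; ring.
- by move=> r r01; rewrite normr0.
- move=> r r01; rewrite addr0 (QQ r r01).
  have -> : amul (hs V (Q r)) (Z' r) - amul (hs V (Q r)) (Z r) = amul (hs V (Q r)) (Z' r - Z r).
    by rewrite amulD; congr (_ + _); rewrite -scaleN1r -[in RHS]scaleN1r amulZ.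
  rewrite -mulrA; apply: amul_bound => //; apply: (hs_bound VT); exact: QM.
Qed.


(** For all small [t], the gradient of the cost at [g t] is [- b t], with [b t] the initial velocity
    of the solution from [g t] to the fixed end point, because [(g t, b t)] is still in [D]. The
    first derivative is thus explicit near [0], and what remains is [b' 0 = mu (- u + e P)]. *)
Lemma cost_second_variation x al (g : R -> 'rV[R]_n) u (mu : R) Q J : D (x, al) -> smooth g -> g 0 = x ->
  'D_1 g 0 = mu *: u -> ivp V M e x al Q -> cont01 J ->
  (forall t, 0 <= t <= 1 ->
    J t = (1 - t) *: u + e *: vop bvp (fun r => amul (hs V (Q r)) (J r)) t) ->
  derive1n 2 (fun t => cost V e (g t) (Phi V e 1 x al)) 0 =
    mu ^+ 2 * dotv u u
    - e * mu ^+ 2 * dotv u (vop prim2 (fun r => amul (hs V (Q r)) (J r)) 1)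
    - dotv al ('D_1 ('D_1 g) 0).
Proof.
move=> Dx sg g0 gu HQ WJ JE.
have [d /andP[d0 d1] Hd] := nearby V_smooth VT e0 eK1 D_open D_regular D_bound BM Dx.
have y1 : Phi V e 1 x al = Q 1.
  have [Q' HQ' ->] := D_ivp V_smooth VT e0 eK1 D_regular D_bound BM Dx; last exact: le01.
  exact: (ivp_unique V_smooth VT e0 eK1 HQ HQ' (@le01 R)).
have HQb : bv V M e x (Phi V e 1 x al) Q by rewrite y1; exact: (ivp_bv HQ).
set y := Phi V e 1 x al in Hd y1 HQb *.
have [rho0 rho00 gd] : exists2 rho0 : R, 0 < rho0 & forall t, `|t| < rho0 -> `|g t - x| < d.
  have cg : continuous g by exact: smooth_cont.
  have := cg 0; move=> /cvgrPdist_lt/(_ d d0)/nbhs_ballP[rho0 /= rho00 H].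
  exists rho0 => // t t0; rewrite distrC -g0; apply: H.
  by rewrite -ball_normE/= sub0r normrN.
have ex t : exists Z, `|t| < rho0 -> bv V M e (g t) y Z.
  have [t0|_] := boolP (`|t| < rho0); last by exists 0 => t0; discriminate t0.
  by have [[Z HZ] _] := Hd _ (gd t t0); exists Z.
have [Qf HQf] := choice ex.
pose b t := velocity V e (g t) y (Qf t).
have Hb t : `|t| < rho0 -> [/\ D (g t, b t), Phi V e 1 (g t) (b t) = y & `|b t - al| <= 2 * `|g t - x|].
  by move=> t0; have [_ /(_ _ (HQf t t0))] := Hd _ (gd t t0).
have F1 t : `|t| < rho0 ->
    is_derive t 1 (fun t => cost V e (g t) y) (dotv (- b t) ('D_1 g t)).
  move=> /Hb[Dt Pt _].
  have := cost_is_diff V_smooth VT e0 eK1 VC D_open D_regular D_bound BM Dt; rewrite Pt => hc.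
  exact: (is_derive_along hc (smooth_diff t sg)).
apply: (derive1n2_eq rho00 F1).
(* The solution chosen at [t = 0] need not be [Q] by construction, but the bound on [b t - al]
   vanishes there. *)
have b0 : b 0 = al.
  have [|_ _] := Hb 0; first by rewrite normr0.
  by rewrite g0 subrr normr0 mulr0 normr_le0 subr_eq0 => /eqP.
set P := vop prim2 _ 1.
have db i : is_derive (0 : R) 1 (fun t => b t 0 i) (mu * (- u 0 i + e * P 0 i)).
  pose rho := Num.min (rho0 / 2) 1.
  have rho_gt0 : 0 < rho by rewrite lt_min ltr01 divr_gt0.
  have rho_le1 : rho <= 1 by rewrite ge_min lexx orbT.
  have rho_lt : rho < rho0.
    by apply: (@le_lt_trans _ _ (rho0 / 2)); [rewrite ge_min lexx|lra].
  clearbody rho.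
  pose X s := Qf (rho * s).
  have rs s : `|s| <= 1 -> `|rho * s| < rho0.
    move=> s1; apply: le_lt_trans rho_lt; rewrite normrM gtr0_norm//.
    by rewrite ler_piMr// ltW.
  have HX s : `|s| <= 1 -> bv V M e (g (rho * s)) y (X s) by move=> /rs; exact: HQf.
  have rho01 : 0 <= rho <= 1 by rewrite ltW.
  have [|||X1 [WX1 X1E qX]] := @nl_derivative _ _ V V_smooth M K VT _ green_bvp X
      (fun s r => (1 - r) *: g (rho * s) + r *: y)
      (fun s r => (1 - r) *: (rho *: 'D_1 g (rho * s))) e eK1' enK _ (curve_qdv y sg rho01).
  - move=> s s1; split; first by have [] := HX s s1.
    apply: cont01_vZ; last exact: cont01_vcst.
    by apply: cont01_D; [exact: cont01_cst|apply: cont01_N; exact: cont01_id].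
  - by move=> s t s1; have [_ h _] := HX s s1; exact: h.
  - by move=> s t s1; have [_ _ h] := HX s s1; exact: h.
  have s0 : `|0 : R| <= 1 by rewrite normr0 ler01.
  have [WX0 X0M X0E] := HX 0 s0.
  have [WQ QM QE] := HQ.
  have X0Q t : 0 <= t <= 1 -> X 0 t = Q t.
    move=> t01; apply/eqP; rewrite -subr_eq0 -normr_le0.
    have HX0 := HX 0 s0; rewrite mulr0 g0 in HX0.
    by have := bv_lip V_smooth VT e0 eK1 HQb HX0 t01; rewrite subrr normr0 mulr0.
  have WQJ : cont01 (fun r => amul (hs V (Q r)) (J r)).
    by apply: cont01_amul => // i' k; exact: cont01_hs.
  (* At [s = 0] the derivative of the family solves the Jacobi equation along [Q] with boundary
     values [(rho * mu) *: u] and [0], so it is a multiple of [J]. *)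
  have X1J t : 0 <= t <= 1 -> X1 0 t = (rho * mu) *: J t.
    have WJ' : cont01 (fun t => (rho * mu) *: J t) by apply: cont01_vZ => //; exact: cont01_cst.
    apply: (jacobi_unique (a := fun t => (1 - t) *: (rho *: 'D_1 g 0)) WQ WX0 WJ' (WX1 0 s0) QM X0Q).
    - move=> r r01.
      have -> : (fun r => amul (hs V (Q r)) ((rho * mu) *: J r)) =
          fun r => (rho * mu) *: amul (hs V (Q r)) (J r).
        by apply/funext => r'; rewrite amulZ.
      rewrite (vopZ green_bvp (rho * mu) WQJ r01) {1}(JE r r01) gu.
      by move: (vop _ _ _) => c; apply/rowP => j; rewrite !mxE; ring.
    - by move=> r r01; rewrite {1}(X1E 0 r s0 r01) mulr0.
  have Wc (f : R -> 'rV[R]_n) j : cont01 f -> cont01 (fun r => f r 0 j).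
    by move=> Wf; move: j; apply/cont01_rVP.
  have WG s : `|s| <= 1 -> cont01 (fun r => grad V (X s r) 0 i).
    by move=> s1; apply: Wc; apply: (cont01_grad V_smooth); have [] := HX s s1.
  have WH s : `|s| <= 1 -> cont01 (fun r => amul (hs V (X s r)) (X1 s r) 0 i).
    move=> s1; have [WXs _ _] := HX s s1; apply: Wc.
    by apply: cont01_amul => [i' k|]; [exact: cont01_hs|exact: WX1].
  have qG : quad_deriv (fun s r => grad V (X s r) 0 i) (fun s r => amul (hs V (X s r)) (X1 s r) 0 i).
    have XM s r : `|s| <= 1 -> 0 <= r <= 1 -> `|X s r| <= M.
      by move=> s1; have [_ h _] := HX s s1; exact: h.
    apply: quad_deriv_ext (quad_deriv_comp (smooth_D (delta_mx 0 i) V_smooth) qX XM) => s r; first by rewrite mxE.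
    by rewrite mxE; apply: eq_bigr => k _; rewrite mulrC.
  have s00 : `|0 : R| < 1 by rewrite normr0 ltr01.
  have dPsi := quad_deriv_derive (quad_deriv_green green_prim2 WG WH qG) s00 (@le01 R).
  have PsiE : prim2 (fun r => amul (hs V (X 0 r)) (X1 0 r) 0 i) 1 = rho * mu * P 0 i.
    have Wi : cont01 (fun r => amul (hs V (Q r)) (J r) 0 i) by exact: Wc.
    rewrite mxE -(prim2Z (rho * mu) Wi (@le01 R)).
    apply: prim2_ext => r r01; rewrite (X1J r r01) (X0Q r r01) amulZ mxE.
    by [].
  rewrite PsiE in dPsi.
  pose Psi s := prim2 (fun r => grad V (X s r) 0 i) 1.
  have dl : is_derive (0 : R) 1 (fun t => rho^-1 * t) rho^-1.
    by have := is_derive_mull rho^-1 (is_derive_id (0 : R) 1); rewrite mulr1.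
  have dPsi' : is_derive (0 : R) 1 (fun t => Psi (rho^-1 * t)) (rho * mu * P 0 i * rho^-1).
    apply: (@is_derive1_comp _ Psi (fun t => rho^-1 * t)); by rewrite mulr0.
  have -> : (fun t => b t 0 i) = fun t => y 0 i - g t 0 i + e * Psi (rho^-1 * t).
    apply/funext => t.
    have XE : X (rho^-1 * t) = Qf t by rewrite /X mulrA divff ?mul1r// gt_eqF.
    have rowE (v w : 'rV[R]_n) : (y - v + e *: w) 0 i = y 0 i - v 0 i + e * w 0 i by rewrite !mxE.
    have vopE (f : R -> 'rV[R]_n) : vop prim2 f 1 0 i = prim2 (fun r => f r 0 i) 1 by rewrite mxE.
    by rewrite /Psi XE /b /velocity rowE vopE.
  have dg := smooth_derive_coord (0 : R) i sg.
  have := is_deriveD (is_deriveB (is_derive_cst (y 0 i) (0 : R) 1) dg) (is_derive_mull e dPsi').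
  move=> db; apply: (@is_derive_eq _ _ _ _ _ _ _ _ db); rewrite gu mxE; move: (P 0 i) => p.
  by field; rewrite gt_eqF.
have -> : (fun t => dotv (- b t) ('D_1 g t)) = \sum_i (fun t => (- b t 0 i) * 'D_1 g t 0 i).
  by apply/funext => t; rewrite fct_sumE; apply: eq_bigr => i _; rewrite mxE.
clearbody P; rewrite -b0.
have -> : mu ^+ 2 * dotv u u - e * mu ^+ 2 * dotv u P - dotv (b 0) ('D_1 ('D_1 g) 0) =
   \sum_i (- (mu * (- u 0 i + e * P 0 i)) * 'D_1 g 0 0 i + - b 0 0 i * 'D_1 ('D_1 g) 0 0 i).
  rewrite gu /dotv !mulr_sumr -!sumrB; apply: eq_bigr => i _.
  have -> : (mu *: u) 0 i = mu * u 0 i by rewrite mxE.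
  by ring.
apply: is_derive_sum => i.
have := is_deriveM (is_deriveN (db i)) (smooth_derive_coord (0 : R) i (smooth_D (1 : R) sg)).
move=> db2; apply: (@is_derive_eq _ _ _ _ _ _ _ _ db2); by rewrite /GRing.scale/= addrC mulrC.
Qed.

(** Scaling enters as follows: [mu ^+ 2] comes from [g' 0 = mu *: u] in the second variation, and
    [la ^+ 2] from evaluating the jet family at [la * s] and differentiating twice in [s]. *)
Lemma curvature_formula x al (g : R -> 'rV[R]_n) u w (mu la : R)
    (q p o J J1 J2 : R -> R -> 'rV[R]_n) :
  D (x, al) -> smooth g -> g 0 = x -> 'D_1 g 0 = mu *: u ->
  jet_family V M e x al w u q p o J J1 J2 ->
  cross_curvature (cost V e) (Kset V e D) g x al (la *: w) =
    3 / 2 * (e * mu ^+ 2 * la ^+ 2 * dotv u (vop prim2 (jet2 V q p o J J1 J2 0) 1)).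
Proof.
move=> Dx sg g0 gu jf; have [G1 [dG dG1]] := jet_second_derivative V_smooth jf.
pose Ga s := dotv u (vop prim2 (fun r => amul (hs V (q s r)) (J s r)) 1).
have {}dG (s : R) : `|s| < 1 -> is_derive s 1 Ga (G1 s) by exact: dG.
set G2 := dotv u _ in dG1 *.
pose gpp := 'D_1 ('D_1 g) (0 : R).
have [d0 /= d00 dD] : nbhs_ball (x, al) D by apply/nbhs_ballP; exact: D_open.
(* Two conditions on [s]: the perturbed covector stays in [D], and the parameter [la * s] stays in
   the range of the jet family. *)
have [d d_gt0 Hd] : exists2 d : R, 0 < d & forall s : R, `|s| < d ->
    D (x, al + s *: (la *: w)) /\ `|la * s| < 1.
  have l1 : 0 < `|la| + 1 by rewrite ltr_wpDl.
  have l2 : 0 < `|la *: w| + 1 by rewrite ltr_wpDl.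
  exists (Num.min (d0 / (`|la *: w| + 1)) (1 / (`|la| + 1))).
    by rewrite lt_min !divr_gt0.
  move=> s; rewrite lt_min !ltr_pdivlMr// => /andP[s1 s2].
  have s0 := normr_ge0 s.
  split; last by rewrite normrM; have := normr_ge0 la; lra.
  apply: dD; split; rewrite -ball_normE/=; first by rewrite subrr normr0.
  rewrite opprD addrA subrr sub0r normrN normrZ; lra.
pose h (s : R) := mu ^+ 2 * dotv u u - e * mu ^+ 2 * Ga (la * s)
    - (dotv al gpp + s * (la * dotv w gpp)).
have FE s : `|s| < d ->
    derive1n 2 (fun t => cost V e (g t) (cexp (cost V e) (Kset V e D) x (al + s *: (la *: w)))) 0 = h s.
  move=> /Hd[Ds ls]; rewrite (cexp_Phi V_smooth VT e0 eK1 VC D_open D_regular D_bound BM Ds).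
  have [Wq _ _ WJ _] := jf_W jf (ltW ls).
  have HQ : ivp V M e x (al + s *: (la *: w)) (q (la * s)).
    split=> // t t01; first exact: (jf_M jf (ltW ls) t01).
    by rewrite {1}(jf_q jf (ltW ls) t01) scalerA [s * la]mulrC.
  rewrite (cost_second_variation Ds sg g0 gu HQ WJ (fun t t01 => jf_J jf (ltW ls) t01)).
  have dE : dotv (al + s *: (la *: w)) gpp = dotv al gpp + s * (la * dotv w gpp).
    rewrite /dotv !mulr_sumr -big_split; apply: eq_bigr => i _ /=.
    have -> : (al + s *: (la *: w)) 0 i = al 0 i + s * (la * w 0 i) by rewrite !mxE.
    by ring.
  by rewrite dE.
have dlin (s : R) : is_derive s 1 (fun s => la * s) la.
  by have := is_derive_mull la (is_derive_id s (1 : R)); rewrite mulr1.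
pose h1 (s : R) := - (e * mu ^+ 2 * (G1 (la * s) * la)) - la * dotv w gpp.
have dh (s : R) : `|s| < d -> is_derive s 1 h (h1 s).
  move=> /Hd[_ ls].
  have dGs := @is_derive1_comp _ Ga (fun s => la * s) s _ _ (dG _ ls) (dlin s).
  have d2 := is_deriveB (is_derive_cst (mu ^+ 2 * dotv u u) s (1 : R)) (is_derive_mull (e * mu ^+ 2) dGs).
  have d3 : is_derive s 1 (fun s => s * (la * dotv w gpp)) (la * dotv w gpp).
    have := is_derive_mull (la * dotv w gpp) (is_derive_id s (1 : R)); rewrite mulr1.
    by under eq_fun do rewrite mulrC.
  have d4 := is_deriveB d2 (is_deriveD (is_derive_cst (dotv al gpp) s (1 : R)) d3).
  by apply: (@is_derive_eq _ _ _ _ _ _ _ _ d4); rewrite /h1 sub0r add0r.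
have dh1 : is_derive (0 : R) 1 h1 (- (e * mu ^+ 2 * (G2 * la * la))).
  have dG1' : is_derive (la * 0) 1 G1 G2 by rewrite mulr0.
  have dGs := @is_derive1_comp _ G1 (fun s => la * s) 0 _ _ dG1' (dlin 0).
  have d1 : is_derive (0 : R) 1 (fun s => - (e * mu ^+ 2 * la) * G1 (la * s))
     (- (e * mu ^+ 2 * la) * (G2 * la)) by exact: is_derive_mull.
  have d2 := is_deriveB d1 (is_derive_cst (la * dotv w gpp) (0 : R) 1).
  have -> : h1 = fun s => - (e * mu ^+ 2 * la) * G1 (la * s) - la * dotv w gpp.
    by apply/funext => s; rewrite /h1; ring.
  by apply: (@is_derive_eq _ _ _ _ _ _ _ _ d2); ring.
rewrite /cross_curvature (@derive1n2_eq _ _ h1 _ d d_gt0 _ dh1); first by ring.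
move=> s sd; apply: near_eq_is_derive (dh s sd).
by apply: (near_ball0 sd) => t td; rewrite FE.
Qed.

End SecondVariation.

(** * Unit directions and uniform asymptotics of the cross-curvature *)

Section Asymptotics.
Context {R : realType} {n : nat}.
Implicit Types (x al u w : 'rV[R]_n).

(** For [u = 0] this is [0], so [directionE] and [norm_direction] hold for every vector. *)
Definition direction u : 'rV[R]_n := (enorm u)^-1 *: u.

Lemma enorm_ge0 u : 0 <= enorm u. Proof. exact: sqrtr_ge0. Qed.

Lemma enorm_eq0 u : enorm u = 0 -> u = 0.
Proof.
move=> u0; have /eqP : dotv u u = 0 by rewrite -enorm_sqr u0 expr0n.
rewrite psumr_eq0 => [/allP H|i _]; last by rewrite -expr2 sqr_ge0.
apply/rowP => i; rewrite mxE; apply/eqP.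
by have := H i (mem_index_enum i); rewrite -expr2 sqrf_eq0.
Qed.

Lemma enormZ (c : R) u : 0 <= c -> enorm (c *: u) = c * enorm u.
Proof.
move=> c0; rewrite /enorm.
have -> : dotv (c *: u) (c *: u) = c ^+ 2 * dotv u u.
  by rewrite /dotv mulr_sumr; apply: eq_bigr => i _; rewrite !mxE; ring.
by rewrite sqrtrM ?sqr_ge0// sqrtr_sqr ger0_norm.
Qed.

Lemma enorm0 : enorm (0 : 'rV[R]_n) = 0.
Proof. by rewrite -(scale0r 0) enormZ// mul0r. Qed.

Lemma enorm_direction u : u != 0 -> enorm (direction u) = 1.
Proof.
move=> u0; rewrite enormZ ?invr_ge0 ?enorm_ge0// mulVf//.
by apply: contra_neq u0 => /enorm_eq0.
Qed.

Lemma directionE u : u = enorm u *: direction u.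
Proof.
rewrite /direction scalerA; have [/enorm_eq0->|u0] := eqVneq (enorm u) 0.
  by rewrite scaler0.
by rewrite divff// scale1r.
Qed.

Lemma norm_le_enorm u : `|u| <= enorm u.
Proof.
apply/rV_normP => [|i]; first exact: enorm_ge0.
rewrite -sqrtr_sqr ler_wsqrtr// /dotv (bigD1 i)//= expr2 lerDl.
by apply: sumr_ge0 => j _; rewrite -expr2 sqr_ge0.
Qed.

Lemma norm_direction u : `|direction u| <= 1.
Proof.
have [->|u0] := eqVneq u 0; first by rewrite /direction scaler0 normr0.
by apply: le_trans (norm_le_enorm _) _; rewrite enorm_direction.
Qed.

(** [e0] precedes [D] and all vectors. [D] is quantified after [e], since it will be the
    intersection of [U] with a set that itself varies with [e]. *)
Lemma curvature_asymptotics (V : 'rV[R]_n -> R) (U : set ('rV[R]_n * 'rV[R]_n)) (C : R) :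
  smooth V -> has_ubound (range V) -> bounded_set U -> 0 < C ->
  exists2 e0 : R, 0 < e0 & forall (e : R) (D : set ('rV[R]_n * 'rV[R]_n)), 0 < e < e0 ->
    open D -> D `<=` U -> (forall x al, D (x, al) -> regular V e x al) ->
    forall x al u a1 (g : R -> 'rV[R]_n), D (x, al) -> smooth g -> g 0 = x -> derive1 g 0 = u ->
    exists2 G : R, `|G - hess_integral V x al (direction u) (direction a1)| <= C / 2 &
      cross_curvature (cost V e) (Kset V e D) g x al a1 =
        3 / 2 * (e * enorm u ^+ 2 * enorm a1 ^+ 2 * G).
Proof.
move=> V_smooth [C0 VC0] [B0 [_ UB0]] C_gt0.
have VC x : V x <= C0 by apply: VC0; exists x.
pose B := `|B0| + 1; have BB0 : B0 < B by rewrite ltr_pwDr// ler_norm.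
have B1 : 0 <= B by rewrite addr_ge0.
have UB x al : U (x, al) -> `|x| <= B /\ `|al| <= B.
  by move=> /(UB0 B BB0)/=; rewrite prod_normE ge_max => /andP[].
(* The main demand on [M] is that of [bv_exists] in [nearby]: initial points up to [B + 1] together
   with end points up to [2 * B + 1]. *)
clearbody B; pose M := 3 * B + 5.
have [K VT] := Vtame_exists M V_smooth; have K1 := Vtame_K VT.
have [A A0 jetA] := jet_estimate V_smooth VT.
have N0 : 0 <= n%:R :> R by [].
have K2 : 0 < 2 * ((n%:R + 1) * K) by rewrite !mulr_gt0//; lra.
have A2 : 0 < 2 * (n%:R * A + 1) by rewrite mulr_gt0// ltr_wpDl// mulr_ge0.
(* The three bounds serve, in order, [e <= 1] in [jet_estimate], the contraction condition, and the
   final error [n A e <= C / 2]. *)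
exists (Num.min 1 (Num.min (1 / (2 * ((n%:R + 1) * K))) (C / (2 * (n%:R * A + 1))))).
  by rewrite !lt_min ltr01 !divr_gt0.
move=> e D /andP[e0]; rewrite !lt_min => /and3P[e1].
rewrite ltr_pdivlMr// ltr_pdivlMr// => eK eA D_open DU D_regular x al u a1 g Dx sg g0 gu.
have {}eK : e * ((n%:R + 1) * K) <= 2^-1.
  by move: (_ * K) eK => k eK; lra.
have D_bound x' al' : D (x', al') -> `|x'| <= B /\ `|al'| <= B by move=> /DU/UB.
have [xB aB] := D_bound x al Dx.
have wM : `|x| + `|al| + `|direction a1| <= M - 1.
  apply: le_trans (lerD (lerD xB aB) (norm_direction a1)) _; rewrite /M; lra.
have [q [p [p1 [J [J1 [J2 jf]]]]]] :=
  jet_family_exists V_smooth VT (direction u) (ltW e0) eK wM.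
have gu' : 'D_1 g 0 = enorm u *: direction u by rewrite -directionE -gu derive1E.
exists (dotv (direction u) (vop prim2 (jet2 V q p p1 J J1 J2 0) 1)); last first.
  rewrite {1}(directionE a1).
  exact: (curvature_formula V_smooth VT (ltW e0) eK VC D_open D_regular D_bound (lexx M) (enorm a1) Dx sg g0 gu' jf).
have s0 : `|0 : R| <= 1 by rewrite normr0.
have Wj := cont01_jet2 V_smooth jf s0.
have Wr := @cont01_jet2_ref _ _ V V_smooth x al (direction a1) (direction u).
have dB : dotv (direction u) (vop prim2 (jet2 V q p p1 J J1 J2 0) 1) -
    dotv (direction u) (vop prim2 (jet2_ref V x al (direction a1) (direction u)) 1) =
    dotv (direction u)
      (vop prim2 (fun r => jet2 V q p p1 J J1 J2 0 r - jet2_ref V x al (direction a1) (direction u) r) 1).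
  by rewrite (vopB green_prim2 Wj Wr (@le01 R)) linearB.
rewrite (hess_integralE V_smooth) dB; apply: le_trans (dotv_bound _ _) _.
have Ae : 0 <= A * e by rewrite mulr_ge0// ltW.
have h : `|vop prim2 (fun r => jet2 V q p p1 J J1 J2 0 r -
    jet2_ref V x al (direction a1) (direction u) r) 1| <= A * e.
  apply: (vop_bound green_prim2 Ae (cont01_vD Wj (cont01_vN Wr)) (@le01 R)).
  apply: (jetA _ _ _ _ _ _ _ _ _ _ _ _ eK (norm_direction a1) (norm_direction u) wM jf).
  by rewrite !ltW.
have h2 := ler_pM (normr_ge0 _) (normr_ge0 _) (norm_direction u) h.
apply: le_trans (ler_wpM2l N0 h2) _.
have -> : n%:R * (1 * (A * e)) = e * (n%:R * A) by ring.
by move: (n%:R * A) eA; clear -e0 => a eA; lra.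
Qed.

End Asymptotics.

Unset Implicit Arguments.

Theorem theorem5p1 (R : realType) (n : nat) (V : 'rV[R]_n -> R)
    (V_smooth : smooth V) (V_bounded : has_ubound (range V))
    (Ueps : R -> set ('rV[R]_n * 'rV[R]_n))
    (Ueps_open : forall eps : R, 0 < eps -> open (Ueps eps))
    (Ueps_regular : forall (eps : R) (x a : 'rV[R]_n), 0 < eps ->
      Ueps eps (x, a) -> regular V eps x a /\ ~ conjugate_locus V eps x a)
    (U : set ('rV[R]_n * 'rV[R]_n)) (U_open : open U)
    (U_bounded : bounded_set U) (C : R) (C_gt0 : 0 < C) :
  ((forall x v u w : 'rV[R]_n, U (x, v) -> enorm u = 1 -> enorm w = 1 ->
      C <= hess_integral V x v u w) ->
   exists2 eps0 : R, 0 < eps0 & forall eps : R, 0 < eps < eps0 ->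
     positively_cross_curved (cost V eps) (Kset V eps (Ueps eps `&` U))
       (Ueps eps `&` U)) /\
  ((forall x v u w : 'rV[R]_n, U (x, v) -> enorm u = 1 -> enorm w = 1 ->
      dotv u w = 0 -> C <= hess_integral V x v u w) ->
   exists2 eps0 : R, 0 < eps0 & forall eps : R, 0 < eps < eps0 ->
     strong_MTW (cost V eps) (Kset V eps (Ueps eps `&` U))
       (Ueps eps `&` U)).
Proof.
have [e0 e0_gt0 H] := curvature_asymptotics V_smooth V_bounded U_bounded C_gt0.
(* The integral bound is asked for one pair of directions only, so the two halves of the theorem
   differ only in how they supply it. *)
have main (eps : R) x a u a1 g : 0 < eps < e0 -> (Ueps eps `&` U) (x, a) -> smooth g -> g 0 = x ->
    derive1 g 0 = u ->
    (u != 0 -> a1 != 0 -> C <= hess_integral V x a (direction u) (direction a1)) ->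
    0 <= cross_curvature (cost V eps) (Kset V eps (Ueps eps `&` U)) g x a a1 /\
    (cross_curvature (cost V eps) (Kset V eps (Ueps eps `&` U)) g x a a1 = 0 -> u = 0 \/ a1 = 0).
  move=> eps0 Dx sg g0 gu; have [eps_gt0 _] := andP eps0.
  have D_open : open (Ueps eps `&` U) by apply: openI => //; exact: Ueps_open.
  have D_regular x' a' : (Ueps eps `&` U) (x', a') -> regular V eps x' a'.
    by move=> [/(Ueps_regular _ _ _ eps_gt0)[]].
  have [G HG ->] := H eps _ eps0 D_open (@subIsetr _ _ _) D_regular x a u a1 g Dx sg g0 gu.
  have [->|u0] := eqVneq u 0.
    by rewrite enorm0 expr0n/= mulr0 !mul0r mulr0; split=> // _; left.
  have [->|a0] := eqVneq a1 0.
    by rewrite enorm0 expr0n/= mulr0 !mul0r mulr0; split=> // _; right.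
  (* [G] is within [C / 2] of an integral that is at least [C]. *)
  move=> /(_ isT isT) hC; have G0 : 0 < G.
    by move: HG; rewrite ler_norml => /andP[]; move: (hess_integral _ _ _ _ _) hC => h hC *; lra.
  have enorm_gt0 (v : 'rV[R]_n) : v != 0 -> 0 < enorm v.
    by move=> v0; rewrite lt_def enorm_ge0 andbT; apply: contra_neq v0 => /enorm_eq0.
  have c0 : 0 < 3 / 2 * (eps * enorm u ^+ 2 * enorm a1 ^+ 2 * G).
    by rewrite !mulr_gt0 ?exprn_gt0 ?enorm_gt0// invr_gt0.
  by split; [exact: ltW|move=> c00; rewrite c00 ltxx in c0].
split=> hessC; exists e0 => // eps eps0 x a u a1 g Dx sg g0 gu.
  apply: (main eps x a u a1 g eps0 Dx sg g0 gu) => u0 a0.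
  by apply: hessC; [case: Dx|exact: enorm_direction..].
move=> a1u; apply: (main eps x a u a1 g eps0 Dx sg g0 gu) => u0 a0.
apply: hessC; [by case: Dx|exact: enorm_direction|exact: enorm_direction|].
have -> : dotv (direction u) (direction a1) = (enorm u)^-1 * (enorm a1)^-1 * dotv a1 u.
  by rewrite /dotv mulr_sumr; apply: eq_bigr => i _; rewrite !mxE; ring.
by rewrite a1u mulr0.
Qed.
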